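(* Let $1<p<\infty$, $p\ne2$, and let $X$ be a closed infinite-dimensional subspace of $L_p$. Then the following conditions on $X$ are equivalent: (i) The closed unit ball $B_X$ is compact in $L_1$. (ii) $X$ has property $(m_p)$. (iii) For any $\varepsilon>0$ there is a subspace $X_0$ of $\ell_p$ such that $d(X_0,X)<1+\varepsilon$.
   Context: $L_p=L_p(\mu)$ and $L_1=L_1(\mu)$, where $\mu$ is a nonatomic Borel probability measure on a compact metric space (so $L_p$ is separable and isometric to $L_p[0,1]$, and $L_p\subset L_1$). In (i), $B_X=\{x\in X:\|x\|_p\le1\}$ is regarded as a subset of $L_1$ with its norm topology. A separable Banach space $X$ has property $(m_p)$ if $\limsup_n\|x+x_n\|=\left(\|x\|^p+\limsup_n\|x_n\|^p\right)^{1/p}$ whenever $x\in X$ and $x_n\to0$ weakly in $X$. $d(X,Y)=\inf\|T\|\,\|T^{-1}\|$, over all surjective isomorphisms $T:X\to Y$, is the Banach–Mazur distance. *)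

(* Defs.v *)
From HB Require Import structures.
From mathcomp Require Import all_boot all_order all_algebra.
From mathcomp Require Import all_classical all_reals all_analysis.
From mathcomp Require Import measurable_realfun ess_sup_inf.

Set Implicit Arguments.
Unset Strict Implicit.
Unset Printing Implicit Defensive.
Import Order.TTheory GRing.Theory Num.Theory.
Import numFieldNormedType.Exports.
Local Open Scope classical_set_scope.
Local Open Scope ring_scope.
Local Open Scope quotient_scope.

(* The library defines [LspaceType mu p1], the a.e.-classes of functions with
   finite L^p-norm, without any algebraic or metric structure; it is made a
   normed space here, by transport from the L-module [LfunType mu p1]. *)
Section Lspace_normed.
Context d (T : measurableType d) (R : realType).
Variables (mu : {measure set T -> \bar R}) (p : \bar R) (p1 : (1 <= p)%E).

Local Notation Lsp := (LspaceType mu p1).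
Local Notation Lf := (LfunType mu p1).
Local Notation aemfun := ({mfun_ mu, T >-> measurableTypeR R}).
Implicit Types (f g h : Lsp) (u v w : Lf).

Lemma ae_eq_Lnorm (u v : T -> R) :
  measurable_fun setT u -> measurable_fun setT v -> u = v %[ae mu] ->
  Lnorm mu p (EFin \o u) = Lnorm mu p (EFin \o v).
Proof.
move=> mu_ mv uv; rewrite unlock /Lnorm; case: p p1 => [r r1|_|//].
- congr (_ `^ _)%E; apply: ae_eq_integral => //.
  + apply/measurable_EFinP/(@measurableT_comp _ _ _ _ _ _ (@powR R ^~ r)) => //.
    exact: measurableT_comp.
  + apply/measurable_EFinP/(@measurableT_comp _ _ _ _ _ _ (@powR R ^~ r)) => //.
    exact: measurableT_comp.
  + by apply: filterS uv => x + Dx => /(_ Dx)/= ->.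
- case: ifPn => // _; apply: eq_ess_sup.
  by apply: filterS uv => x /(_ I)/= ->.
Qed.

Lemma Lspace_repr_subproof f : (f : T -> R) \in Lfun mu p.
Proof.
rewrite inE; apply/andP; split; rewrite inE/=.
- exact: (@measurable_funPT _ _ _ _ (repr (f : aemfun))).
- exact: Lebesgue_finite.
Qed.

Definition Lrepr f : Lf := Lfun_Sub p1 (Lspace_repr_subproof f).

Lemma Lfun_mfunR_subproof u :
  (u : T -> measurableTypeR R) \in @mfun _ _ T (measurableTypeR R).
Proof. by rewrite inE; exact: (@measurable_funPT _ _ _ _ u). Qed.

Definition Lfun_mfunR u : {mfun T >-> measurableTypeR R} :=
  mfun_Sub (Lfun_mfunR_subproof u).

Definition Lclass_ae u : aemfun := \pi_aemfun (Lfun_mfunR u).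

Lemma Lclass_ae_repr u : (Lclass_ae u : T -> R) = u %[ae mu].
Proof.
have /eqP : \pi_aemfun (repr (Lclass_ae u)) = \pi_aemfun (Lfun_mfunR u).
  by rewrite reprK.
by rewrite eqmodE => /asboolP.
Qed.

Lemma Lclass_subproof u : finite_norm mu p (Lclass_ae u).
Proof.
rewrite /finite_norm (@ae_eq_Lnorm _ u).
- exact: Lfunction_finite.
- exact: (@measurable_funPT _ _ _ _ (repr (Lclass_ae u))).
- exact: measurable_funPT.
- exact: Lclass_ae_repr.
Qed.

Definition Lclass u : Lsp := @LebesgueSpace.Pack _ _ _ _ _ p1 (Lclass_ae u)
  (@LebesgueSpace.Class _ _ _ _ _ p1 _
    (isFinLebesgue.Build _ _ _ _ _ p1 _ (Lclass_subproof u))).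

Lemma Lrepr_class u : (Lrepr (Lclass u) : T -> R) = u %[ae mu].
Proof. exact: Lclass_ae_repr. Qed.

Lemma Lspace_inj f g : (f : aemfun) = g -> f = g.
Proof.
case: f => f [[ff]]; case: g => g [[gf]] /= fg.
by case: _ / fg gf => gf; rewrite (Prop_irrelevance ff gf).
Qed.

Lemma Lclass_eqP u v : Lclass u = Lclass v <-> (u : T -> R) = v %[ae mu].
Proof.
split=> [uv|uv].
  apply: ae_eq_trans (Lrepr_class v); rewrite -uv.
  by apply: ae_eq_sym; exact: Lrepr_class.
by apply: Lspace_inj => /=; apply/eqP; rewrite eqmodE; apply/asboolP.
Qed.

Lemma LreprK f : Lclass (Lrepr f) = f.
Proof.
apply: Lspace_inj => /=; rewrite -[RHS]reprK; apply/eqP.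
by rewrite eqmodE; apply/asboolP; exact: ae_eq_refl.
Qed.

HB.instance Definition _ := gen_eqMixin Lsp.
HB.instance Definition _ := gen_choiceMixin Lsp.

Definition Lspace_zero : Lsp := Lclass 0.
Definition Lspace_opp f : Lsp := Lclass (- Lrepr f).
Definition Lspace_add f g : Lsp := Lclass (Lrepr f + Lrepr g).
Definition Lspace_scale (a : R) f : Lsp := Lclass (a *: Lrepr f).
Definition Lspace_norm f : R := fine (Lnorm mu p (EFin \o f)).

Lemma Lclass_add u v : Lspace_add (Lclass u) (Lclass v) = Lclass (u + v).
Proof.
apply/Lclass_eqP; have := Lrepr_class v; apply: filterS2 (Lrepr_class u).
by move=> x /(_ I) /= ux /(_ I) /= vx _; congr (_ + _).
Qed.

Lemma Lclass_opp u : Lspace_opp (Lclass u) = Lclass (- u).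
Proof.
apply/Lclass_eqP; apply: filterS (Lrepr_class u).
by move=> x /(_ I) /= ux _; congr (- _).
Qed.

Lemma Lclass_scale a u : Lspace_scale a (Lclass u) = Lclass (a *: u).
Proof.
apply/Lclass_eqP; apply: filterS (Lrepr_class u).
by move=> x /(_ I) /= ux _; congr (_ * _).
Qed.

Fact Lspace_addA : associative Lspace_add.
Proof.
by move=> f g h; rewrite -(LreprK f) -(LreprK g) -(LreprK h) !Lclass_add addrA.
Qed.

Fact Lspace_addC : commutative Lspace_add.
Proof. by move=> f g; rewrite /Lspace_add addrC. Qed.

Fact Lspace_add0 : left_id Lspace_zero Lspace_add.
Proof. by move=> f; rewrite -(LreprK f) Lclass_add add0r. Qed.

Fact Lspace_addN : left_inverse Lspace_zero Lspace_opp Lspace_add.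
Proof. by move=> f; rewrite -(LreprK f) Lclass_opp Lclass_add addNr. Qed.

HB.instance Definition _ := GRing.isZmodule.Build Lsp
  Lspace_addA Lspace_addC Lspace_add0 Lspace_addN.

Fact Lspace_scaleA a b f :
  Lspace_scale a (Lspace_scale b f) = Lspace_scale (a * b) f.
Proof. by rewrite -(LreprK f) !Lclass_scale scalerA. Qed.

Fact Lspace_scale1 : left_id 1 Lspace_scale.
Proof. by move=> f; rewrite -(LreprK f) Lclass_scale scale1r. Qed.

Fact Lspace_scaleDr : right_distributive Lspace_scale +%R.
Proof.
move=> a f g; rewrite -(LreprK f) -(LreprK g).
by rewrite [_ + _]Lclass_add !Lclass_scale scalerDr [RHS]Lclass_add.
Qed.

Fact Lspace_scaleDl f : {morph Lspace_scale^~ f : a b / a + b}.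
Proof.
by move=> a b; rewrite -(LreprK f) !Lclass_scale scalerDl [RHS]Lclass_add.
Qed.

HB.instance Definition _ := GRing.Zmodule_isLmodule.Build R Lsp
  Lspace_scaleA Lspace_scale1 Lspace_scaleDr Lspace_scaleDl.

Lemma Lspace_norm_class u :
  Lspace_norm (Lclass u) = fine (Lnorm mu p (EFin \o u)).
Proof.
congr fine; apply: ae_eq_Lnorm (Lrepr_class u).
- exact: (@measurable_funPT _ _ _ _ (Lrepr (Lclass u))).
- exact: measurable_funPT.
Qed.

Fact Lspace_normD f g : Lspace_norm (f + g) <= Lspace_norm f + Lspace_norm g.
Proof. by rewrite Lspace_norm_class; exact: ler_LnormD. Qed.

Fact Lspace_normZ (a : R) f : Lspace_norm (a *: f) = `|a| * Lspace_norm f.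
Proof.
rewrite Lspace_norm_class (LnormZ (Lrepr f)) fineM//.
by rewrite -(finite_norm_fine (Lrepr f)).
Qed.

Fact Lspace_norm0_eq0 f : Lspace_norm f = 0 -> f = 0.
Proof.
move=> /(@fine_Lnormr_eq0 _ _ _ _ _ p1 (Lrepr f)) f0.
by rewrite -(LreprK f); apply/Lclass_eqP.
Qed.

HB.instance Definition _ := @Lmodule_isNormed.Build R Lsp
  Lspace_norm Lspace_normD Lspace_normZ Lspace_norm0_eq0.

End Lspace_normed.

Section Lspace_L1.
Context d (T : measurableType d) (R : realType).
Variables (mu : {finite_measure set T -> \bar R}).
Variables (p : \bar R) (p1 : (1 <= p)%E).

Lemma Lspace_L1_subproof (f : LspaceType mu p1) :
  (f : T -> R) \in Lfun mu 1.
Proof.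
apply: (Lfun_subset _ p1) (Lspace_repr_subproof f) => //.
exact: fin_num_measure.
Qed.

Definition Lspace_L1 (f : LspaceType mu p1) : LspaceType1 mu :=
  Lclass (Lfun_Sub (lexx 1%E) (Lspace_L1_subproof f)).

End Lspace_L1.

(* For the counting measure a.e. equality is equality, so this is $\ell_p$. *)
Definition ell (R : realType) (p : \bar R) (p1 : (1 <= p)%E) : normedModType R :=
  LspaceType (@counting nat R) p1.

Definition subspace_of (R : realType) (E : normedModType R)
  (X : submodClosed E) : Type := {x : E | x \in X}.

Section subspace_normed.
Context (R : realType) (E : normedModType R) (X : submodClosed E).

HB.instance Definition _ := SubChoice.on (subspace_of X).
HB.instance Definition _ := [SubChoice_isSubLmodule of subspace_of X by <:].

Definition subspace_norm (x : subspace_of X) : R := `|\val x|.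

Fact subspace_normD x y :
  subspace_norm (x + y) <= subspace_norm x + subspace_norm y.
Proof. exact: ler_normD. Qed.

Fact subspace_normZ (a : R) x : subspace_norm (a *: x) = `|a| * subspace_norm x.
Proof. exact: normrZ. Qed.

Fact subspace_norm0_eq0 x : subspace_norm x = 0 -> x = 0.
Proof. by move=> /normr0_eq0 x0; exact: val_inj. Qed.

HB.instance Definition _ := @Lmodule_isNormed.Build R (subspace_of X)
  subspace_norm subspace_normD subspace_normZ subspace_norm0_eq0.

End subspace_normed.

Section banach_notions.
Context (R : realType).
Implicit Types X Y : normedModType R.

Definition finite_dimensional X := exists n (e : 'I_n -> X),
  forall x, exists a : 'I_n -> R, x = \sum_(i < n) a i *: e i.

Definition weakly_null X (u : X^nat) :=
  forall phi : {linear X -> R^o}, continuous phi -> phi (u n) @[n --> \oo] --> 0.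

(* Property $(m_p)$. Separability and completeness, part of the usual setting,
   are not required: both are automatic for closed subspaces of $L_p$, $\ell_p$.
   The upper limits are extended-real, hence meaningful without knowing that a
   weakly null sequence is bounded. *)
Definition property_m (p : R) X := forall (x : X) (u : X^nat), weakly_null u ->
  limn_esup (fun n => `|x + u n|%:E) =
  ((`|x|%:E `^ p + limn_esup (fun n => `|u n|%:E) `^ p) `^ p^-1)%E.

Definition opnorm X Y (f : X -> Y) : \bar R :=
  ereal_sup [set `|f x|%:E | x in [set x | `|x| <= 1]].

(* The infimum of the empty set is [+oo], so [X] and [Y] are isomorphic
   whenever their distance is finite. *)
Definition banach_mazur X Y : \bar R := ereal_inf
  [set c | exists (f : {linear X -> Y}) (g : {linear Y -> X}),
    [/\ continuous f, continuous g, cancel f g, cancel g f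
      & c = (opnorm f * opnorm g)%E]].

End banach_notions.

(* [g_sigma_algebraType] needs a base point. *)
#[short(type="pmetricType")]
HB.structure Definition PointedMetric (R : numDomainType) :=
  {M of Metric R M & Pointed M}.

Definition borel (R : realType) (T : pmetricType R) :=
  g_sigma_algebraType (@open T).

Definition nonatomic d (T : measurableType d) (R : realType)
    (mu : {measure set T -> \bar R}) :=
  forall A, measurable A -> (0 < mu A)%E ->
    exists B, [/\ measurable B, B `<=` A, (0 < mu B)%E & (mu B < mu A)%E].

Lemma lt1_le1E (R : realType) (p : R) : 1 < p -> (1 <= p%:E)%E.
Proof. by move=> p1; rewrite lee_fin ltW. Qed.

(* Main.v *)
Require Import Defs.
From mathcomp Require Import all_boot all_order all_algebra.
From mathcomp Require Import all_classical all_reals all_analysis.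
From HB Require Import structures.
From mathcomp Require Import measurable_realfun ring lra.
Set Implicit Arguments.
Unset Strict Implicit.
Unset Printing Implicit Defensive.
Import Order.TTheory GRing.Theory Num.Theory.
Import numFieldNormedType.Exports.
Local Open Scope classical_set_scope.
Local Open Scope ring_scope.

(** (i) => (iii).  Truncating at heights [c m] that grow fast enough splits a function into nearly
disjoint layers, so the sum over [m] of the [p]-th powers of the norms of the windows (from [c (m - N)]
to [c m]) is about [N |f|^p].  By compactness in $L_1$ a conditional expectation [E m] on a finite
partition reproduces, uniformly on the unit ball, what lies below [c m] and, since the rest is small in
$L_1$, nearly kills what lies above [c m.+1].  Hence the coordinates of [E m (f - E (m - N) f)], scaled
by [N^(-1/p)], embed [X] almost isometrically into $\ell_p$.

(iii) => (ii).  In $\ell_p$ a weakly null sequence leaves every finite set of coordinates, and the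
Brezis-Lieb estimate gives additivity of the [p]-th powers of the norms, which survives almost isometries.

(ii) => (i).  For [p != 2] Clarkson's inequality is strict off disjoint supports, so $(m_p)$ forces
weakly null bounded sequences to become disjoint from every fixed function.  Uniform smoothness gives
weakly Cauchy subsequences; if the ball were not totally bounded in $L_1$, the differences along a
separated one would yield arbitrarily many nearly disjoint functions with $L_1$-norms bounded below,
which is impossible.  Finally an $L_1$-limit of points of the ball lies in it: among the convex sets of
approximants, those of nearly minimal norm are Cauchy in $L_p$ by uniform convexity. *)

(** * Inequalities between powers of real numbers *)

(** In (i) => (iii), stage [m] controls what lies below [c m] and above [c m.+1], but not the slice
    of the function between these two heights, which need not be small uniformly on the unit ball.
    Only the sum over [m] of the [p]-th powers of the norms of the slices is bounded, by [|f|^p].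
    Windows of length [N] answer this: every layer is counted [N] times, while the total error stays
    bounded independently of [N] and becomes negligible after division by [N].

    Much of the geometry of $L_p$ is reduced to inequalities between two real numbers, homogeneous
    of degree [p], of the form [F <= e (|a|^p + |b|^p) + C G] with [F <= 0] wherever [G] vanishes.
    They integrate directly, and on bounded sequences the term with [e] is as small as desired.

    At [p = 2] Clarkson's inequality is the parallelogram identity: every Hilbert space has $(m_2)$,
    which then says nothing about supports. *)

Section PowerInequalities.
Context (R : realType).
Implicit Types (p a b s r x y e : R).

Lemma le_powR p a b : 0 <= p -> 0 <= a -> a <= b -> a `^ p <= b `^ p.
Proof. by move=> p0 a0 ab; apply: ge0_ler_powR; rewrite ?nnegrE// (le_trans a0). Qed.

Lemma lt_powR p a b : 0 < p -> 0 <= a -> a < b -> a `^ p < b `^ p.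
Proof.
by move=> p0 a0 ab; apply: gt0_ltr_powR; rewrite ?nnegrE// (le_trans a0)// ltW.
Qed.

(** Young's inequality for the product [s * 1], with exponent [p] and its conjugate, multiplied by
    [p]. *)
Lemma bernoulli_powR p s : 1 < p -> 0 <= s -> 1 + p * (s - 1) <= s `^ p.
Proof.
move=> p1 s0; have p0 : 0 < p by lra.
have q0 : 0 < (1 - p^-1)^-1 by rewrite invr_gt0 subr_gt0 invf_lt1.
have := @conjugate_powR R s 1 p (1 - p^-1)^-1 s0 ler01 p0 q0.
rewrite invrK subrKC => /(_ erefl); rewrite powR1 mulr1 mul1r.
rewrite -(ler_pM2r p0) mulrDl divfK ?gt_eqF// mulrBl mulVf ?gt_eqF// mul1r.
by lra.
Qed.

(** Strictness comes from a square: with [s = w ^+ 2], squaring the weak inequality at [w] gives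
    [(1 + p (w - 1))^2], which exceeds [1 + p (s - 1)] by [p (p - 1) (w - 1)^2]. *)
Lemma bernoulli_powR_lt p s : 1 < p -> 0 <= s -> s != 1 ->
  1 + p * (s - 1) < s `^ p.
Proof.
move=> p1 s0 s1; have p0 : 0 < p by lra.
pose w := s `^ 2^-1; have w0 : 0 <= w by exact: powR_ge0.
have ws : s = w ^+ 2 by rewrite -powR_mulrn// /w -powRrM mulVf// powRr1.
have w1 : w != 1 by apply: contraNneq s1; rewrite ws => ->; rewrite expr1n.
have -> : s `^ p = (w `^ p) ^+ 2.
  by rewrite -powR_mulrn ?powR_ge0// powRAC powR_mulrn// -ws.
have B := bernoulli_powR p1 w0.
have wpos : 0 < (w - 1) ^+ 2 by rewrite lt_neqAle sqr_ge0 eq_sym sqrf_eq0 subr_eq0 w1.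
have [neg|pos] := ltP (1 + p * (s - 1)) 0.
  by rewrite (lt_le_trans neg)// sqr_ge0.
have [neg2|pos2] := ltP (1 + p * (w - 1)) 0; last first.
  apply: (@lt_le_trans _ _ ((1 + p * (w - 1)) ^+ 2)).
    rewrite -subr_gt0 ws (_ : _ - _ = p * (p - 1) * (w - 1) ^+ 2); last by ring.
    by rewrite mulr_gt0// mulr_gt0//; lra.
  by rewrite ler_sqr ?nnegrE// powR_ge0.
(* A negative lower bound at [w] cannot be squared, but then [w < 1] makes the bound at [s] negative
   too, against [pos]. *)
have : w < 1 by nra.
move: pos; rewrite ws; nra.
Qed.

Lemma powR_tangent p a b : 1 < p -> 0 <= a -> 0 <= b ->
  b `^ p + p * b `^ (p - 1) * (a - b) <= a `^ p.
Proof.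
move=> p1 a0; rewrite le_eqVlt => /predU1P[<-|b0].
  rewrite !powR0 ?mulr0 ?mul0r ?addr0 ?powR_ge0//; apply/eqP; lra.
have := bernoulli_powR p1 (divr_ge0 a0 (ltW b0)).
have bp : 0 < b `^ p by rewrite powR_gt0.
rewrite -(ler_pM2l bp) -powRM ?divr_ge0 ?(ltW b0)// mulrCA divff ?gt_eqF// mulr1.
apply: le_trans; rewrite -mulr_powRB1 ?(ltW b0)//; last by lra.
rewrite le_eqVlt; apply/orP; left; apply/eqP.
by field; rewrite gt_eqF.
Qed.

Lemma powR_super p x y : 1 < p -> 0 <= x -> 0 <= y ->
  x `^ p + y `^ p <= (x + y) `^ p.
Proof.
move=> p1 x0 y0; have p0 : 0 < p by lra.
rewrite -(mulr_powRB1 x0 p0) -(mulr_powRB1 y0 p0) -(mulr_powRB1 (addr_ge0 x0 y0) p0).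
rewrite mulrDl; apply: lerD; apply: ler_wpM2l => //; apply: le_powR; lra.
Qed.

Lemma powR_super_lt p x y : 1 < p -> 0 < x -> 0 < y ->
  x `^ p + y `^ p < (x + y) `^ p.
Proof.
move=> p1 x0 y0; have p0 : 0 < p by lra.
rewrite -(mulr_powRB1 (ltW x0) p0) -(mulr_powRB1 (ltW y0) p0).
rewrite -(mulr_powRB1 (addr_ge0 (ltW x0) (ltW y0)) p0) mulrDl.
by apply: ltrD; rewrite ltr_pM2l// lt_powR//; lra.
Qed.

(** Strict superadditivity for the exponent [p^-1], applied to the [p]-th powers of [x] and [y]. *)
Lemma powR_sub_lt p x y : 0 < p -> p < 1 -> 0 < x -> 0 < y ->
  (x + y) `^ p < x `^ p + y `^ p.
Proof.
move=> p0 p1 x0 y0; have ip1 : 1 < p^-1 by rewrite invf_gt1.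
have := powR_super_lt ip1 (powR_gt0 p x0) (powR_gt0 p y0).
rewrite -!powRrM mulfV ?gt_eqF// !powRr1 ?(ltW x0) ?(ltW y0)// => h.
have := @lt_powR p _ _ p0 _ h.
rewrite -powRrM mulVf ?gt_eqF// powRr1; last by rewrite addr_ge0 ?powR_ge0.
apply; lra.
Qed.

Lemma bernoulli_powR_concave p s : 0 < p -> p < 1 -> 0 <= s -> s `^ p <= 1 + p * (s - 1).
Proof.
move=> p0 p1 s0; have ip1 : 1 < p^-1 by rewrite invf_gt1.
have := bernoulli_powR ip1 (powR_ge0 s p).
rewrite -powRrM mulfV ?gt_eqF// powRr1// -(ler_pM2l p0) mulrDr mulrA divff ?gt_eqF//.
lra.
Qed.

Lemma powR_add_ub p x y : 1 <= p -> 0 <= x -> 0 <= y ->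
  (x + y) `^ p <= 2 `^ p * (x `^ p + y `^ p).
Proof.
move=> p1 x0 y0; apply: (@le_trans _ _ ((2 * Num.max x y) `^ p)).
  apply: ge0_ler_powR; rewrite ?nnegrE ?mulr_ge0 ?addr_ge0 ?le_max ?x0//; first lra.
  by have [xy|yx] := leP x y; lra.
rewrite powRM ?le_max ?x0// ler_wpM2l ?powR_ge0//.
by have [xy|yx] := leP x y; rewrite ?lerDl ?lerDr powR_ge0.
Qed.

Lemma norm_powR_continuous p : 1 < p -> continuous (fun x => `|x| `^ p).
Proof.
move=> p1 x; apply/cvgrPdist_le => /= e e0.
(* [M] is the slope of the power at [|x| + 1], hence a Lipschitz constant up to that point; the
   tangent inequality is used at the larger of the two values. *)
pose M := p * (`|x| + 1) `^ (p - 1).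
have M0 : 0 <= M by rewrite mulr_ge0 ?powR_ge0//; lra.
have M1 : 0 < M + 1 by lra.
near=> y.
have xy : `|x - y| <= 1 by near: y; apply: cvgr_dist_le.
have xy2 : `|x - y| <= e / (M + 1).
  by near: y; apply: cvgr_dist_le => //; rewrite divr_gt0.
have key : forall a b, 0 <= a -> 0 <= b -> b <= `|x| + 1 -> b `^ p - a `^ p <= M * `|a - b|.
  move=> a b a0 b0 bx; have := powR_tangent p1 a0 b0.
  have : b `^ (p - 1) <= (`|x| + 1) `^ (p - 1) by apply: ge0_ler_powR; rewrite ?nnegrE//; lra.
  have := ler_norm (b - a); rewrite distrC.
  have := powR_ge0 b (p - 1); rewrite /M => h1 h2 h3 h4.
  have : b `^ (p - 1) * (b - a) <= (`|x| + 1) `^ (p - 1) * `|a - b|.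
    apply: (@le_trans _ _ (b `^ (p - 1) * `|a - b|)); first by rewrite ler_wpM2l.
    by rewrite ler_wpM2r.
  by nra.
have d : `| `|x| - `|y| | <= `|x - y| by exact: ler_dist_dist.
have yx : `|y| <= `|x| + 1 by have := ler_dist_dist y x; rewrite distrC; move: xy => /[swap]; have := ler_norm (`|y| - `|x|); lra.
apply: (@le_trans _ _ (M * `|x - y|)); last first.
  apply: (@le_trans _ _ ((M + 1) * (e / (M + 1)))).
    by rewrite ler_pM//; lra.
  by rewrite mulrC divfK ?gt_eqF.
rewrite ler_norml; apply/andP; split.
  have := key _ _ (normr_ge0 x) (normr_ge0 y) yx.
  by have := ler_wpM2l M0 d; lra.
have := key _ _ (normr_ge0 y) (normr_ge0 x).
rewrite distrC in d; have := ler_wpM2l M0 d => h1 h2.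
by apply: le_trans h1; apply: h2; lra.
Unshelve. all: by end_near.
Qed.

(* Homogeneity reduces the estimate to the unit sphere of the maximum norm,
   where [G] is bounded below on the compact set where [F >= e]. *)
Lemma homogeneous_domination p (F G : R * R -> R) e :
  0 < p -> continuous F -> continuous G ->
  (forall c a b : R, 0 <= c -> F (c * a, c * b) = c `^ p * F (a, b)) ->
  (forall c a b : R, 0 <= c -> G (c * a, c * b) = c `^ p * G (a, b)) ->
  (forall a b, 0 <= G (a, b)) ->
  (forall a b, G (a, b) = 0 -> F (a, b) <= 0) -> 0 < e ->
  exists2 C : R, 0 <= C & forall a b, F (a, b) <= e * (`|a| `^ p + `|b| `^ p) + C * G (a, b).
Proof.
move=> p0 cF cG hF hG G0 GF e0.
pose Q : set (R * R) := `[-1, 1] `*` `[-1, 1].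
have cQ : compact Q by apply: compact_setX; exact: segment_compact.
pose K := Q `&` ([set z | e <= F z] `&` [set z | 1 <= `|z|]).
have cK : compact K.
  apply: compact_closedI => //; apply: closedI.
    by apply: (@closed_comp _ _ F [set x | e <= x]) => [z _|]; [exact: cF|exact: closed_ge].
  apply: (@closed_comp _ _ (fun z : R * R => `|z|) [set x | 1 <= x]) => [z _|].
    exact: norm_continuous.
  exact: closed_ge.
have main : exists2 C, 0 <= C & forall z, Q z -> 1 <= `|z| -> F z <= e + C * G z.
  have [K0|/set0P/negP] := pselect (K !=set0); last first.
    move/negPn/eqP => K0; exists 0 => // z Qz z1; rewrite mul0r addr0 leNgt; apply/negP => Fz.
    have : K z by split=> //; split=> //; exact: ltW.
    by rewrite K0.
  have [c Kc cmin] := compact_EVT_min K0 cK (continuous_subspaceT cG).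
  have [d Kd dmax] := compact_EVT_max K0 cK (continuous_subspaceT cF).
  have Gc : 0 < G c.
    rewrite lt_neqAle; case: (c) Kc => c1 c2 Kc; rewrite G0 andbT eq_sym; apply/eqP => /GF Fc.
    by move: Kc; rewrite inE => -[_ [/= + _]]; lra.
  have Fd : 0 <= F d by move: Kd; rewrite inE => -[_ [/= + _]]; lra.
  exists (F d / G c); first by rewrite divr_ge0 ?(ltW Gc).
  move=> z Qz z1; have [Fz|Fz] := leP (F z) e.
    case: (z) Fz => z1' z2 Fz; apply: (le_trans Fz); rewrite lerDl mulr_ge0 ?divr_ge0 ?(ltW Gc)//.
  have Kz : z \in K by rewrite inE; split=> //; split=> //; exact: ltW.
  apply: (le_trans (dmax _ Kz)); apply: ler_wpDl; first exact: ltW.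
  rewrite mulrAC -mulrA ler_peMr// ler_pdivlMr// mul1r; exact: cmin.
have [C C0 HC] := main; exists C => // a b.
have [ab0|abn0] := eqVneq (Num.max `|a| `|b|) 0.
  have /andP[a0 b0] : (`|a| <= 0) && (`|b| <= 0) by rewrite -ge_max ab0.
  rewrite !normr_le0 in a0 b0; move/eqP: a0 => ->; move/eqP: b0 => ->.
  have := hF 0 0 0 (lexx _); have := hG 0 0 0 (lexx _).
  by rewrite !mul0r powR0 ?gt_eqF// !mul0r => -> ->; rewrite mulr0 addr0 mulr_ge0 ?addr_ge0 ?powR_ge0//; lra.
set m := Num.max _ _ in abn0.
have m0 : 0 < m by rewrite lt_neqAle eq_sym abn0 /m le_max normr_ge0.
have am : `|a| <= m by rewrite /m le_max lexx.
have bm : `|b| <= m by rewrite /m le_max lexx orbT.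
have ea : a = m * (a / m) by rewrite mulrC divfK.
have eb : b = m * (b / m) by rewrite mulrC divfK.
have Qab : Q (a / m, b / m).
  split => /=; rewrite in_itv/= -ler_norml normrM normfV (ger0_norm (ltW m0)) ler_pdivrMr// mul1r//.
have nab : 1 <= `|(a / m, b / m)|.
  rewrite prod_normE/= !normrM normfV (ger0_norm (ltW m0)).
  by rewrite -maxr_pMl ?invr_ge0 ?(ltW m0)// -/m divff.
have H := HC _ Qab nab.
have -> : F (a, b) = m `^ p * F (a / m, b / m) by rewrite -hF ?(ltW m0)// -ea -eb.
have -> : G (a, b) = m `^ p * G (a / m, b / m) by rewrite -hG ?(ltW m0)// -ea -eb.
have mp : 0 < m `^ p by exact: powR_gt0.
apply: (@le_trans _ _ (m `^ p * (e + C * G (a / m, b / m)))); first by rewrite ler_pM2l.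
rewrite mulrDr mulrCA lerD2r mulrC ler_pM2l//.
rewrite /m; case: (leP `|a| `|b|) => _; rewrite ?lerDl ?lerDr powR_ge0//.
Qed.

Lemma powR_tangent_concave p a b : 0 < p -> p < 1 -> 0 <= a -> 0 < b ->
  a `^ p <= b `^ p + p * b `^ (p - 1) * (a - b).
Proof.
move=> p0 p1 a0 b0.
have := bernoulli_powR_concave p0 p1 (divr_ge0 a0 (ltW b0)).
have bp : 0 < b `^ p by rewrite powR_gt0.
rewrite -(ler_pM2l bp) -powRM ?divr_ge0 ?(ltW b0)// mulrCA divff ?gt_eqF// mulr1.
move=> /le_trans; apply; rewrite -mulr_powRB1 ?(ltW b0)//.
rewrite le_eqVlt; apply/orP; left; apply/eqP.
by field; rewrite gt_eqF.
Qed.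

Lemma norm_powR_sqr p x : `|x| `^ p = (x ^+ 2) `^ (p / 2).
Proof. by rewrite -real_normK ?num_real// -powR_mulrn// -powRrM mulrC divfK. Qed.

(** The defect in Clarkson's inequality, which reverses at the exponent 2; the sign makes the defect
    nonnegative on both sides. *)
Definition clarkson p a b : R := (if 2 < p then 1 else -1) *
  (`|a + b| `^ p + `|a - b| `^ p - 2 * `|a| `^ p - 2 * `|b| `^ p).

(* Compare both sides with [2 (a^2 + b^2)^(p/2)], using the tangent inequality and
   superadditivity of [s^(p/2)] (both reversed for [p < 2]). *)
Lemma clarkson_gt0 p a b : 1 < p -> p != 2 -> a != 0 -> b != 0 -> 0 < clarkson p a b.
Proof.
move=> p1 p2 a0 b0; rewrite /clarkson !(norm_powR_sqr p).
have a2 : 0 < a ^+ 2 by rewrite lt_neqAle sqr_ge0 eq_sym sqrf_eq0 a0.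
have b2 : 0 < b ^+ 2 by rewrite lt_neqAle sqr_ge0 eq_sym sqrf_eq0 b0.
have M0 : 0 < a ^+ 2 + b ^+ 2 by lra.
have [p2'|p2'] := ltP 2 p.
  have q1 : 1 < p / 2 by lra.
  have := powR_super_lt q1 a2 b2.
  have := powR_tangent q1 (sqr_ge0 (a + b)) (ltW M0).
  have := powR_tangent q1 (sqr_ge0 (a - b)) (ltW M0).
  set c := p / 2 * _.
  rewrite (_ : (a - b) ^+ 2 - (a ^+ 2 + b ^+ 2) = - (a * b *+ 2)); last by ring.
  rewrite (_ : (a + b) ^+ 2 - (a ^+ 2 + b ^+ 2) = (a * b *+ 2)); last by ring.
  by nra.
have {}p2 : p < 2 by rewrite lt_neqAle p2.
have q0 : 0 < p / 2 by lra.
have q1 : p / 2 < 1 by lra.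
have := powR_sub_lt q0 q1 a2 b2.
have := powR_tangent_concave q0 q1 (sqr_ge0 (a + b)) M0.
have := powR_tangent_concave q0 q1 (sqr_ge0 (a - b)) M0.
set c := p / 2 * _.
rewrite (_ : (a - b) ^+ 2 - (a ^+ 2 + b ^+ 2) = - (a * b *+ 2)); last by ring.
rewrite (_ : (a + b) ^+ 2 - (a ^+ 2 + b ^+ 2) = (a * b *+ 2)); last by ring.
by nra.
Qed.

Lemma clarkson_ge0 p a b : 1 < p -> p != 2 -> 0 <= clarkson p a b.
Proof.
move=> p1 p2; have p0 : p != 0 by apply/eqP; lra.
have [->|a0] := eqVneq a 0.
  by rewrite /clarkson add0r sub0r normrN normr0 powR0// mulr0 subr0; lra.
have [->|b0] := eqVneq b 0; last by rewrite ltW// clarkson_gt0.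
by rewrite /clarkson addr0 subr0 normr0 powR0// mulr0 subr0; lra.
Qed.

Lemma bernoulli_norm_powR_lt p s : 1 < p -> s != 1 -> 1 + p * (s - 1) < `|s| `^ p.
Proof.
move=> p1 s1; have [s0|s0] := leP 0 s.
  by rewrite ger0_norm// bernoulli_powR_lt.
by have := bernoulli_powR p1 (normr_ge0 s); rewrite ltr0_norm//; nra.
Qed.

(** After division by [|a|], the strict Bernoulli inequalities at [1 + b / a] and [1 - b / a] are
    added and their linear terms cancel. *)
Lemma midpoint_powR_gt0 p a b : 1 < p -> b != 0 ->
  0 < `|a + b| `^ p + `|a - b| `^ p - 2 * `|a| `^ p.
Proof.
move=> p1 b0; have bn : 0 < `|b| by rewrite normr_gt0.
have [->|a0] := eqVneq a 0.
  rewrite add0r sub0r normrN normr0 powR0 ?mulr0 ?subr0; last by apply/eqP; lra.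
  by have := powR_gt0 p bn; lra.
have an : 0 < `|a| by rewrite normr_gt0.
have ba : b / a != 0 by rewrite mulf_neq0// invr_neq0.
have e1 : 1 + b / a != 1 by rewrite -subr_eq0 addrAC subrr add0r.
have e2 : 1 - b / a != 1 by rewrite -subr_eq0 addrAC subrr add0r oppr_eq0.
have := bernoulli_norm_powR_lt p1 e1; have := bernoulli_norm_powR_lt p1 e2.
have -> : `|a + b| `^ p = `|a| `^ p * `|1 + b / a| `^ p.
  by rewrite -powRM// -normrM mulrDr mulr1 mulrCA divff// mulr1.
have -> : `|a - b| `^ p = `|a| `^ p * `|1 - b / a| `^ p.
  by rewrite -powRM// -normrM mulrBr mulr1 mulrCA divff// mulr1.
by have := powR_gt0 p an; nra.
Qed.

Lemma midpoint_powR_ge0 p a b : 1 < p ->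
  0 <= `|a + b| `^ p + `|a - b| `^ p - 2 * `|a| `^ p.
Proof.
move=> p1; have [->|b0] := eqVneq b 0; last by rewrite ltW// midpoint_powR_gt0.
by rewrite addr0 subr0; lra.
Qed.

Lemma powR_continuous_at1 q : (fun x => x `^ q) @ (1 : R) --> (1 : R).
Proof.
have h : (1 : R) \in `]0, +oo[ by rewrite in_itv/= ltr01.
have /derivable1_diffP/differentiable_continuous := @derivable_powR R 1 q 1 h.
by move=> H; have := H; rewrite /prop_for /continuous_at powR1.
Qed.

(** The tangents at [1 + r] and [1 - r], evaluated at 1, bound the left side by [p r] times the
    difference of the powers of [1 + r] and [1 - r] with exponent [p - 1]; this difference tends to
    0 by continuity at 1. *)
Lemma uniform_smooth_at1 p e : 1 < p -> 0 < e -> exists2 rho, 0 < rho < 1 &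
  forall r, 0 <= r -> r <= rho -> (1 + r) `^ p + (1 - r) `^ p - 2 <= r * e.
Proof.
move=> p1 e0; have p0 : 0 < p by lra.
have ep : 0 < e / (2 * p) by rewrite divr_gt0//; lra.
have /cvgrPdist_le /(_ _ ep) := @powR_continuous_at1 (p - 1).
move=> /nbhs_ballP[d /= d0 Hd].
exists (Num.min (d / 2) 2^-1).
  by rewrite lt_min divr_gt0//= invr_gt0 ltr0n/= gt_min invf_lt1// ltr1n orbT.
move=> r r0; rewrite le_min => /andP[rd r2].
have r1 : r <= 1 / 2 by lra.
have Hp : (1 + r) `^ (p - 1) <= 1 + e / (2 * p).
  have : ball (1:R) d (1 + r) by rewrite /ball/= opprD addNKr normrN ger0_norm//; lra.
  by move=> /Hd /=; rewrite ler_norml; lra.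
have Hm : 1 - e / (2 * p) <= (1 - r) `^ (p - 1).
  have : ball (1:R) d (1 - r) by rewrite /ball/= opprB addrCA subrr addr0 ger0_norm//; lra.
  by move=> /Hd /=; rewrite ler_norml; lra.
have r1' : 0 <= 1 + r by lra.
have r2' : 0 <= 1 - r by lra.
have := powR_tangent p1 ler01 r1'; have := powR_tangent p1 ler01 r2'; rewrite !powR1.
move=> h1 h2.
have : p * ((1 + r) `^ (p - 1) - (1 - r) `^ (p - 1)) <= e.
  apply: (@le_trans _ _ (p * (2 * (e / (2 * p))))); first by rewrite ler_pM2l//; lra.
  by rewrite le_eqVlt; apply/orP; left; apply/eqP; field; rewrite gt_eqF.
move=> h3; have := ler_wpM2l r0 h3; nra.
Qed.

(** If [t |b|] dominates [rho |a|], everything is at most [K t^p |b|^p / 1], and [t^(p - 1) K <= e]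
    for small [t] because [p > 1]. Otherwise [r = t |b| / |a|] is at most [rho] and the one-variable
    estimate applies after division by [|a|^p]. *)
Lemma uniform_smooth_powR p e : 1 < p -> 0 < e -> exists2 t0, 0 < t0 &
  forall t a b, 0 < t -> t <= t0 ->
  `|a + t * b| `^ p + `|a - t * b| `^ p - 2 * `|a| `^ p <= t * e * (`|a| `^ p + `|b| `^ p).
Proof.
move=> p1 e0; have p0 : 0 < p by lra.
have [rho /andP[rho0 rho1] Hrho] := uniform_smooth_at1 p1 e0.
pose K := 2 * (rho^-1 + 1) `^ p.
have K0 : 0 < K by rewrite mulr_gt0// powR_gt0// addr_gt0// invr_gt0.
exists ((e / K) `^ (p - 1)^-1); first by rewrite powR_gt0// divr_gt0.
move=> t a b t0 tt.
have tp : t `^ (p - 1) * K <= e.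
  rewrite -ler_pdivlMr//; have : t `^ (p - 1) <= (e / K) `^ (p - 1)^-1 `^ (p - 1).
    by apply: le_powR => //; [lra|exact: ltW].
  by rewrite -powRrM mulVf ?powRr1 ?divr_ge0 ?(ltW e0) ?(ltW K0)//; apply/eqP; lra.
have [small|big] := leP (rho * `|a|) (t * `|b|).
  have al : `|a| + t * `|b| <= t * `|b| * (rho^-1 + 1).
    by rewrite mulrDr mulr1 lerD2r ler_pdivlMr// mulrC.
  have tb : 0 <= t * `|b| by rewrite mulr_ge0// ltW.
  have B : (`|a| + t * `|b|) `^ p <= t * t `^ (p - 1) * (rho^-1 + 1) `^ p * `|b| `^ p.
    apply: (le_trans (le_powR (ltW p0) _ al)); first by rewrite addr_ge0.
    rewrite powRM//; last by rewrite addr_ge0// invr_ge0 ltW.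
    by rewrite powRM ?(ltW t0)// mulr_powRB1 ?(ltW t0)// le_eqVlt; apply/orP; left; apply/eqP; ring.
  have B1 : `|a + t * b| `^ p <= (`|a| + t * `|b|) `^ p.
    apply: le_powR => //; first exact: ltW.
    by rewrite (le_trans (ler_normD _ _))// normrM (gtr0_norm t0).
  have B2 : `|a - t * b| `^ p <= (`|a| + t * `|b|) `^ p.
    apply: le_powR => //; first exact: ltW.
    by rewrite (le_trans (ler_normB _ _))// normrM (gtr0_norm t0).
  have a0 := powR_ge0 `|a| p; have b0 := powR_ge0 `|b| p.
  have h := ler_wpM2r b0 (ler_wpM2l (ltW t0) tp).
  have ta : 0 <= t * e * `|a| `^ p by rewrite !mulr_ge0 ?(ltW t0) ?(ltW e0).
  by rewrite /K in h; lra.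
have an : 0 < `|a|.
  rewrite lt_neqAle normr_ge0 andbT; apply: contraTneq big => <-.
  by rewrite mulr0 -leNgt mulr_ge0// ltW.
have a0 : a != 0 by rewrite -normr_gt0.
pose r := t * `|b| / `|a|.
have r0 : 0 <= r by rewrite !mulr_ge0 ?(ltW t0)// invr_ge0.
have rr : r <= rho by rewrite ler_pdivrMr// ltW.
have := Hrho r r0 rr.
have -> : `|a + t * b| `^ p + `|a - t * b| `^ p = `|a| `^ p * ((1 + r) `^ p + (1 - r) `^ p).
  have rE : r = `|t * b / a| by rewrite /r !normrM normfV (gtr0_norm t0).
  have -> : `|a + t * b| `^ p = `|a| `^ p * `|1 + t * b / a| `^ p.
    by rewrite -powRM// -normrM mulrDr mulr1 mulrCA divff// mulr1.
  have -> : `|a - t * b| `^ p = `|a| `^ p * `|1 - t * b / a| `^ p.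
    by rewrite -powRM// -normrM mulrBr mulr1 mulrCA divff// mulr1.
  rewrite -mulrDr; congr (_ * _).
  have r1 : `|t * b / a| < 1 by rewrite -rE; lra.
  move: r1; rewrite rE ltr_norml => /andP[r1 r2].
  have [s0|s0] := leP 0 (t * b / a).
    by rewrite (ger0_norm s0) !ger0_norm//; lra.
  by rewrite (ltr0_norm s0) opprK addrC !ger0_norm//; lra.
have a1 := powR_ge0 `|a| p; move=> h.
have := ler_wpM2l a1 h.
have : `|a| `^ p * (r * e) <= t * e * (`|a| `^ p + `|b| `^ p); last by lra.
have -> : `|a| `^ p * (r * e) = t * e * (`|b| * `|a| `^ (p - 1)).
  by rewrite -mulr_powRB1// /r; field; rewrite gt_eqF.
rewrite ler_wpM2l ?mulr_ge0 ?(ltW t0) ?(ltW e0)//.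
have [ab|ba] := leP `|a| `|b|.
  rewrite -(mulr_powRB1 (normr_ge0 b) p0) ler_wpDl ?powR_ge0// ler_wpM2l// le_powR//; lra.
by rewrite -(mulr_powRB1 (normr_ge0 a) p0) ler_wpDr ?powR_ge0// ler_wpM2r ?powR_ge0// ltW.
Qed.

Lemma norm_powRZ p c a : 0 <= c -> `|c * a| `^ p = c `^ p * `|a| `^ p.
Proof. by move=> c0; rewrite normrM powRM// ger0_norm. Qed.

Let cvg1 : continuous (fun z : R * R => z.1). Proof. by move=> z; exact: cvg_fst. Qed.
Let cvg2 : continuous (fun z : R * R => z.2). Proof. by move=> z; exact: cvg_snd. Qed.

Let cvg_norm_powR p (f : R * R -> R) : 1 < p -> continuous f ->
  continuous (fun z => `|f z| `^ p).
Proof.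
move=> p1 cf z; apply: (@continuous_comp _ _ _ f (fun x => `|x| `^ p)).
  exact: cf.
exact: norm_powR_continuous.
Qed.

Let cvg_add : continuous (fun z : R * R => z.1 + z.2).
Proof. by move=> z; apply: cvgD; [exact: cvg1|exact: cvg2]. Qed.

Let cvg_sub : continuous (fun z : R * R => z.1 - z.2).
Proof. by move=> z; apply: cvgB; [exact: cvg1|exact: cvg2]. Qed.

Let cvg_min : continuous (fun z : R * R => Num.min `|z.1| `|z.2|).
Proof.
move=> z; apply: (@continuous_min _ _ (fun z => `|z.1|) (fun z => `|z.2|)).
  by apply: continuous_comp; [exact: cvg1|exact: norm_continuous].
by apply: continuous_comp; [exact: cvg2|exact: norm_continuous].
Qed.

Let min_norm a b : Num.min `|a| `|b| = `|Num.min `|a| `|b| |.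
Proof. by rewrite [RHS]ger0_norm// le_min !normr_ge0. Qed.

Let min_normZ c a b : 0 <= c -> Num.min `|c * a| `|c * b| = c * Num.min `|a| `|b|.
Proof. by move=> c0; rewrite !normrM ger0_norm// minr_pMr. Qed.

(** [clarkson] vanishes only where [a] or [b] is 0, and there the minimum vanishes as well. This
    quantifies that near equality in Clarkson's inequality forces nearly disjoint supports. *)
Lemma min_powR_clarkson p e : 1 < p -> p != 2 -> 0 < e -> exists2 C : R, 0 <= C &
  forall a b, Num.min `|a| `|b| `^ p <= e * (`|a| `^ p + `|b| `^ p) + C * clarkson p a b.
Proof.
move=> p1 p2 e0; have p0 : 0 < p by lra.
apply: (@homogeneous_domination p (fun z => Num.min `|z.1| `|z.2| `^ p)
  (fun z => clarkson p z.1 z.2)) => //=.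
- rewrite (_ : (fun _ => _) = fun z : R * R => `|Num.min `|z.1| `|z.2| | `^ p).
    exact: cvg_norm_powR.
  by apply/funext => z; rewrite -min_norm.
- move=> z; apply: cvgM; first exact: cvg_cst.
  apply: cvgB; last by apply: cvgM; [exact: cvg_cst|exact: cvg_norm_powR].
  apply: cvgB; last by apply: cvgM; [exact: cvg_cst|exact: cvg_norm_powR].
  by apply: cvgD; exact: cvg_norm_powR.
- by move=> c a b c0; rewrite min_normZ// powRM// le_min !normr_ge0.
- move=> c a b c0; rewrite /clarkson -mulrDr -mulrBr !norm_powRZ//; ring.
- by move=> a b; exact: clarkson_ge0.
- move=> a b S0; have [->|a0] := eqVneq a 0.
    by rewrite normr0 min_l// powR0// gt_eqF.
  have [->|b0] := eqVneq b 0; first by rewrite normr0 min_r// powR0// gt_eqF.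
  by have := clarkson_gt0 p1 p2 a0 b0; rewrite S0 ltxx.
Qed.

(** Uniform convexity for the points [a + b] and [a - b] with midpoint [a]: the convexity defect
    vanishes only at [b = 0]. *)
Lemma uniform_convex_powR p e : 1 < p -> 0 < e -> exists2 C : R, 0 <= C &
  forall a b, `|b| `^ p <= e * (`|a| `^ p + `|b| `^ p) +
    C * (`|a + b| `^ p + `|a - b| `^ p - 2 * `|a| `^ p).
Proof.
move=> p1 e0; have p0 : 0 < p by lra.
apply: (@homogeneous_domination p (fun z => `|z.2| `^ p)
  (fun z => `|z.1 + z.2| `^ p + `|z.1 - z.2| `^ p - 2 * `|z.1| `^ p)) => //=.
- exact: cvg_norm_powR.
- move=> z; apply: cvgB; last by apply: cvgM; [exact: cvg_cst|exact: cvg_norm_powR].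
  by apply: cvgD; exact: cvg_norm_powR.
- by move=> c a b c0; rewrite norm_powRZ.
- by move=> c a b c0; rewrite -mulrDr -mulrBr !norm_powRZ//; ring.
- by move=> a b; exact: midpoint_powR_ge0.
- move=> a b S0; have [->|b0] := eqVneq b 0; first by rewrite normr0 powR0// gt_eqF.
  by have := midpoint_powR_gt0 a p1 b0; rewrite S0 ltxx.
Qed.

(** Where the minimum vanishes, one of the numbers is 0 and the left side is 0. *)
Lemma brezis_lieb_powR p e : 1 < p -> 0 < e -> exists2 C : R, 0 <= C &
  forall a b, `| `|a + b| `^ p - `|a| `^ p - `|b| `^ p| <=
    e * (`|a| `^ p + `|b| `^ p) + C * Num.min `|a| `|b| `^ p.
Proof.
move=> p1 e0; have p0 : 0 < p by lra.
apply: (@homogeneous_domination p (fun z => `| `|z.1 + z.2| `^ p - `|z.1| `^ p - `|z.2| `^ p|)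
  (fun z => Num.min `|z.1| `|z.2| `^ p)) => //=.
- move=> z; apply: (@continuous_comp _ _ _ (fun z : R * R =>
    `|z.1 + z.2| `^ p - `|z.1| `^ p - `|z.2| `^ p) (fun x : R => `|x|)).
    by apply: cvgB; [apply: cvgB|]; exact: cvg_norm_powR.
  exact: norm_continuous.
- rewrite (_ : (fun _ => _) = fun z : R * R => `|Num.min `|z.1| `|z.2| | `^ p).
    exact: cvg_norm_powR.
  by apply/funext => z; rewrite -min_norm.
- move=> c a b c0; rewrite -mulrDr !norm_powRZ// -!mulrBr normrM ger0_norm//.
  exact: powR_ge0.
- by move=> c a b c0; rewrite min_normZ// powRM// le_min !normr_ge0.
- move=> a b /powR_eq0_eq0; have [_ /normr0_eq0 ->|_ /normr0_eq0 ->] := leP `|a| `|b|.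
    by rewrite add0r normr0 powR0 ?gt_eqF// subr0 subrr normr0.
  by rewrite addr0 normr0 powR0 ?gt_eqF// subr0 subrr normr0.
Qed.

Lemma powR_add_eps p e : 1 < p -> 0 < e -> exists2 C : R, 0 <= C &
  forall a b, `|a + b| `^ p <= (1 + e) * `|a| `^ p + C * `|b| `^ p.
Proof.
move=> p1 e0; have p0 : 0 < p by lra.
have [] := @homogeneous_domination p (fun z => `|z.1 + z.2| `^ p - `|z.1| `^ p)
  (fun z => `|z.2| `^ p) e p0 _ _ _ _ _ _ e0 => //=.
- by move=> z; apply: cvgB; exact: cvg_norm_powR.
- exact: cvg_norm_powR.
- by move=> c a b c0; rewrite -mulrDr !norm_powRZ// mulrBr.
- by move=> c a b c0; rewrite norm_powRZ.
- by move=> a b /powR_eq0_eq0/normr0_eq0 ->; rewrite addr0 subrr.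
move=> C C0 H; exists (C + e) => [|a b]; first lra.
by have := H a b; lra.
Qed.

End PowerInequalities.

(** * Integral forms of the power inequalities *)

Section LpNorm.
Context d (T : measurableType d) (R : realType).
Variables (mu : {measure set T -> \bar R}) (p : R) (p1 : 1 < p).
Local Notation L := (LspaceType mu (lt1_le1E p1)).
Local Notation Lf := (LfunType mu (lt1_le1E p1)).
Local Notation Int f := (mu.-integrable setT (EFin \o f)).
Implicit Types (f g : L) (u v : Lf).

Let p0 : 0 < p. Proof. exact: lt_trans ltr01 p1. Qed.

Lemma IntD (h k : T -> R) : Int h -> Int k -> Int (fun x => h x + k x).
Proof. by move=> hi ki; have := integrableD measurableT hi ki; exact. Qed.

Lemma IntZ (c : R) (h : T -> R) : Int h -> Int (fun x => c * h x).
Proof. by move=> hi; have := integrableZl measurableT c hi; exact. Qed.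

Lemma Int_le (h k : T -> R) : measurable_fun setT h -> Int k ->
  (forall x, `|h x| <= k x) -> Int h.
Proof.
move=> mh ki hk; apply: (le_integrable measurableT _ _ ki).
  exact/measurable_EFinP.
by move=> x _ /=; rewrite lee_fin (le_trans (hk x)) ?ler_norm.
Qed.

Lemma Int_measurable (h : T -> R) : Int h -> measurable_fun setT h.
Proof. by move=> /measurable_int /measurable_EFinP. Qed.

Lemma le_Rint (h k : T -> R) : Int h -> Int k -> (forall x, h x <= k x) ->
  \int[mu]_x h x <= \int[mu]_x k x.
Proof. by move=> hi ki hk; apply: le_Rintegral. Qed.

Lemma measurable_norm_powR (h : T -> R) q : measurable_fun setT h ->
  measurable_fun setT (fun x => `|h x| `^ q).
Proof.
move=> mh; apply: (@measurableT_comp _ _ _ _ _ _ (@powR R ^~ q)) => //.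
exact: measurableT_comp.
Qed.

Lemma Lf_measurable u : measurable_fun setT u.
Proof. exact: measurable_funPT. Qed.

Lemma Lf_Int u : Int (fun x => `|u x| `^ p).
Proof. by apply: Lfun_integrable => //; [exact: ltW|exact: LfunP]. Qed.

Lemma Lfun_Int (h : T -> R) : measurable_fun setT h ->
  Int (fun x => `|h x| `^ p) -> h \in Lfun mu p%:E.
Proof.
move=> mh hi; rewrite inE; apply/andP; split; rewrite inE//=.
rewrite /finite_norm unlock; apply: poweR_lty.
have /integrableP[_] := hi; apply: le_lt_trans; apply: ge0_le_integral => //=.
- apply/measurable_EFinP; exact: measurable_norm_powR.
- by apply/measurable_EFinP; apply: measurableT_comp => //; exact: measurable_norm_powR.
- by move=> x _; rewrite lee_fin ler_norm.
Qed.

Definition mkLf (h : T -> R) (mh : measurable_fun setT h)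
  (hi : Int (fun x => `|h x| `^ p)) : Lf := Lfun_Sub (lt1_le1E p1) (Lfun_Int mh hi).

Lemma norm_Lclass u : `|Lclass u| `^ p = \int[mu]_x (`|u x| `^ p).
Proof.
rewrite /Num.norm/= Lspace_norm_class; apply: EFin_inj.
rewrite -poweR_EFin fineK; last first.
  rewrite fin_numElt (lt_le_trans ltNy0) ?Lnorm_ge0//=; exact: Lfunction_finite.
rewrite poweR_Lnorm ?gt_eqF// /Rintegral.
rewrite fineK; last exact: integrable_fin_num (Lf_Int u).
by apply: eq_integral => x _.
Qed.

Lemma norm_Lrepr f : `|f| `^ p = \int[mu]_x (`|Lrepr f x| `^ p).
Proof. by rewrite -[in LHS](LreprK f) norm_Lclass. Qed.

Lemma LclassD u v : Lclass u + Lclass v = Lclass (u + v).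
Proof. exact: Lclass_add. Qed.

Lemma LclassN u : - Lclass u = Lclass (- u).
Proof. exact: Lclass_opp. Qed.

Lemma LclassB u v : Lclass u - Lclass v = Lclass (u - v).
Proof. by rewrite LclassN LclassD. Qed.

Lemma LclassZ c u : c *: Lclass u = Lclass (c *: u).
Proof. exact: Lclass_scale. Qed.

Lemma addE u v x : (u + v) x = u x + v x. Proof. by []. Qed.

Lemma subE u v x : (u - v) x = u x - v x. Proof. by []. Qed.

Lemma scaleE c u x : (c *: u) x = c * u x. Proof. by []. Qed.

Lemma norm_le_powR f g : `|f| `^ p <= `|g| `^ p -> `|f| <= `|g|.
Proof.
move=> h; rewrite leNgt; apply/negP => fg.
by have := lt_powR p0 (normr_ge0 _) fg; lra.
Qed.

(** The single passage from pointwise inequalities to integrals: terms are first moved to the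
    right-hand side, and free slots receive the coefficient 0. *)
Lemma le_Rint_comb4 (F A B C D : T -> R) (a b c e : R) :
  Int F -> Int A -> Int B -> Int C -> Int D ->
  (forall x, F x <= a * A x + b * B x + c * C x + e * D x) ->
  \int[mu]_x F x <= a * \int[mu]_x A x + b * \int[mu]_x B x +
    c * \int[mu]_x C x + e * \int[mu]_x D x.
Proof.
move=> iF iA iB iC iD H.
have jA := IntZ a iA; have jB := IntZ b iB; have jC := IntZ c iC; have jD := IntZ e iD.
have jAB := IntD jA jB; have jABC := IntD jAB jC.
rewrite -(RintegralZl _ measurableT iA) -(RintegralZl _ measurableT iB).
rewrite -(RintegralZl _ measurableT iC) -(RintegralZl _ measurableT iD).
rewrite -(RintegralD measurableT jA jB) -(RintegralD measurableT jAB jC).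
by rewrite -(RintegralD measurableT jABC jD); apply: le_Rint => //; exact: IntD.
Qed.

Lemma uniform_convex_Lp e : 0 < e -> exists2 C : R, 0 <= C &
  forall f g, `|g| `^ p <= e * (`|f| `^ p + `|g| `^ p) +
    C * (`|f + g| `^ p + `|f - g| `^ p - 2 * `|f| `^ p).
Proof.
move=> e0; have [C C0 H] := uniform_convex_powR p1 e0; exists C => // f g.
rewrite -(LreprK f) -(LreprK g); move: (Lrepr f) (Lrepr g) => u v.
rewrite LclassD LclassB !norm_Lclass.
have := @le_Rint_comb4 _ _ _ _ _ (e - 2 * C) e C C (Lf_Int v) (Lf_Int u) (Lf_Int v)
  (Lf_Int (u + v)) (Lf_Int (u - v)).
have pw x : `|v x| `^ p <= (e - 2 * C) * `|u x| `^ p + e * `|v x| `^ p +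
    C * `|(u + v) x| `^ p + C * `|(u - v) x| `^ p.
  rewrite addE subE; move: (H (u x) (v x)).
  move: (`|u x + v x| `^ p) (`|u x - v x| `^ p) (`|u x| `^ p) (`|v x| `^ p) => *; lra.
move=> /(_ pw); move: (Rintegral _ _ _) (Rintegral _ _ _) (Rintegral _ _ _) (Rintegral _ _ _).
by move=> *; lra.
Qed.

Lemma uniform_smooth_Lp e : 0 < e -> exists2 t0, 0 < t0 &
  forall t f g, 0 < t -> t <= t0 ->
  `|f + t *: g| `^ p + `|f - t *: g| `^ p - 2 * `|f| `^ p <= t * e * (`|f| `^ p + `|g| `^ p).
Proof.
move=> e0; have [t0 t00 H] := uniform_smooth_powR p1 e0; exists t0 => // t f g t1 t2.
rewrite -(LreprK f) -(LreprK g); move: (Lrepr f) (Lrepr g) => u v.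
rewrite LclassZ LclassD LclassB !norm_Lclass.
have := @le_Rint_comb4 _ _ _ _ _ (2 + t * e) (t * e) (-1) 0 (Lf_Int (u + t *: v)) (Lf_Int u)
  (Lf_Int v) (Lf_Int (u - t *: v)) (Lf_Int u).
have pw x : `|(u + t *: v) x| `^ p <= (2 + t * e) * `|u x| `^ p + t * e * `|v x| `^ p +
    -1 * `|(u - t *: v) x| `^ p + 0 * `|u x| `^ p.
  rewrite addE subE scaleE; move: (H t (u x) (v x) t1 t2).
  move: (`|u x + _| `^ p) (`|u x - _| `^ p) (`|u x| `^ p) (`|v x| `^ p) => *; lra.
move=> /(_ pw); move: (Rintegral _ _ _) (Rintegral _ _ _) (Rintegral _ _ _) (Rintegral _ _ _).
by move=> *; lra.
Qed.

(** Measures the overlap of [f] and [g]: it is 0 exactly when their supports are disjoint up to a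
    null set. *)
Definition pmin f g : R := \int[mu]_x (Num.min `|Lrepr f x| `|Lrepr g x| `^ p).

Lemma min_measurable (h k : T -> R) : measurable_fun setT h -> measurable_fun setT k ->
  measurable_fun setT (fun x => Num.min `|h x| `|k x|).
Proof. by move=> mh mk; apply: measurable_minr; exact: measurableT_comp. Qed.

Lemma Int_min_powR u (k : T -> R) : measurable_fun setT k ->
  Int (fun x => Num.min `|u x| `|k x| `^ p).
Proof.
move=> mk; apply: (@Int_le _ (fun x => `|u x| `^ p)); last 2 first.
- exact: Lf_Int.
- move=> x; rewrite ger0_norm ?powR_ge0//; apply: le_powR; [exact: ltW| |].
    by rewrite le_min !normr_ge0.
  by rewrite ge_min lexx.
apply: (@measurableT_comp _ _ _ _ _ _ (@powR R ^~ p)) => //.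
by apply: min_measurable => //; exact: Lf_measurable.
Qed.

Lemma pmin_clarkson e : p != 2 -> 0 < e -> exists2 C : R, 0 <= C &
  forall f g, pmin f g <= e * (`|f| `^ p + `|g| `^ p) +
    C * ((if 2 < p then 1 else -1) *
         (`|f + g| `^ p + `|f - g| `^ p - 2 * `|f| `^ p - 2 * `|g| `^ p)).
Proof.
move=> p2 e0; have [C C0 H] := min_powR_clarkson p1 p2 e0; exists C => // f g.
rewrite /pmin; have fE := LreprK f; have gE := LreprK g.
set u := Lrepr f in fE *; set v := Lrepr g in gE *; clearbody u v; subst f g.
rewrite LclassD LclassB !norm_Lclass; rewrite /clarkson in H.
move: (if 2 < p then 1 else -1) H => s H.
have := @le_Rint_comb4 _ _ _ _ _ (e - 2 * C * s) (e - 2 * C * s) (C * s) (C * s)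
  (Int_min_powR u (Lf_measurable v)) (Lf_Int u) (Lf_Int v) (Lf_Int (u + v)) (Lf_Int (u - v)).
have pw x : Num.min `|u x| `|v x| `^ p <= (e - 2 * C * s) * `|u x| `^ p +
    (e - 2 * C * s) * `|v x| `^ p + C * s * `|(u + v) x| `^ p + C * s * `|(u - v) x| `^ p.
  rewrite addE subE; move: (H (u x) (v x)).
  move: (`|u x + v x| `^ p) (`|u x - v x| `^ p) (`|u x| `^ p) (`|v x| `^ p) (_ `^ p) => *; lra.
move=> /(_ pw); move: (Rintegral _ _ _) (Rintegral _ _ _) (Rintegral _ _ _) (Rintegral _ _ _) (Rintegral _ _ _).
by move=> *; lra.
Qed.

Lemma brezis_lieb_Lp e : 0 < e -> exists2 C : R, 0 <= C &
  forall f g, `| `|f + g| `^ p - `|f| `^ p - `|g| `^ p| <=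
    e * (`|f| `^ p + `|g| `^ p) + C * pmin f g.
Proof.
move=> e0; have [C C0 H] := brezis_lieb_powR p1 e0; exists C => // f g.
rewrite /pmin; have fE := LreprK f; have gE := LreprK g.
set u := Lrepr f in fE *; set v := Lrepr g in gE *; clearbody u v; subst f g.
rewrite LclassD !norm_Lclass ler_norml.
have k1 x : `|(u + v) x| `^ p <= (1 + e) * `|u x| `^ p + (1 + e) * `|v x| `^ p +
    C * Num.min `|u x| `|v x| `^ p + 0 * `|u x| `^ p.
  rewrite addE; move: (H (u x) (v x)); rewrite ler_norml => /andP[].
  move: (`|u x + v x| `^ p) (`|u x| `^ p) (`|v x| `^ p) (_ `^ p) => *; lra.
have k2 x : `|u x| `^ p <= 1 * `|(u + v) x| `^ p + e * `|u x| `^ p + (e - 1) * `|v x| `^ p +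
    C * Num.min `|u x| `|v x| `^ p.
  rewrite addE; move: (H (u x) (v x)); rewrite ler_norml => /andP[].
  move: (`|u x + v x| `^ p) (`|u x| `^ p) (`|v x| `^ p) (_ `^ p) => *; lra.
have im := Int_min_powR u (Lf_measurable v).
have h1 := @le_Rint_comb4 _ _ _ _ _ (1 + e) (1 + e) C 0
  (Lf_Int (u + v)) (Lf_Int u) (Lf_Int v) im (Lf_Int u).
have h2 := @le_Rint_comb4 _ _ _ _ _ 1 e (e - 1) C
  (Lf_Int u) (Lf_Int (u + v)) (Lf_Int u) (Lf_Int v) im.
move: (h1 k1) (h2 k2) => {h1 h2 k1 k2}.
move: (Rintegral _ _ _) (Rintegral _ _ _) (Rintegral _ _ _) (Rintegral _ _ _).
by move=> *; apply/andP; split; lra.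
Qed.

End LpNorm.

(** * Truncations and conditional expectations *)

Section Truncation.
Context (R : realType).
Implicit Types (a b c p : R).

Definition clip c a : R := Num.max (- c) (Num.min c a).

Lemma clip_id c a : `|a| <= c -> clip c a = a.
Proof. by rewrite ler_norml /clip => /andP[h1 h2]; rewrite min_r// max_r. Qed.

Lemma clip_ge c a : 0 <= c -> c <= a -> clip c a = c.
Proof. by move=> c0 ca; rewrite /clip min_l// max_r//; lra. Qed.

Lemma clip_le c a : 0 <= c -> a <= - c -> clip c a = - c.
Proof. by move=> c0 ca; rewrite /clip min_r ?max_l//; lra. Qed.

Lemma clipN c a : 0 <= c -> clip c (- a) = - clip c a.
Proof.
move=> c0; have [h|h] := leP `|a| c; first by rewrite !clip_id ?normrN.
have [a0|a0] := leP 0 a.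
  by move: h; rewrite ger0_norm// => h; rewrite (clip_ge c0 (ltW h)) clip_le//; lra.
move: h; rewrite ltr0_norm// => h; rewrite (clip_ge c0 (ltW h)) clip_le ?opprK//; lra.
Qed.

Lemma clip_pos c a : 0 <= c -> 0 <= a -> clip c a = Num.min c a.
Proof. by move=> c0 a0; rewrite /clip max_r// le_min; lra. Qed.

Lemma norm_clip c a : 0 <= c -> `|clip c a| = Num.min c `|a|.
Proof.
move=> c0; wlog a0 : a / 0 <= a.
  move=> H; have [|a0] := leP 0 a; first exact: H.
  have a0' : 0 <= - a by lra.
  by have := H _ a0'; rewrite clipN// !normrN.
by rewrite clip_pos// !ger0_norm// le_min c0.
Qed.

Lemma norm_clip_le c a : 0 <= c -> `|clip c a| <= `|a|.
Proof. by move=> c0; rewrite norm_clip// ge_min lexx orbT. Qed.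

Lemma clip0 a : clip 0 a = 0.
Proof. by apply/normr0_eq0; rewrite norm_clip// min_l. Qed.

Lemma clip_clip b c a : 0 <= b -> b <= c -> clip b (clip c a) = clip b a.
Proof.
move=> b0 bc; have c0 : 0 <= c by lra.
wlog a0 : a / 0 <= a.
  move=> H; have [|a0] := leP 0 a; first exact: H.
  have a0' : 0 <= - a by lra.
  by have := H _ a0'; rewrite !clipN// => /oppr_inj.
rewrite (clip_pos c0 a0) !clip_pos// ?le_min ?c0//.
by rewrite minA (min_l bc).
Qed.

Lemma clip_lip c a b : 0 <= c -> `|clip c a - clip c b| <= `|a - b|.
Proof.
move=> c0.
have cl x : [\/ clip c x = c /\ c <= x, clip c x = - c /\ x <= - c |
    clip c x = x /\ - c <= x <= c].
  have [h|h] := leP c x; first by constructor 1; rewrite clip_ge.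
  have [h'|h'] := leP x (- c); first by constructor 2; rewrite clip_le.
  by constructor 3; rewrite clip_id ?ler_norml ?(ltW h) ?(ltW h').
rewrite ler_norml; have := ler_norm (a - b); have := ler_norm (b - a); rewrite distrC.
have [[-> ?]|[-> ?]|[-> /andP[? ?]]] := cl a; have [[-> ?]|[-> ?]|[-> /andP[? ?]]] := cl b;
  move=> ? ?; apply/andP; split; lra.
Qed.

(** [clip b a] and the increment from it to [clip c a] have the same sign, so their absolute values
    add up. *)
Lemma norm_clipB b c a : 0 <= b -> b <= c -> `|clip c a - clip b a| = `|clip c a| - `|clip b a|.
Proof.
move=> b0 bc; have c0 : 0 <= c by lra.
wlog a0 : a / 0 <= a.
  move=> H; have [|a0] := leP 0 a; first exact: H.
  have a0' : 0 <= - a by lra.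
  by have := H _ a0'; rewrite !clipN// -opprD !normrN.
rewrite !clip_pos// !(@ger0_norm _ (Num.min _ _)) ?le_min ?c0 ?b0//.
rewrite ger0_norm// subr_ge0 le_min !ge_min bc lexx/= orbT//.
Qed.

Lemma clip_powR_super b c a p : 1 < p -> 0 <= b -> b <= c ->
  `|clip c a - clip b a| `^ p + `|clip b a| `^ p <= `|clip c a| `^ p.
Proof.
move=> p1 b0 bc; have := powR_super p1 (normr_ge0 (clip c a - clip b a)) (normr_ge0 (clip b a)).
by rewrite (norm_clipB a b0 bc) subrK.
Qed.

(** A converse to superadditivity. If [|a| <= c], both truncations equal [a]. Otherwise
    [|clip c a| = c], which is at most [2 (c - b)], twice the increment from [b] to [c]; this is
    where heights that at least double are used. *)
Lemma clip_powR_sub b c c' a p e C : 1 < p -> 0 <= b -> 2 * b <= c -> c <= c' ->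
  0 <= e -> 0 <= C ->
  (forall x y : R, `|x + y| `^ p <= (1 + e) * `|x| `^ p + C * `|y| `^ p) ->
  `|clip c' a| `^ p <= `|clip c a| `^ p + (1 + e) * `|clip c' a - clip c a| `^ p +
    C * 2 `^ p * `|clip c a - clip b a| `^ p.
Proof.
move=> p1 b0 bc cc' e0 C0 H; have c0 : 0 <= c by lra.
have p0 : 0 < p by lra.
have t1 : 0 <= (1 + e) * `|clip c' a - clip c a| `^ p by rewrite mulr_ge0 ?powR_ge0//; lra.
have t2 : 0 <= C * 2 `^ p * `|clip c a - clip b a| `^ p by rewrite !mulr_ge0 ?powR_ge0.
have [ac|ca] := leP `|a| c.
  have ac' : `|a| <= c' by lra.
  move: t1 t2; rewrite (clip_id ac) (clip_id ac') => t1 t2.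
  by rewrite -addrA lerDl addr_ge0.
have := H (clip c' a - clip c a) (clip c a); rewrite subrK => /le_trans; apply.
have : `|clip c a| <= 2 * `|clip c a - clip b a|.
  rewrite norm_clipB//; last lra.
  rewrite !norm_clip// (min_l (ltW ca)) min_l//; last lra.
  lra.
move=> /(le_powR (ltW p0) (normr_ge0 _)); rewrite powRM// => h.
have := ler_wpM2l C0 h; rewrite mulrA => h'.
by rewrite -addrA ler_wpDl ?powR_ge0// lerD2l.
Qed.

(** The left side vanishes unless [|a| > c], and then [|a|] is [|a|^p] divided by [|a|^(p - 1)]. *)
Lemma clip_tail c a p : 1 < p -> 0 < c -> `|a - clip c a| <= c `^ (1 - p) * `|a| `^ p.
Proof.
move=> p1 c0; have [h|h] := leP `|a| c.
  by rewrite clip_id// subrr normr0 mulr_ge0 ?powR_ge0.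
have -> : a - clip c a = clip `|a| a - clip c a by rewrite (@clip_id `|a|).
have p0 : 0 < p by lra.
rewrite norm_clipB ?(ltW c0) ?(ltW h)// clip_id// (@le_trans _ _ `|a|) ?gerBl//.
rewrite -(mulr_powRB1 (normr_ge0 a) p0) mulrCA ler_peMr//.
have -> : 1 - p = - (p - 1) by ring.
rewrite powRN -ler_pdivrMl ?invr_gt0 ?powR_gt0// invrK mulr1 le_powR//; lra.
Qed.

(** For functions bounded by [c], closeness in $L_1$ yields closeness in $L_p$: all but one of the
    [p] factors are bounded by [2 c]. *)
Lemma clip_interp c b x y p : 1 < p -> 0 <= b -> b <= c ->
  `|clip b x - clip b y| `^ p <= (2 * c) `^ (p - 1) * `|x - y|.
Proof.
move=> p1 b0 bc; have p0 : 0 < p by lra.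
rewrite -(mulr_powRB1 (normr_ge0 _) p0) mulrC ler_pM ?powR_ge0//; last exact: clip_lip.
apply: le_powR => //; first lra.
apply: (le_trans (ler_normB _ _)); rewrite !norm_clip//.
have := @ge_min _ _ b b `|x|; have := @ge_min _ _ b b `|y|; rewrite lexx /=.
lra.
Qed.

Lemma measurable_clip d (T : measurableType d) c (h : T -> R) :
  measurable_fun setT h -> measurable_fun setT (fun x => clip c (h x)).
Proof.
move=> mh; apply: measurable_maxr => //.
by apply: measurable_minr.
Qed.

End Truncation.

(** Functions are added one at a time, each refining the partition by its level sets of height [e].
    A partition is a map [q] into the integers below [k], so that averages over cells are finite
    sums. *)
Lemma finite_partition_adapted d (T : measurableType d) (R : realType) (c e : R)
    (us : seq (T -> R)) : 0 < e ->
  (forall u, List.In u us -> measurable_fun setT u /\ forall x, `|u x| <= c) ->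
  exists k (q : T -> nat), [/\ forall l, measurable (q @^-1` [set l]),
    forall x, (q x < k)%N &
    forall u, List.In u us -> exists g : nat -> R, forall x, `|u x - g (q x)| <= e].
Proof.
move=> e0; elim: us => [|u us IH] us_c.
  exists 1%N, (fun=> 0%N); split=> // l.
  have [->|l0] := eqVneq l 0%N; first by rewrite (_ : _ @^-1` _ = setT)//; apply/seteqP; split.
  rewrite (_ : _ @^-1` _ = set0)//; apply/seteqP; split=> // x /= l1.
  by rewrite -l1 eqxx in l0.
have [k [q [mq qk qg]]] := IH (fun v vus => us_c v (or_intror vus)).
have [mu_ uc] := us_c u (or_introl erefl).
pose w x := (u x + c) / e.
have w0 x : 0 <= w x by rewrite divr_ge0 ?(ltW e0)//; have := uc x; rewrite ler_norml; lra.
pose n x := Num.truncn (w x).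
have nP x : (n x)%:R <= w x < (n x).+1%:R by exact: truncn_itv.
have mn j : measurable (n @^-1` [set j]).
  have -> : n @^-1` [set j] = w @^-1` `[j%:R, j.+1%:R[.
    apply/seteqP; split=> x /=; first by move=> <-; rewrite in_itv/=.
    rewrite in_itv/= => /andP[h1 h2]; apply/eqP; rewrite eqn_leq.
    have /andP[h3 h4] := nP x; apply/andP; split; rewrite -ltnS -(ltr_nat R).
      exact: le_lt_trans h3 h2.
    exact: le_lt_trans h1 h4.
  rewrite -[X in measurable X]setTI; apply: (_ : measurable_fun setT w) => //.
  by apply: measurable_funM => //; exact: measurable_funD.
pose M := Num.truncn (2 * c / e).
have nM x : (n x <= M)%N.
  apply: le_truncn; rewrite /w ler_pM2r ?invr_gt0//.
  have := uc x; rewrite ler_norml; lra.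
(* If [k] is 0 there is no point at all; the coding below divides by [k]. *)
have [k0|k0] := posnP k.
  exists 0%N, q; split=> // [x|v _]; first by have := qk x; rewrite k0.
  by exists (fun=> 0) => x; have := qk x; rewrite k0.
(* The pair of the level of [u] and the old cell is coded in mixed radix: the quotient by [k]
   recovers the level, the remainder the old cell. *)
exists (M.+1 * k)%N, (fun x => n x * k + q x)%N; split.
- move=> l; have -> : (fun x => n x * k + q x)%N @^-1` [set l] =
      n @^-1` [set (l %/ k)%N] `&` q @^-1` [set (l %% k)%N].
    apply/seteqP; split=> x /=.
      by move=> <-; rewrite divnMDl// divn_small ?addn0// modnMDl modn_small.
    by move=> [-> ->]; rewrite -divn_eq.
  exact: measurableI.
- move=> x; rewrite mulSn addnC; apply: (@leq_trans (k + n x * k)).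
    by rewrite -addSn leq_add2r.
  by rewrite leq_add2l leq_mul2r nM orbT.
- move=> v [<-|vus].
    exists (fun l => (l %/ k)%:R * e - c) => x.
    rewrite divnMDl// divn_small// addn0.
    have /andP[h1 h2] := nP x.
    have we : w x * e = u x + c by rewrite /w divfK ?gt_eqF.
    have := ler_wpM2r (ltW e0) h1; have : w x * e <= (n x).+1%:R * e by rewrite ler_pM2r// ltW.
    rewrite we -natr1 mulrDl mul1r ler_norml => h3 h4; apply/andP; split; lra.
  have [g gv] := qg v vus; exists (fun l => g (l %% k)%N) => x.
  by rewrite modnMDl modn_small.
Qed.

Section Stage.
Context d (T : measurableType d) (R : realType).
Variables (mu : probability T R) (p : R) (p1 : 1 < p).
Local Notation L := (LspaceType mu (lt1_le1E p1)).
Local Notation Lf := (LfunType mu (lt1_le1E p1)).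
Local Notation Int f := (mu.-integrable setT (EFin \o f)).
Local Notation J := (@Lspace_L1 _ _ _ mu _ (lt1_le1E p1)).
Implicit Types (f g : L) (u v : Lf).

Let p0 : 0 < p. Proof. exact: lt_trans ltr01 p1. Qed.

Lemma Int_cst (c : R) : Int (fun=> c).
Proof. exact: finite_measure_integrable_cst. Qed.

Lemma Rint_cst (c : R) : \int[mu]_x c = c.
Proof.
rewrite Rintegral_cst//; transitivity (c * fine 1%E); last by rewrite mulr1.
congr (_ * fine _); exact: probability_setT.
Qed.

Lemma Int_bounded (h : T -> R) c : measurable_fun setT h -> (forall x, `|h x| <= c) -> Int h.
Proof. by move=> mh hc; apply: (Int_le mh (Int_cst c)). Qed.

Lemma Rint_sum n (F : nat -> T -> R) : (forall i, Int (F i)) ->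
  Int (fun x => \sum_(i < n) F i x) /\
  \int[mu]_x (\sum_(i < n) F i x) = \sum_(i < n) \int[mu]_x F i x.
Proof.
move=> iF; elim: n => [|n [IH1 IH2]].
  rewrite big_ord0; have -> : (fun x => \sum_(i < 0) F i x) = (fun=> 0).
    by apply/funext => x; rewrite big_ord0.
  by split; [exact: Int_cst|rewrite Rint_cst].
have -> : (fun x => \sum_(i < n.+1) F i x) = (fun x => \sum_(i < n) F i x + F n x).
  by apply/funext => x; rewrite big_ord_recr.
split; first exact: IntD.
by rewrite (RintegralD measurableT IH1 (iF n)) IH2 big_ord_recr.
Qed.

Lemma Rint_ae (h k : T -> R) : measurable_fun setT h -> measurable_fun setT k ->
  h = k %[ae mu] -> \int[mu]_x h x = \int[mu]_x k x.
Proof.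
move=> mh mk hk; congr fine; apply: ae_eq_integral => //; try exact/measurable_EFinP.
by apply: filterS hk => x hk Dx; rewrite hk.
Qed.

Lemma Lf_Int1 u : Int u.
Proof.
apply: (@Int_le _ _ _ _ _ (fun x => 1 + `|u x| `^ p)).
- exact: Lf_measurable.
- by apply: IntD; [exact: Int_cst|exact: Lf_Int].
- move=> x; have [h|h] := leP `|u x| 1.
    by rewrite (le_trans h)// lerDl powR_ge0.
  by apply: ler_wpDl => //; apply: le1r_powR; exact: ltW.
Qed.

Definition n1 f : R := `|J f|.

Lemma norm_L1 (w : LspaceType1 mu) : `|w| = \int[mu]_x `|w x|.
Proof.
rewrite /Num.norm/= /Lspace_norm Lnorm1 /Rintegral.
by congr fine; apply: eq_integral => x _.
Qed.

Lemma n1E f : n1 f = \int[mu]_x `|Lrepr f x|.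
Proof.
rewrite /n1 norm_L1; apply: Rint_ae.
- apply: measurableT_comp => //; exact: (@measurable_funPT _ _ _ _ (Lrepr (J f))).
- by apply: measurableT_comp => //; exact: Lf_measurable.
- have := Lrepr_class (Lfun_Sub (lexx 1%E) (Lspace_L1_subproof f)).
  by apply: filterS => x /(_ I) /= h _; congr (`| _ |).
Qed.

Lemma n1_Lclass u : n1 (Lclass u) = \int[mu]_x `|u x|.
Proof.
rewrite n1E; apply: Rint_ae.
- by apply: measurableT_comp => //; exact: Lf_measurable.
- by apply: measurableT_comp => //; exact: Lf_measurable.
- by have := Lrepr_class u; apply: filterS => x /(_ I) /= h _; congr (`| _ |).
Qed.

Lemma L1_class u : J (Lclass u) = Lclass (Lfun_Sub (lexx 1%E) (Lfun_subset (lexx 1%E) (lt1_le1E p1) (fin_num_measure mu _ measurableT) (lt1_le1E p1) (LfunP u))).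
Proof.
apply/Lclass_eqP; have := Lrepr_class u; apply: filterS => x /(_ I) /= h _; exact: h.
Qed.

Lemma L1B f g : J (f - g) = J f - J g.
Proof.
rewrite -(LreprK f) -(LreprK g); move: (Lrepr f) (Lrepr g) => u v.
rewrite LclassB !L1_class [in RHS]/GRing.opp/= Lclass_opp [in RHS]/GRing.add/= Lclass_add.
by apply/Lclass_eqP; apply/nearW.
Qed.

Lemma n1D f g : n1 (f + g) <= n1 f + n1 g.
Proof.
rewrite -(LreprK f) -(LreprK g); move: (Lrepr f) (Lrepr g) => u v.
rewrite LclassD !n1_Lclass.
have i1 : Int (fun x => `|u x|) by apply: integrable_norm; exact: Lf_Int1.
have i2 : Int (fun x => `|v x|) by apply: integrable_norm; exact: Lf_Int1.
have i3 : Int (fun x => `|(u + v) x|) by apply: integrable_norm; exact: Lf_Int1.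
rewrite -(RintegralD measurableT i1 i2); apply: le_Rint => //; first exact: IntD.
by move=> x; exact: ler_normD.
Qed.

(** At norm one, [|u| <= 1 + |u|^p] integrates to 2 on a probability space; the general case follows
    by homogeneity. *)
Lemma n1_le f : n1 f <= 2 * `|f|.
Proof.
have main g : `|g| = 1 -> n1 g <= 2.
  rewrite -(LreprK g); move: (Lrepr g) => u u1; rewrite n1_Lclass.
  have i1 : Int (fun x => `|u x|) by apply: integrable_norm; exact: Lf_Int1.
  have i2 : Int (fun x => 1 + `|u x| `^ p) by apply: IntD; [exact: Int_cst|exact: Lf_Int].
  apply: (@le_trans _ _ (\int[mu]_x (1 + `|u x| `^ p))).
    apply: le_Rint => // x; have [h|h] := leP `|u x| 1.
      by rewrite (le_trans h)// lerDl powR_ge0.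
    by apply: ler_wpDl => //; apply: le1r_powR; exact: ltW.
  by rewrite (RintegralD measurableT (Int_cst 1) (Lf_Int u)) Rint_cst -norm_Lclass u1 powR1.
have [->|f0] := eqVneq f 0.
  rewrite normr0 mulr0 -(LreprK 0) n1_Lclass.
  have := norm_Lrepr (0 : L); rewrite normr0 powR0 ?gt_eqF// => h.
  have : (0 : L) = Lclass 0 by [].
  move=> ->; rewrite (@Rint_ae _ (fun=> 0)) ?Rint_cst//.
    by apply: measurableT_comp => //; exact: Lf_measurable.
  by have := Lrepr_class (0 : Lf); apply: filterS => x /(_ I) /= -> _; rewrite normr0.
have fn : 0 < `|f| by rewrite normr_gt0.
have := main (`|f|^-1 *: f); rewrite normrZ normfV normr_id mulVf ?gt_eqF// => /(_ erefl).
rewrite -{1 2}(LreprK f) LclassZ n1_Lclass.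
have i1 : Int (fun x => `|Lrepr f x|) by apply: integrable_norm; exact: Lf_Int1.
under eq_Rintegral do rewrite scaleE normrM normfV normr_id.
rewrite (RintegralZl _ measurableT i1) -n1E.
by rewrite LreprK -(ler_pM2l fn) mulrA divff ?gt_eqF// mul1r mulrC.
Qed.

Lemma clipLf_subproof c u : 0 <= c -> Int (fun x => `|clip c (u x)| `^ p).
Proof.
move=> c0; apply: (@Int_le _ _ _ _ _ (fun x => `|u x| `^ p)).
- by apply: measurable_norm_powR; apply: measurable_clip; exact: Lf_measurable.
- exact: Lf_Int.
- by move=> x; rewrite ger0_norm ?powR_ge0// le_powR ?(ltW p0)// norm_clip_le.
Qed.

Definition clipLf c (c0 : 0 <= c) u : Lf :=
  mkLf p1 (measurable_clip c (Lf_measurable u)) (clipLf_subproof u c0).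

(** Truncation is only wanted for [0 <= c]; the value 0 for negative [c] frees the later statements
    from carrying a proof of [0 <= c]. *)
Definition clipL c f : L :=
  if pselect (0 <= c) is left c0 then Lclass (clipLf c0 (Lrepr f)) else 0.

Lemma clipLE c (c0 : 0 <= c) f : clipL c f = Lclass (clipLf c0 (Lrepr f)).
Proof.
rewrite /clipL; case: pselect => // c0'; congr Lclass; apply/LfuneqP => x; by [].
Qed.

Lemma clipL0 f : clipL 0 f = 0.
Proof.
rewrite (clipLE (lexx 0)) [RHS]/GRing.zero/=; apply/Lclass_eqP.
by apply/nearW => x _ /=; rewrite clip0.
Qed.

Lemma norm_clipL c f : 0 <= c -> `|clipL c f| <= `|f|.
Proof.
move=> c0; apply: norm_le_powR; rewrite (clipLE c0) norm_Lclass norm_Lrepr.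
apply: le_Rint; [exact: Lf_Int|exact: Lf_Int|] => x.
by rewrite le_powR ?(ltW p0)// norm_clip_le.
Qed.

Lemma clipL_super b c f : 0 <= b -> b <= c ->
  `|clipL c f - clipL b f| `^ p + `|clipL b f| `^ p <= `|clipL c f| `^ p.
Proof.
move=> b0 bc; have c0 : 0 <= c := le_trans b0 bc.
rewrite (clipLE b0) (clipLE c0); move: (Lrepr f) => u; rewrite LclassB !norm_Lclass.
set v := clipLf c0 u; set w := clipLf b0 u.
rewrite -(RintegralD measurableT (Lf_Int (v - w)) (Lf_Int w)).
apply: le_Rint; [exact: IntD (Lf_Int (v - w)) (Lf_Int w)|exact: Lf_Int|] => x.
by rewrite subE; exact: clip_powR_super.
Qed.

Lemma clipL_sub b c c' f e C : 0 <= b -> 2 * b <= c -> c <= c' -> 0 <= e -> 0 <= C ->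
  (forall x y : R, `|x + y| `^ p <= (1 + e) * `|x| `^ p + C * `|y| `^ p) ->
  `|clipL c' f| `^ p <= `|clipL c f| `^ p + (1 + e) * `|clipL c' f - clipL c f| `^ p +
    C * 2 `^ p * `|clipL c f - clipL b f| `^ p.
Proof.
move=> b0 bc cc' e0 C0 H; have c0 : 0 <= c by lra.
have c'0 : 0 <= c' by lra.
rewrite (clipLE b0) (clipLE c0) (clipLE c'0); move: (Lrepr f) => u; rewrite !LclassB !norm_Lclass.
set w := clipLf b0 u; set v := clipLf c0 u; set v' := clipLf c'0 u.
have h := @le_Rint_comb4 _ _ _ mu _ _ _ _ _ 1 (1 + e) (C * 2 `^ p) 0 (Lf_Int v') (Lf_Int v)
  (Lf_Int (v' - v)) (Lf_Int (v - w)) (Lf_Int v).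
apply: le_trans (h _) _ => [x|].
  rewrite !subE mul0r addr0 mul1r; exact: clip_powR_sub.
move: (Rintegral _ _ _) (Rintegral _ _ _) (Rintegral _ _ _) => *.
by rewrite mul0r addr0 mul1r.
Qed.

Lemma n1_clip_tail c f : 0 < c -> n1 (f - clipL c f) <= c `^ (1 - p) * `|f| `^ p.
Proof.
move=> c0; rewrite (clipLE (ltW c0)) norm_Lrepr -{1}(LreprK f); move: (Lrepr f) => u.
rewrite LclassB n1_Lclass -(RintegralZl _ measurableT (Lf_Int u)).
apply: le_Rint; [by apply: integrable_norm; exact: Lf_Int1|exact: IntZ (Lf_Int u)|] => x.
by rewrite subE; exact: clip_tail.
Qed.

Lemma clipL_interp c b f g : 0 <= b -> b <= c ->
  `|clipL b f - clipL b g| `^ p <= (2 * c) `^ (p - 1) * n1 (f - g).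
Proof.
move=> b0 bc; rewrite !(clipLE b0) -{2}(LreprK f) -{2}(LreprK g).
move: (Lrepr f) (Lrepr g) => u v; rewrite !LclassB n1_Lclass norm_Lclass.
have i1 : Int (fun x => `|(u - v) x|) by apply: integrable_norm; exact: Lf_Int1.
rewrite -(RintegralZl _ measurableT i1).
apply: le_Rint; [exact: Lf_Int|exact: IntZ|] => x.
by rewrite !subE; exact: clip_interp.
Qed.

(** * Conditional expectation on a finite partition *)

Section Partition.
Variables (k : nat) (q : T -> nat).
Hypothesis mq : forall l, measurable (q @^-1` [set l]).
Hypothesis qk : forall x, (q x < k)%N.
Implicit Types (a b : nat -> R).

Definition cell l (x : T) : R := (q x == l)%:R.
Definition mass l : R := \int[mu]_x cell l x.

Lemma measurable_cell l : measurable_fun setT (cell l).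
Proof.
have -> : cell l = \1_(q @^-1` [set l]).
  apply/funext => x; rewrite /cell indicE; congr (_%:R); congr nat_of_bool.
  by apply/idP/idP => [/eqP h|]; [rewrite inE|rewrite inE => /eqP].
exact: measurable_indic.
Qed.

Lemma cell_ge0 l x : 0 <= cell l x. Proof. by []. Qed.

Lemma Int_cell l : Int (cell l).
Proof.
apply: (@Int_bounded _ 1); first exact: measurable_cell.
by move=> x; rewrite ger0_norm// /cell; case: (_ == _).
Qed.

Lemma mass_ge0 l : 0 <= mass l.
Proof. exact: Rintegral_ge0. Qed.

Lemma sum_cell (F : nat -> R) x : F (q x) = \sum_(l < k) F l * cell l x.
Proof.
rewrite (bigD1 (Ordinal (qk x)))//= /cell eqxx mulr1 big1 ?addr0// => i.
rewrite -val_eqE/= => /negbTE h; rewrite eq_sym h mulr0//.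
Qed.

Lemma measurable_step a : measurable_fun setT (fun x => a (q x)).
Proof.
have -> : (fun x => a (q x)) = (fun x => \sum_(l < k) a l * cell l x).
  by apply/funext => x; rewrite sum_cell.
apply: measurable_sum => l; apply: measurable_funM => //; exact: measurable_cell.
Qed.

Lemma Int_step a : Int (fun x => a (q x)).
Proof.
have -> : (fun x => a (q x)) = (fun x => \sum_(l < k) a l * cell l x).
  by apply/funext => x; rewrite sum_cell.
by have [] := @Rint_sum k (fun l x => a l * cell l x) (fun l => IntZ (a l) (Int_cell l)).
Qed.

Lemma Rint_step a : \int[mu]_x a (q x) = \sum_(l < k) a l * mass l.
Proof.
have -> : (fun x => a (q x)) = (fun x => \sum_(l < k) a l * cell l x).
  by apply/funext => x; rewrite sum_cell.
have [_ ->] := @Rint_sum k (fun l x => a l * cell l x) (fun l => IntZ (a l) (Int_cell l)).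
by apply: eq_bigr => l _; rewrite (RintegralZl _ measurableT (Int_cell l)).
Qed.

Definition step a : Lf := mkLf p1 (measurable_step a) (Int_step (fun l => `|a l| `^ p)).

Definition stepL a : L := Lclass (step a).

Lemma norm_stepL a : `|stepL a| `^ p = \sum_(l < k) `|a l| `^ p * mass l.
Proof. by rewrite norm_Lclass (Rint_step (fun l => `|a l| `^ p)). Qed.

Lemma stepL_linear c a b : stepL (fun l => c * a l + b l) = c *: stepL a + stepL b.
Proof.
by rewrite /stepL LclassZ LclassD; congr Lclass; apply/LfuneqP.
Qed.

Lemma Int_cellM (h : T -> R) l : Int h -> Int (fun x => h x * cell l x).
Proof.
move=> ih; apply: (@Int_le _ _ _ _ _ (fun x => `|h x|)).
- by apply: measurable_funM; [exact: Int_measurable ih|exact: measurable_cell].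
- exact: integrable_norm.
- by move=> x; rewrite normrM /cell; case: (_ == _); rewrite ?normr1 ?mulr1// normr0 mulr0.
Qed.

Lemma Rint_cellM (h : T -> R) : Int h ->
  \int[mu]_x h x = \sum_(l < k) \int[mu]_x (h x * cell l x).
Proof.
move=> ih; have [_ <-] := @Rint_sum k (fun l x => h x * cell l x) (fun l => Int_cellM l ih).
congr fine; apply: eq_integral => x _; congr (_%:E).
by rewrite -mulr_sumr -[LHS]mulr1; congr (_ * _); rewrite [LHS](sum_cell (fun=> 1) x); apply: eq_bigr => l _; rewrite mul1r.
Qed.

(** On a cell of mass 0 the quotient is 0 by the convention for division; such a cell has weight 0
    in every norm. *)
Definition cavg f l : R := (\int[mu]_x (Lrepr f x * cell l x)) / mass l.

Lemma cavg_Lclass u l : cavg (Lclass u) l = (\int[mu]_x (u x * cell l x)) / mass l.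
Proof.
congr (_ / _); apply: Rint_ae.
- by apply: measurable_funM; [exact: Lf_measurable|exact: measurable_cell].
- by apply: measurable_funM; [exact: Lf_measurable|exact: measurable_cell].
- by have := Lrepr_class u; apply: filterS => x /(_ I) /= -> _.
Qed.

Lemma cavg_linear c f g l : cavg (c *: f + g) l = c * cavg f l + cavg g l.
Proof.
rewrite -(LreprK f) -(LreprK g); move: (Lrepr f) (Lrepr g) => u v.
rewrite LclassZ LclassD !cavg_Lclass mulrA -mulrDl; congr (_ / _).
have iu := Int_cellM l (Lf_Int1 u); have iv := Int_cellM l (Lf_Int1 v).
rewrite -(RintegralZl _ measurableT iu) -(RintegralD measurableT (IntZ c iu) iv).
by congr fine; apply: eq_integral => x _; congr (_%:E); rewrite addE scaleE mulrDl mulrA.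
Qed.

Definition cexp f : L := stepL (cavg f).

Lemma cexp_linear c f g : cexp (c *: f + g) = c *: cexp f + cexp g.
Proof.
rewrite /cexp -stepL_linear; congr stepL; apply/funext => l; exact: cavg_linear.
Qed.

(* Jensen's inequality on one cell, by integrating the tangent inequality at the average. *)
Lemma cavg_jensen f l : `|cavg f l| `^ p * mass l <= \int[mu]_x (`|Lrepr f x| `^ p * cell l x).
Proof.
have iu := Lf_Int (Lrepr f); have iu1 := Lf_Int1 (Lrepr f).
have [m0|m0] := eqVneq (mass l) 0.
  by rewrite m0 mulr0 Rintegral_ge0// => x _; rewrite mulr_ge0 ?powR_ge0 ?cell_ge0.
set c := cavg f l; pose K := p * `|c| `^ (p - 1) * Num.sg c.
have pw x : (`|c| `^ p - K * c) * cell l x + K * (Lrepr f x * cell l x) <=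
    `|Lrepr f x| `^ p * cell l x.
  rewrite [K * (_ * _)]mulrA -mulrDl; apply: ler_wpM2r; first exact: cell_ge0.
  have := powR_tangent p1 (normr_ge0 (Lrepr f x)) (normr_ge0 c); apply: le_trans.
  have K0 : 0 <= p * `|c| `^ (p - 1) by rewrite mulr_ge0 ?powR_ge0 ?ltW.
  rewrite -addrA lerD2l (_ : - (K * c) + K * Lrepr f x = K * (Lrepr f x - c)); last ring.
  rewrite /K -mulrA; apply: ler_wpM2l => //; rewrite mulrBr -[in leLHS]normrEsg lerD2r.
  apply: (le_trans (ler_norm _)); rewrite normrM normr_sg.
  by case: (c != 0); rewrite ?mul1r// mul0r.
have i1 := IntZ (`|c| `^ p - K * c) (Int_cell l).
have i2 := IntZ K (Int_cellM l iu1).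
have := le_Rint (IntD i1 i2) (Int_cellM l iu) pw.
rewrite (RintegralD measurableT i1 i2) (RintegralZl _ measurableT (Int_cell l)).
rewrite (RintegralZl _ measurableT (Int_cellM l iu1)) -/(mass l).
have -> : \int[mu]_x (Lrepr f x * cell l x) = c * mass l by rewrite /c /cavg divfK.
by apply: le_trans; rewrite mulrBl mulrA subrK.
Qed.

Lemma norm_cexp f : `|cexp f| <= `|f|.
Proof.
apply: norm_le_powR; rewrite norm_stepL norm_Lrepr (Rint_cellM (Lf_Int (Lrepr f))).
by apply: ler_sum => l _; exact: cavg_jensen.
Qed.

Lemma cexp_stepL a : cexp (stepL a) = stepL a.
Proof.
apply/eqP; rewrite -subr_eq0 -normr_eq0; apply/eqP; apply: (@powR_eq0_eq0 _ _ p).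
rewrite -[cexp _ - _]addrC -scaleN1r -stepL_linear norm_stepL big1// => l _.
have [m0|m0] := eqVneq (mass l) 0; first by rewrite m0 mulr0.
rewrite cavg_Lclass (_ : (fun x => step a x * cell l x) = (fun x => a l * cell l x)).
  rewrite (RintegralZl _ measurableT (Int_cell l)) -/(mass l) mulfK// mulN1r addNr.
  by rewrite normr0 powR0 ?mul0r// gt_eqF.
by apply/funext => x; rewrite /cell /=; case: eqP => [->//|_]; rewrite !mulr0.
Qed.

(** [cexp] fixes step functions and is a contraction, so [f] is nearly reproduced as soon as some
    step function is near it. *)
Lemma cexp_dist f a : `|cexp f - f| <= 2 * `|f - stepL a|.
Proof.
have E : cexp (f - stepL a) = cexp f - stepL a.
  by rewrite addrC -scaleN1r cexp_linear cexp_stepL scaleN1r addrC.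
have -> : cexp f - f = cexp (f - stepL a) - (f - stepL a).
  by rewrite E opprB addrA subrK.
by rewrite (le_trans (ler_normB _ _))// mulr2n mulrDl mul1r lerD2r norm_cexp.
Qed.

(** The factor [mass l ^ (1/p)] turns the weighted sum giving the norm of [cexp f] into an
    unweighted $\ell_p$ sum. *)
Definition ccoord f l : R := if (l < k)%N then cavg f l * mass l `^ p^-1 else 0.

Lemma ccoord_linear c f g l : ccoord (c *: f + g) l = c * ccoord f l + ccoord g l.
Proof.
rewrite /ccoord; case: ifP => _; last by rewrite mulr0 addr0.
by rewrite cavg_linear mulrDl -mulrA.
Qed.

Lemma sum_ccoord f : \sum_(l < k) `|ccoord f l| `^ p = `|cexp f| `^ p.
Proof.
rewrite norm_stepL; apply: eq_bigr => l _; rewrite /ccoord ltn_ord normrM powRM//.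
by rewrite (ger0_norm (powR_ge0 _ _)) -powRrM mulVf ?gt_eqF// powRr1// mass_ge0.
Qed.

(** A finite partition makes [cexp] bounded from $L_1$ to $L_p$, with a constant that depends on the
    partition; it is used to kill tails that are small in $L_1$ only. *)
Lemma cexp_n1 : exists2 K, 0 <= K & forall f, `|cexp f| `^ p <= K * n1 f `^ p.
Proof.
exists (\sum_(l < k) (mass l)^-1 `^ p * mass l).
  by apply: sumr_ge0 => l _; rewrite mulr_ge0 ?powR_ge0 ?mass_ge0.
move=> f; have n0 : 0 <= n1 f by exact: normr_ge0.
rewrite norm_stepL mulr_suml; apply: ler_sum => l _.
rewrite mulrAC ler_wpM2r ?mass_ge0// -powRM ?invr_ge0 ?mass_ge0//.
apply: le_powR => //; first exact: ltW.
rewrite normrM (ger0_norm (_ : 0 <= (mass l)^-1)) ?invr_ge0 ?mass_ge0// mulrC.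
rewrite ler_wpM2l ?invr_ge0 ?mass_ge0// n1E.
apply: (le_trans (le_normr_Rintegral _ _)) => //; first exact: Int_cellM (Lf_Int1 _).
apply: le_Rint.
- by apply: integrable_norm; exact: Int_cellM (Lf_Int1 _).
- by apply: integrable_norm; exact: Lf_Int1.
- by move=> x; rewrite normrM /cell; case: (_ == _); rewrite ?normr1 ?mulr1// normr0 mulr0.
Qed.

End Partition.

End Stage.

Lemma In_map_mem (A : eqType) B (h : A -> B) (s : seq A) x : x \in s -> List.In (h x) (map h s).
Proof.
elim: s => //= y s IH; rewrite inE => /predU1P[->|/IH]; [by left|by right].
Qed.

Lemma subr_split (V : zmodType) (a b c : V) : a = b + ((c - b) + (a - c)).
Proof. by rewrite addrA [b + _]addrC subrK addrC subrK. Qed.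

Lemma subr_regroup (V : zmodType) (a b c e h : V) :
  a - e - (b - c) = a - b - ((e - h) + (h - c)).
Proof.
rewrite [e - h + _]addrA subrK !opprB addrACA [RHS]addrACA; congr (_ + _).
exact: addrC.
Qed.

(** * Compact unit balls embed into $\ell_p$ *)

Section StageExists.
Context d (T : measurableType d) (R : realType).
Variables (mu : probability T R) (p : R) (p1 : 1 < p).
Local Notation L := (LspaceType mu (lt1_le1E p1)).
Local Notation Lf := (LfunType mu (lt1_le1E p1)).
Local Notation J := (@Lspace_L1 _ _ _ mu _ (lt1_le1E p1)).
Variable (X : submodClosed L).

Let p0 : 0 < p. Proof. exact: lt_trans ltr01 p1. Qed.

Lemma L1_net e : compact (J @` [set f | f \in X /\ `|f| <= 1]) -> 0 < e ->
  exists s : seq L, forall f, f \in X -> `|f| <= 1 -> exists2 g, g \in s & n1 (f - g) <= e.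
Proof.
move=> cX e0; move: cX; rewrite compact_cover => cX.
have [|w [f [fX f1]] <-|D' _ HD] := cX L [set f | f \in X /\ `|f| <= 1] (fun g => ball (J g) e).
- by move=> g _; exact: ball_open.
- by exists f => //; exact: ballxx.
exists (finmap.enum_fset D') => f fX f1.
have [//|g gD] := HD (J f); first by exists f.
rewrite -ball_normE /= -L1B => h; exists g => //.
by rewrite /n1 L1B distrC -L1B ltW.
Qed.

Lemma norm_Lclass_bounded (u : Lf) c : 0 <= c -> (forall x, `|u x| <= c) -> `|Lclass u| <= c.
Proof.
move=> c0 uc; rewrite leNgt; apply/negP => /(lt_powR p0 c0); rewrite ltNge => /negP; apply.
rewrite norm_Lclass -[leRHS](Rint_cst mu); apply: le_Rint; [exact: Lf_Int|exact: Int_cst|] => x.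
by rewrite le_powR// ltW.
Qed.

(* [D] identifies the range of [E] isometrically with a subspace of the [k]-dimensional $\ell_p$. *)
Definition is_stage (E : L -> L) (D : L -> nat -> R) (k : nat) :=
  [/\ forall c f g, E (c *: f + g) = c *: E f + E g,
      forall c f g l, D (c *: f + g) l = c * D f l + D g l,
      forall f, `|E f| <= `|f|,
      forall f, \sum_(l < k) `|D f l| `^ p = `|E f| `^ p &
      forall f l, (k <= l)%N -> D f l = 0].

(** The partition is adapted to the truncations at height [c] of a finite $L_1$-net of the ball. The
    height [c'] is chosen afterwards, since the bound of [cexp] from $L_1$ to $L_p$ depends on the
    partition. *)
Lemma stage_exists c e : compact (J @` [set f | f \in X /\ `|f| <= 1]) -> 0 <= c -> 0 < e ->
  exists E D k c', [/\ is_stage E D k, 2 * c <= c', c + 1 <= c',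
    forall f, f \in X -> `|f| <= 1 -> forall b, 0 <= b -> b <= c ->
      `|E (clipL b f) - clipL b f| <= e &
    forall f, `|f| <= 1 -> `|E (f - clipL c' f)| <= e].
Proof.
move=> cX c0 e0.
(* [K] is the constant of [clipL_interp], increased by 1 to be positive even for [c = 0]. The net
   radius makes truncations [e / 4] close in $L_p$; the partition adds [e / 4], and [cexp_dist]
   doubles the sum. *)
pose K := (2 * c) `^ (p - 1) + 1.
have K0 : 0 < K by rewrite ltr_wpDl// powR_ge0.
have e4 : 0 < e / 4 by rewrite divr_gt0.
have [s Hs] := @L1_net ((e / 4) `^ p / K) cX (divr_gt0 (powR_gt0 p e4) K0).
pose us := map (fun g : L => fun x => clip c (Lrepr g x)) s.
have Hus u : List.In u us -> measurable_fun setT u /\ forall x, `|u x| <= c.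
  rewrite /us; elim: (s) => //= g s' IH [<-|/IH//]; split.
    by apply: measurable_clip; exact: (Lf_measurable (Lrepr g)).
  by move=> x; rewrite norm_clip// ge_min lexx.
have [k [q [mq qk qg]]] := finite_partition_adapted e4 Hus.
have [K' K'0 HK'] := @cexp_n1 _ _ _ mu p p1 k q mq qk.
(* An $L_1$-norm of at most [t] ensures [K' t^p <= e^p]; the last term of [c'] brings the tail above
   [c'] down to [t]. *)
pose t := e * (K' + 1) `^ (- p^-1).
have t0 : 0 < t by rewrite mulr_gt0// powR_gt0//; lra.
pose c' := Num.max (Num.max (2 * c) (c + 1)) (t^-1 `^ (p - 1)^-1).
have c1 : c + 1 <= c' by rewrite !le_max lexx orbT.
have c'0 : 0 < c' by lra.
exists (@cexp _ _ _ mu p p1 k q mq qk), (@ccoord _ _ _ mu p p1 k q), k, c'; split.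
- split.
  + exact: cexp_linear.
  + exact: ccoord_linear.
  + exact: norm_cexp.
  + exact: sum_ccoord.
  + by move=> f l kl; rewrite /ccoord ltnNge kl.
- by rewrite !le_max lexx.
- exact: c1.
- move=> f fX f1 b b0 bc; have [g gs fg] := Hs f fX f1.
  have [a Ha] := qg _ (In_map_mem (fun g : L => fun x => clip c (Lrepr g x)) gs).
  (* One partition serves all heights [b <= c], because truncation at [b] factors through truncation
     at [c] and is 1-Lipschitz. *)
  pose ab l := clip b (a l).
  apply: (le_trans (@cexp_dist _ _ _ mu p p1 k q mq qk _ ab)).
  have h1 : `|clipL b f - clipL b g| <= e / 4.
    rewrite leNgt; apply/negP => /(lt_powR p0 (ltW e4)); rewrite ltNge => /negP; apply.
    apply: (le_trans (clipL_interp f g b0 bc)).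
    apply: (@le_trans _ _ (K * ((e / 4) `^ p / K))); last by rewrite mulrC divfK ?gt_eqF.
    by apply: ler_pM; rewrite ?powR_ge0 ?normr_ge0//; rewrite /K; lra.
  have h2 : `|clipL b g - stepL mu p1 mq qk ab| <= e / 4.
    rewrite (clipLE b0) /stepL LclassB; apply: norm_Lclass_bounded => [|x]; first exact: ltW.
    rewrite subE /ab /= -(clip_clip _ b0 bc).
    exact: le_trans (clip_lip _ _ b0) (Ha x).
  have -> : clipL b f - stepL mu p1 mq qk ab =
    (clipL b f - clipL b g) + (clipL b g - stepL mu p1 mq qk ab) by rewrite addrA subrK.
  have := ler_normD (clipL b f - clipL b g) (clipL b g - stepL mu p1 mq qk ab).
  by move: (`|_ + _|) h1 h2 => *; lra.
- move=> f f1; rewrite leNgt; apply/negP => /(lt_powR p0 (ltW e0)); rewrite ltNge => /negP; apply.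
  apply: (le_trans (HK' _)).
  have fp : `|f| `^ p <= 1 by have := @le_powR _ p _ _ (ltW p0) (normr_ge0 f) f1; rewrite powR1.
  have tc : c' `^ (1 - p) <= t.
    have h : t^-1 <= c' `^ (p - 1).
      have : (t^-1 `^ (p - 1)^-1) `^ (p - 1) <= c' `^ (p - 1).
        apply: le_powR; rewrite ?powR_ge0//; first by rewrite subr_ge0 ltW.
        by rewrite !le_max lexx orbT.
      rewrite -powRrM mulVf ?powRr1 ?invr_ge0 ?(ltW t0)//.
      by rewrite gt_eqF// subr_gt0.
    rewrite -opprB powRN -[leRHS]invrK lef_pV2 ?posrE ?invr_gt0//.
    exact: powR_gt0.
  have n1t : n1 (f - clipL c' f) <= t.
    apply: (le_trans (n1_clip_tail f c'0)); apply: le_trans tc.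
    by rewrite ler_piMr// powR_ge0.
  apply: (@le_trans _ _ (K' * t `^ p)).
    by rewrite ler_wpM2l// le_powR// ?normr_ge0// ltW.
  have K1 : 0 <= K' + 1 by lra.
  rewrite /t powRM ?powR_ge0 ?(ltW e0)// -powRrM mulNr mulVf ?gt_eqF// powR_inv1//.
  rewrite mulrCA ler_piMr ?powR_ge0// ler_pdivrMr; lra.
Qed.

End StageExists.

(* For the heights [c m]: [t m] is the [p]-th power of the norm of [clipL (c m) f], and [s m], [z m]
   those of the increments from [c m] to [c m.+1] and from [c (m - N)] to [c m]. *)
Lemma window_sums (R : realType) (N : nat) (K e C : R) (t s z : nat -> R) :
  t 0%N = 0 -> (forall m, 0 <= t m) -> (forall m, t m <= K) -> (forall m, 0 <= s m) ->
  (forall m, t m + s m <= t m.+1) ->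
  (forall m, (m < N)%N -> z m = t m) ->
  (forall m, t m + z (m + N)%N <= t (m + N)%N) ->
  (forall m, t (m + N)%N <= t m + (1 + e) * z (m + N)%N + C * s m.-1) ->
  0 <= e -> 0 <= C -> 0 <= K ->
  [/\ forall M, \sum_(m < M) s m <= K,
      forall M, \sum_(m < M + N) z m <= N%:R * K &
      forall M, \sum_(j < N) t (M + j)%N <= (1 + e) * (\sum_(m < M + N) z m) + C * (2 * K)].
Proof.
move=> t0 t_ge0 tK s_ge0 ts zt zs tz e0 C0 K0.
have S M : \sum_(m < M) s m <= t M.
  elim: M => [|M IH]; first by rewrite big_ord0 t0.
  by rewrite big_ord_recr/=; have := ts M; lra.
have SK M : \sum_(m < M) s m <= K by exact: le_trans (S M) (tK M).
(* Sliding the window of [N] consecutive terms by one place changes its sum by [t (M + N) - t M],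
   which [zs] and [tz] compare with [z (M + N)]. *)
have win M : \sum_(j < N) t (M.+1 + j)%N = \sum_(j < N) t (M + j)%N + t (M + N)%N - t M.
  have E1 : \sum_(j < N.+1) t (M + j)%N = \sum_(j < N) t (M + j)%N + t (M + N)%N.
    by rewrite big_ord_recr.
  have E2 : \sum_(j < N.+1) t (M + j)%N = t M + \sum_(j < N) t (M.+1 + j)%N.
    rewrite big_ord_recl addn0; congr (_ + _).
    by apply: eq_bigr => i _; rewrite lift0 addnS.
  by rewrite -E1 E2 addrAC subrr add0r.
split=> // M.
  apply: (@le_trans _ _ (\sum_(j < N) t (M + j)%N)); last first.
    rewrite mulr_natl -[in leRHS](card_ord N) -sumr_const.
    by apply: ler_sum => i _; exact: tK.
  elim: M => [|M IH].
    by rewrite add0n le_eqVlt; apply/orP; left; apply/eqP; apply: eq_bigr => i _; rewrite zt.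
  by rewrite addSn big_ord_recr/= win; have := zs M; lra.
(* The shift to [m.-1] counts [s 0] twice, hence [2 * K]. *)
have P M' : \sum_(m < M') s m.-1 <= 2 * K.
  case: M' => [|M']; first by rewrite big_ord0; lra.
  rewrite big_ord_recl; under eq_bigr do rewrite lift0.
  by have := SK M'; have := SK 1%N; rewrite big_ord1/=; lra.
apply: (@le_trans _ _ ((1 + e) * (\sum_(m < M + N) z m) + C * (\sum_(m < M) s m.-1))); last first.
  by rewrite lerD2l ler_wpM2l.
elim: M => [|M IH].
  rewrite add0n big_ord0 mulr0 addr0 (eq_bigr (fun j : 'I_N => z j)) => [|i _]; last by rewrite zt.
  have : 0 <= \sum_(m < N) z m by apply: sumr_ge0 => i _; rewrite zt.
  by nra.
rewrite addSn !big_ord_recr/= win; have := tz M.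
by move: IH; rewrite !mulrDr; lra.
Qed.

Lemma shift_sum (R : realType) (N : nat) (F : nat -> R) M :
  \sum_(m < M) (if (N <= m)%N then F (m - N)%N else 0) = \sum_(m < M - N) F m.
Proof.
elim: M => [|M IH]; first by rewrite !big_ord0.
rewrite big_ord_recr/= IH; case: leqP => [NM|MN].
  by rewrite subSn// big_ord_recr.
rewrite addr0; have /eqP -> : (M - N == 0)%N by rewrite subn_eq0 ltnW.
have /eqP -> : (M.+1 - N == 0)%N by rewrite subn_eq0.
by rewrite !big_ord0.
Qed.

Lemma sum_half (R : realType) M : \sum_(m < M) (2^-1 : R) ^+ m <= 2.
Proof.
suff : \sum_(m < M) (2^-1 : R) ^+ m = 2 - 2 * 2^-1 ^+ M.
  by move=> ->; rewrite gerBl mulr_ge0// exprn_ge0// invr_ge0.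
elim: M => [|M IH]; first by rewrite big_ord0 expr0 mulr1 subrr.
by rewrite big_ord_recr/= IH exprS mulrA divff// mul1r; lra.
Qed.

Lemma powR_add3_ub (R : realType) (p a b c : R) : 1 <= p -> 0 <= a -> 0 <= b -> 0 <= c ->
  (a + b + c) `^ p <= 2 `^ p * 2 `^ p * (a `^ p + b `^ p + c `^ p).
Proof.
move=> p1 a0 b0 c0; have two : 1 <= 2 `^ p.
  by have := @le_powR _ p 1 2 (le_trans ler01 p1) ler01; rewrite powR1; apply; lra.
apply: (le_trans (powR_add_ub p1 (addr_ge0 a0 b0) c0)).
rewrite -mulrA ler_wpM2l ?powR_ge0// mulrDr lerD//; first exact: powR_add_ub.
by rewrite ler_peMl// powR_ge0.
Qed.

(** * Layers, windows and almost isometric coordinates *)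

Section Embedding.
Context d (T : measurableType d) (R : realType).
Variables (mu : probability T R) (p : R) (p1 : 1 < p).
Local Notation L := (LspaceType mu (lt1_le1E p1)).
Local Notation J := (@Lspace_L1 _ _ _ mu _ (lt1_le1E p1)).
Variable (X : submodClosed L).

Let p0 : 0 < p. Proof. exact: lt_trans ltr01 p1. Qed.

(** Monotone convergence along integer heights; monotonicity of the norm in the height covers the
    others. *)
Lemma clipL_cvg (f : L) e : 0 < e -> exists2 c0, 0 <= c0 &
  forall c, c0 <= c -> `|f| `^ p <= `|clipL c f| `^ p + e.
Proof.
move=> e0; apply: contrapT => H.
pose g (n : nat) (x : T) : \bar R := (`|clip n%:R (Lrepr f x)| `^ p)%:E.
have mg n : measurable_fun setT (g n).
  apply/measurable_EFinP; apply: measurable_norm_powR; apply: measurable_clip.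
  exact: Lf_measurable.
have g0 n x : setT x -> (0 <= g n x)%E by move=> _; rewrite lee_fin powR_ge0.
have ndg x : setT x -> {homo g^~ x : n m / (n <= m)%N >-> (n <= m)%E}.
  move=> _ n m nm; rewrite lee_fin le_powR ?(ltW p0)// !norm_clip//.
  by rewrite le_min !ge_min ler_nat nm lexx orbT.
have := @cvg_monotone_convergence _ _ _ mu setT measurableT _ mg g0 ndg.
have -> : (fun x => limn (g^~ x)) = (fun x => (`|Lrepr f x| `^ p)%:E).
  apply/funext => x; apply/cvg_lim => //; apply: cvg_near_cst.
  near=> n; rewrite /g clip_id//.
  by near: n; exact: nbhs_infty_ger.
have -> : (fun n => \int[mu]_x g n x)%E = (fun n => (`|clipL n%:R f| `^ p)%:E).
  apply/funext => n; rewrite (clipLE (ler0n _ n)) norm_Lclass /Rintegral.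
  by rewrite fineK; last exact: integrable_fin_num (Lf_Int _).
have -> : (\int[mu]_x (`|Lrepr f x| `^ p)%:E)%E = (`|f| `^ p)%:E.
  rewrite norm_Lrepr /Rintegral fineK//; exact: integrable_fin_num (Lf_Int _).
move=> /fine_cvgP[_] /= cv; apply: H.
have /cvgrPdist_le/(_ e e0)[N _ HN] := cv.
exists N%:R => // c Nc; have := HN N (leqnn N) => /=.
have := @clipL_super _ _ _ mu _ p1 N%:R c f (ler0n _ _) Nc.
have := powR_ge0 `|clipL c f - clipL N%:R f| p.
by move=> h1 h2; move/ler_normlW; lra.
Unshelve. all: by end_near.
Qed.

(** [c m.+1] is known only once the partition of stage [m] is chosen, so the recursion returns the
    next height together with the stage. The precision [2^-m] makes the errors summable. *)
Lemma stage_sequence : compact (J @` [set f | f \in X /\ `|f| <= 1]) ->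
  exists (c : nat -> R) (E : nat -> L -> L) (D : nat -> L -> nat -> R) (k : nat -> nat),
  [/\ c 0%N = 0, forall m, is_stage (E m) (D m) (k m),
    forall m, m%:R <= c m /\ 2 * c m <= c m.+1,
    forall m f b, f \in X -> `|f| <= 1 -> 0 <= b -> b <= c m ->
      `|E m (clipL b f) - clipL b f| <= 2^-1 ^+ m &
    forall m f, `|f| <= 1 -> `|E m (f - clipL (c m.+1) f)| <= 2^-1 ^+ m].
Proof.
move=> cX; pose eta m : R := 2^-1 ^+ m.
have eta0 m : 0 < eta m by rewrite exprn_gt0// invr_gt0.
have /choice[F HF] : forall mc : nat * R, exists y : (L -> L) * (L -> nat -> R) * nat * R,
  0 <= mc.2 -> [/\ is_stage y.1.1.1 y.1.1.2 y.1.2, 2 * mc.2 <= y.2, mc.2 + 1 <= y.2,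
    forall f, f \in X -> `|f| <= 1 -> forall b, 0 <= b -> b <= mc.2 ->
      `|y.1.1.1 (clipL b f) - clipL b f| <= eta mc.1 &
    forall f, `|f| <= 1 -> `|y.1.1.1 (f - clipL y.2 f)| <= eta mc.1].
  move=> [m c]; have [c0|c0] := leP 0 c; last first.
    (* The recursion never meets a negative height; [choice] only asks for some value there. *)
    by exists (id, (fun _ _ => 0), 0%N, 0) => /= h; lra.
  have [E [D [k [c' H]]]] := stage_exists cX c0 (eta0 m).
  by exists (E, D, k, c').
pose cs := fix cs (m : nat) : R := if m is m'.+1 then (F (m', cs m')).2 else 0.
have cs_ge0 m : 0 <= cs m.
  elim: m => [|m IH]; first by rewrite /cs.
  by rewrite /=; have [_ _ h _ _] := HF (m, cs m) IH; move: h => /=; lra.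
exists cs, (fun m => (F (m, cs m)).1.1.1), (fun m => (F (m, cs m)).1.1.2),
  (fun m => (F (m, cs m)).1.2); split=> //.
- by move=> m; have [] := HF (m, cs m) (cs_ge0 m).
- move=> m; split; last by have [] := HF (m, cs m) (cs_ge0 m).
  elim: m => [//|m IH]; have [_ _ h _ _] := HF (m, cs m) (cs_ge0 m).
  by rewrite -natr1; move: h => /=; lra.
- move=> m f b fX f1; have [_ _ _ h _] := HF (m, cs m) (cs_ge0 m); exact: h.
- by move=> m f f1; have [_ _ _ _ h] := HF (m, cs m) (cs_ge0 m); exact: h.
Qed.

Section Blocks.
Variables (c : nat -> R) (E : nat -> L -> L) (D : nat -> L -> nat -> R) (k : nat -> nat).
Hypothesis c0 : c 0%N = 0.
Hypothesis stE : forall m, is_stage (E m) (D m) (k m).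
Hypothesis c_lb : forall m, m%:R <= c m.
Hypothesis c2 : forall m, 2 * c m <= c m.+1.
Hypothesis Eclip : forall m f b, f \in X -> `|f| <= 1 -> 0 <= b -> b <= c m ->
      `|E m (clipL b f) - clipL b f| <= 2^-1 ^+ m.
Hypothesis Etail : forall m f, `|f| <= 1 -> `|E m (f - clipL (c m.+1) f)| <= 2^-1 ^+ m.
Variable N : nat.

(** [E m] of this approximates the window of [f] from [c (m - N)] to [c m]. For [m < N] the window
    starts at height 0 and nothing is subtracted. *)
Definition block (f : L) m : L := if (N <= m)%N then f - E (m - N) f else f.

Let c_ge0 m : 0 <= c m. Proof. exact: le_trans (ler0n _ _) (c_lb m). Qed.

Let c_mono m n : (m <= n)%N -> c m <= c n.
Proof.
elim: n => [|n IH]; first by rewrite leqn0 => /eqP ->.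
rewrite leq_eqVlt => /predU1P[->//|]; rewrite ltnS => /IH; have := c2 n; have := c_ge0 n; lra.
Qed.

Let ED m f g : E m (f + g) = E m f + E m g.
Proof. by have [h _ _ _ _] := stE m; have := h 1 f g; rewrite !scale1r. Qed.

Let EN m f : E m (- f) = - E m f.
Proof.
have E0 : E m 0 = 0.
  by have := ED m 0 0; rewrite addr0 => h; apply: (@addrI _ (E m 0)); rewrite addr0 -h.
by apply: (@addrI _ (E m f)); rewrite -ED !subrr.
Qed.

Let E_le m f : `|E m f| <= `|f|. Proof. by have [_ _ h _ _] := stE m. Qed.

(** [sl] is the slice about which stage [m] says nothing beyond contraction, and [zl] is the window.
    For [m < N] the truncated difference [m - N] is 0 and [c 0 = 0], so [zl] is then the whole
    truncation. *)
Let sl f m : L := clipL (c m.+1) f - clipL (c m) f.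
Let zl f m : L := clipL (c m) f - clipL (c (m - N)%N) f.

(** [f] is the sum of its truncation at [c m], which [E m] reproduces up to [2^-m], the slice, which
    is contracted, and the part above [c m.+1], which is killed up to [2^-m]. *)
Lemma stage_clip_dist f m : f \in X -> `|f| <= 1 ->
  `|E m f - clipL (c m) f| <= `|sl f m| + 2 * 2^-1 ^+ m.
Proof.
move=> fX f1.
have fE : f = clipL (c m) f + (sl f m + (f - clipL (c m.+1) f)).
  exact: subr_split.
rewrite {1}fE [E m (_ + (_ + _))]ED [E m (sl f m + _)]ED addrAC.
have h1 := Eclip fX f1 (c_ge0 m) (lexx _).
have h2 := Etail m f1; have h3 := E_le m (sl f m).
apply: (le_trans (ler_normD _ _)); have := ler_normD (E m (sl f m)) (E m (f - clipL (c m.+1) f)).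
move: h1 h2 h3; set x1 := `|_ - _|; set x2 := `|_|; set x3 := `|_|.
by move: (`|_ + _|) => w; lra.
Qed.

(** Of the factor 3, two units come from stage [m] on [f] and one from [E m] on the truncation at
    the lower height [c (m - N)]. The contraction [E m] passes on the error of stage [m - N]. *)
Lemma block_dist f m : f \in X -> `|f| <= 1 ->
  `|E m (block f m) - zl f m| <= `|sl f m| + (if (N <= m)%N then `|sl f (m - N)| else 0) +
   (3 * 2^-1 ^+ m + (if (N <= m)%N then 2 * 2^-1 ^+ (m - N) else 0)).
Proof.
move=> fX f1; have h := stage_clip_dist m fX f1.
have e0 : 0 <= (2^-1 : R) ^+ m by rewrite exprn_ge0// invr_ge0.
rewrite /block /zl; case: leqP => [Nm|mN]; last first.
  have /eqP -> : (m - N == 0)%N by rewrite subn_eq0 ltnW.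
  by rewrite c0 clipL0 subr0; lra.
have h' := stage_clip_dist (m - N) fX f1.
have h2 := Eclip fX f1 (c_ge0 (m - N)) (c_mono (leq_subr N m)).
have h3 := E_le m (E (m - N) f - clipL (c (m - N)) f).
rewrite ED EN.
have -> : E m f - E m (E (m - N)%N f) - (clipL (c m) f - clipL (c (m - N)%N) f) =
  (E m f - clipL (c m) f) - (E m (E (m - N)%N f - clipL (c (m - N)%N) f) +
   (E m (clipL (c (m - N)%N) f) - clipL (c (m - N)%N) f)).
  by rewrite [E m (_ - clipL _ _)]ED EN; exact: subr_regroup.
apply: (le_trans (ler_normB _ _)).
have := ler_normD (E m (E (m - N)%N f - clipL (c (m - N)%N) f)) (E m (clipL (c (m - N)%N) f) - clipL (c (m - N)%N) f).
by move: (`|_ + _|) => w; lra.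
Qed.

(** The point is that [Q] does not involve [N]: the [p]-th powers of the slices sum to at most 1,
    both at [m] and at [m - N], and the remaining errors are geometric. *)
Lemma block_sums f e C : f \in X -> `|f| = 1 -> 0 < e -> 0 <= C ->
  (forall a b : R, `|a + b| `^ p <= (1 + e) * `|a| `^ p + C * `|b| `^ p) ->
  let Q := C * (2 `^ p * 2 `^ p * (1 + 1 + 10 * 5 `^ p)) in
  (forall M, \sum_(m < M) `|E m (block f m)| `^ p <= (1 + e) * N%:R + Q) /\
  exists M, N%:R * (1 - e) <=
    (1 + e) * ((1 + e) * \sum_(m < M) `|E m (block f m)| `^ p + Q) + C * 2 `^ p * 2.
Proof.
move=> fX f1 ep C0 HC Q; have f1' : `|f| <= 1 by rewrite f1.
have fp : `|f| `^ p = 1 by rewrite f1 powR1.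
pose er m := `|sl f m| + (if (N <= m)%N then `|sl f (m - N)| else 0) +
   (3 * 2^-1 ^+ m + (if (N <= m)%N then 2 * 2^-1 ^+ (m - N) else 0)).
have hf0 m : 0 <= (2^-1 : R) ^+ m by rewrite exprn_ge0// invr_ge0.
have hf1 m : (2^-1 : R) ^+ m <= 1 by rewrite exprn_ile1// ?invr_ge0// invf_le1// ler1n.
have er0 m : 0 <= er m.
  by rewrite /er; case: ifP => _; rewrite !addr_ge0// mulr_ge0.
have [SS ZZ LL] : [/\ forall M, \sum_(m < M) `|sl f m| `^ p <= 1,
    forall M, \sum_(m < M + N) `|zl f m| `^ p <= N%:R * 1 &
    forall M, \sum_(j < N) `|clipL (c (M + j)%N) f| `^ p <=
     (1 + e) * (\sum_(m < M + N) `|zl f m| `^ p) + C * 2 `^ p * (2 * 1)].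
  apply: (@window_sums R N 1 e (C * 2 `^ p) (fun m => `|clipL (c m) f| `^ p)
    (fun m => `|sl f m| `^ p) (fun m => `|zl f m| `^ p)) => //.
  - by rewrite c0 clipL0 normr0 powR0// gt_eqF.
  - by move=> m; rewrite -fp le_powR ?(ltW p0)// norm_clipL.
  - by move=> m; rewrite addrC; apply: clipL_super => //; exact: c_mono.
  - move=> m mN; have /eqP h : (m - N == 0)%N by rewrite subn_eq0 ltnW.
    by rewrite /zl h c0 clipL0 subr0.
  - move=> m; rewrite /zl addnK addrC; apply: clipL_super => //; apply: c_mono; exact: leq_addr.
  - move=> m; rewrite /zl addnK.
    have cm : 2 * c m.-1 <= c m by case: (m) => [|m'] /=; rewrite ?c0 ?mulr0.
    apply: (le_trans (clipL_sub f (c_ge0 m.-1) cm (c_mono (leq_addr N m)) (ltW ep) C0 HC)).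
    rewrite lerD2l ler_wpM2l ?mulr_ge0 ?powR_ge0//; case: (m) => [|m'] //=.
    by rewrite subrr normr0 powR0 ?powR_ge0// gt_eqF.
  - exact: ltW.
  - by rewrite mulr_ge0// powR_ge0.
have p1' : 1 <= p := ltW p1.
have SB M : \sum_(m < M) (if (N <= m)%N then `|sl f (m - N)| else 0) `^ p <= 1.
  apply: le_trans (SS (M - N)%N); rewrite -(shift_sum N (fun m => `|sl f m| `^ p)) le_eqVlt; apply/orP; left; apply/eqP.
  by apply: eq_bigr => m _; case: ifP => // _; rewrite powR0// gt_eqF.
(* [H] is at most [3 + 2 = 5] and has sum at most [6 + 4 = 10]; since [H^p <= H 5^p], its [p]-th
   powers sum to at most [10 * 5^p]. *)
pose H m : R := 3 * 2^-1 ^+ m + (if (N <= m)%N then 2 * 2^-1 ^+ (m - N) else 0).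
have H0 m : 0 <= H m by rewrite /H; case: ifP => _; rewrite ?addr_ge0// mulr_ge0.
have H5 m : H m <= 5.
  by rewrite /H; case: ifP => _; have := hf1 m; have := hf1 (m - N)%N; lra.
have SH M : \sum_(m < M) H m `^ p <= 10 * 5 `^ p.
  apply: (@le_trans _ _ (\sum_(m < M) H m * 5 `^ p)).
    apply: ler_sum => m _; rewrite -(mulr_powRB1 (H0 m) p0) ler_wpM2l//.
    apply: (@le_trans _ _ (5 `^ (p - 1))); first by rewrite le_powR ?subr_ge0.
    by apply: ler_powR; [rewrite ler1n|rewrite gerBl].
  rewrite -mulr_suml ler_wpM2r ?powR_ge0// big_split/= -mulr_sumr.
  have := sum_half R M; have := sum_half R (M - N).
  rewrite (shift_sum N (fun m => 2 * 2^-1 ^+ m)) -mulr_sumr; lra.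
have SE M : \sum_(m < M) er m `^ p <= 2 `^ p * 2 `^ p * (1 + 1 + 10 * 5 `^ p).
  apply: (@le_trans _ _ (\sum_(m < M) 2 `^ p * 2 `^ p *
    (`|sl f m| `^ p + (if (N <= m)%N then `|sl f (m - N)| else 0) `^ p + H m `^ p))).
    apply: ler_sum => m _; apply: powR_add3_ub => //; last exact: H0.
    by case: ifP.
  rewrite -mulr_sumr ler_wpM2l ?mulr_ge0 ?powR_ge0// !big_split/=.
  by apply: lerD; [apply: lerD; [exact: SS|exact: SB]|exact: SH].
have CE M : C * \sum_(m < M) er m `^ p <= Q by rewrite ler_wpM2l.
have two_sided (a b x : R) : 0 <= a -> 0 <= b -> 0 <= x -> a <= b + x ->
    a `^ p <= (1 + e) * b `^ p + C * x `^ p.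
  move=> a0 b0 x0 abx; have := HC b x; rewrite !ger0_norm ?addr_ge0//; apply: le_trans.
  by rewrite le_powR// ltW.
have bd m : `|E m (block f m) - zl f m| <= er m by exact: block_dist.
have up m : `|E m (block f m)| `^ p <= (1 + e) * `|zl f m| `^ p + C * er m `^ p.
  apply: two_sided => //; have := ler_normD (zl f m) (E m (block f m) - zl f m).
  by rewrite addrCA subrr addr0; have := bd m; lra.
have lo m : `|zl f m| `^ p <= (1 + e) * `|E m (block f m)| `^ p + C * er m `^ p.
  apply: two_sided => //; have := ler_normB (E m (block f m)) (E m (block f m) - zl f m).
  by rewrite opprB addrCA subrr addr0; have := bd m; lra.
have e1 : 0 <= 1 + e by lra.
split.
  move=> M; apply: (@le_trans _ _ (\sum_(m < M) ((1 + e) * `|zl f m| `^ p + C * er m `^ p))).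
    by apply: ler_sum => m _; exact: up.
  rewrite big_split/= -!mulr_sumr; apply: lerD; last exact: CE.
  apply: ler_wpM2l => //; rewrite -[leRHS]mulr1; apply: le_trans (ZZ M).
  by rewrite big_split_ord/= lerDl sumr_ge0// => m _; rewrite powR_ge0.
have [b b0 Hb] := clipL_cvg f ep.
(* From index [M] on, the heights exceed [b], so each of the [N] truncations in the window keeps all
   but [e] of the [p]-th power of the norm. *)
pose M := (Num.truncn b).+1; exists (M + N)%N.
have Mb j : b <= c (M + j)%N.
  apply: (@le_trans _ _ M%:R); first by apply: ltW; exact: truncnS_gt.
  by apply: (le_trans (c_lb M)); apply: c_mono; exact: leq_addr.
have : N%:R * (1 - e) <= \sum_(j < N) `|clipL (c (M + j)%N) f| `^ p.
  rewrite mulr_natl -[in leLHS](card_ord N) -sumr_const.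
  by apply: ler_sum => j _; have := Hb _ (Mb j); rewrite fp; lra.
have := LL M.
have : \sum_(m < M + N) `|zl f m| `^ p <= (1 + e) * (\sum_(m < M + N) `|E m (block f m)| `^ p) + Q.
  apply: (@le_trans _ _ (\sum_(m < M + N) ((1 + e) * `|E m (block f m)| `^ p + C * er m `^ p))).
    by apply: ler_sum => m _; exact: lo.
  by rewrite big_split/= -!mulr_sumr; apply: lerD => //; exact: CE.
move=> /(ler_wpM2l e1).
move: (\sum_(j < N) _) (\sum_(m < M + N) _ `^ _) (\sum_(m < M + N) _) => x y z; lra.
Qed.

End Blocks.

Lemma almost_isometric_coords e0 : compact (J @` [set f | f \in X /\ `|f| <= 1]) -> 0 < e0 ->
  exists (W : L -> nat -> nat -> R) (k : nat -> nat),
  [/\ forall c f g m l, W (c *: f + g) m l = c * W f m l + W g m l,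
    forall f m l, (k m <= l)%N -> W f m l = 0 &
    forall f, f \in X -> `|f| = 1 ->
      (forall M, \sum_(m < M) \sum_(l < k m) `|W f m l| `^ p <= 1 + e0) /\
      exists M, 1 - e0 <= \sum_(m < M) \sum_(l < k m) `|W f m l| `^ p].
Proof.
move=> cX e00.
(* The lower estimate loses the factor [(1 + e)^2] and the term [2 e];
   [(1 + e)^2 (1 - 4 e) <= 1 - 2 e] makes up for both. *)
pose e := e0 / 4; have ep : 0 < e by rewrite divr_gt0.
have [C C0 HC] := powR_add_eps p1 ep.
pose Q := C * (2 `^ p * 2 `^ p * (1 + 1 + 10 * 5 `^ p)).
have Q0 : 0 <= Q.
  have := powR_ge0 2 p; have := powR_ge0 5 p => h1 h2.
  by rewrite !mulr_ge0// !addr_ge0// mulr_ge0.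
pose Q' := (1 + e) * Q + C * 2 `^ p * 2.
have Q'0 : 0 <= Q'.
  by rewrite addr_ge0// !mulr_ge0 ?powR_ge0//; lra.
(* [Q] and [Q'] are independent of [N], so [N] can be taken large compared with them. *)
pose N := (Num.truncn ((Q + Q') / e)).+1.
have NQ : Q + Q' <= e * N%:R.
  by rewrite mulrC -ler_pdivrMr// ltW// truncnS_gt.
have N0 : 0 < N%:R :> R by rewrite ltr0n.
have [c [E [D [k [c0 stE /all_and2[c_lb c2] Eclip Etail]]]]] := stage_sequence cX.
exists (fun f m l => N%:R `^ (- p^-1) * D m (block E N f m) l), k; split.
- move=> a f g m l.
  have [EL DL _ _ _] := stE m; have [ELN _ _ _ _] := stE (m - N)%N.
  have -> : block E N (a *: f + g) m = a *: block E N f m + block E N g m.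
    rewrite /block; case: ifP => // _; rewrite ELN scalerBr opprD addrACA.
    by rewrite addrACA.
  by rewrite DL mulrDr mulrCA.
- by move=> f m l kl; have [_ _ _ _ ->] := stE m; rewrite ?mulr0.
- move=> f fX f1.
  have [up [M lo]] := block_sums c0 stE c_lb c2 Eclip Etail N fX f1 ep C0 HC.
  rewrite -/Q in up lo.
  have S M' : \sum_(m < M') \sum_(l < k m) `|N%:R `^ (- p^-1) * D m (block E N f m) l| `^ p =
      N%:R^-1 * \sum_(m < M') `|E m (block E N f m)| `^ p.
    rewrite mulr_sumr; apply: eq_bigr => m _; have [_ _ _ <- _] := stE m.
    rewrite mulr_sumr; apply: eq_bigr => l _; rewrite normrM powRM//.
    by rewrite (ger0_norm (powR_ge0 _ _)) -powRrM mulNr mulVf ?gt_eqF// powR_inv1.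
  have e4 : e0 = 4 * e by rewrite /e; lra.
  split => [M'|].
    rewrite S ler_pdivrMl//; apply: (le_trans (up M')); rewrite e4; nra.
  exists M; rewrite S ler_pdivlMl// e4.
  move: lo; set Z := \sum_(m < M) _ => lo.
  have Z0 : 0 <= Z by apply: sumr_ge0 => m _; rewrite powR_ge0.
  have lo' : N%:R * (1 - e) - Q' <= (1 + e) * (1 + e) * Z by rewrite /Q'; lra.
  have NQ' : Q' <= e * N%:R by lra.
  have lo2 : N%:R * (1 - 2 * e) <= (1 + e) * (1 + e) * Z by lra.
  have [h|h] := leP (1 - 4 * e) 0; first by apply: le_trans Z0; nra.
  have ee : (1 + e) * (1 + e) * (1 - 4 * e) <= 1 - 2 * e by nra.
  have e1 : 0 < (1 + e) * (1 + e) by apply: mulr_gt0; apply: addr_gt0.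
  rewrite -(ler_pM2l e1); apply: le_trans lo2.
  by have := ler_wpM2l (ltW N0) ee; lra.
Qed.

End Embedding.

(** * Operator norms and the distance of a space to its embedded image *)

Section OperatorNorm.
Context (R : realType) (U V : normedModType R).
Implicit Types (f : {linear U -> V}) (C : R).

Lemma bounded_linear_cont f C : (forall x, `|f x| <= C * `|x|) -> continuous f.
Proof.
move=> H; apply/linear_bounded_continuous/linear_boundedP; near=> r => x.
by apply: (le_trans (H x)); apply: ler_wpM2r.
Unshelve. all: by end_near.
Qed.

Lemma opnorm_le (f : U -> V) C : 0 <= C -> (forall x, `|f x| <= C * `|x|) ->
  (opnorm f <= C%:E)%E.
Proof.
move=> C0 H; apply: ub_ereal_sup => _ [x x1 <-]; rewrite lee_fin.
by apply: (le_trans (H x)); rewrite ler_piMr.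
Qed.

Lemma opnorm_ge0 f : (0 <= opnorm f)%E.
Proof.
apply: (@le_trans _ _ (`|f 0|%:E)); first by rewrite lee_fin.
by apply: ereal_sup_ubound; exists 0 => //=; rewrite normr0.
Qed.

Lemma opnorm_bound f C : (opnorm f <= C%:E)%E -> forall x, `|f x| <= C * `|x|.
Proof.
move=> fC x; have [->|x0] := eqVneq x 0; first by rewrite linear0 !normr0 mulr0.
have xn : 0 < `|x| by rewrite normr_gt0.
have : (`|f (`|x|^-1 *: x)|%:E <= C%:E)%E.
  apply: le_trans fC; apply: ereal_sup_ubound; exists (`|x|^-1 *: x) => //=.
  by rewrite normrZ normfV normr_id mulVf ?gt_eqF.
by rewrite lee_fin linearZ/= normrZ normfV normr_id ler_pdivrMl// mulrC.
Qed.

Lemma opnorm_fin f : continuous f -> opnorm f \is a fin_num.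
Proof.
move=> /linear_bounded_continuous/linear_boundedP /= fb.
have [M [_ HM]] := fb.
have M1 : M < `|M| + 1 by have := ler_norm M; lra.
have := @opnorm_le f _ _ (HM _ M1) => h.
rewrite ge0_fin_numE ?opnorm_ge0//; apply: (@le_lt_trans _ _ (`|M| + 1)%:E); last exact: ltry.
by apply: h; rewrite addr_ge0.
Qed.

End OperatorNorm.

(** Names a function together with a proof of its linearity, so that the linear structure can be
    attached to the name. *)
Definition mklinear (R : realType) (U V : normedModType R) (S : U -> V) (h : linear S) := S.

HB.instance Definition _ (R : realType) (U V : normedModType R) (S : U -> V) (h : linear S) :=
  GRing.isLinear.Build R U V _ (mklinear h) h.

Section LinearRange.
Context (R : realType) (U V : normedModType R) (S : {linear U -> V}) (a : R).
Hypothesis a0 : 0 < a.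
Hypothesis Sa : forall x, a * `|x| <= `|S x|.

Definition lrange : {pred V} := fun y => `[< exists x, S x = y >].

Lemma lrange_closed : submod_closed lrange.
Proof.
split; first by apply/asboolP; exists 0; rewrite linear0.
move=> c y z /asboolP[x <-] /asboolP[x' <-]; apply/asboolP.
by exists (c *: x + x'); rewrite linearP.
Qed.

HB.instance Definition _ := GRing.isSubmodClosed.Build R V lrange lrange_closed.

Definition lrange_submod : submodClosed V := lrange.

Lemma lrange_preimage (y : subspace_of lrange_submod) : exists x, S x = val y.
Proof. exact/asboolP/(valP y). Qed.

Definition lrange_inv (y : subspace_of lrange_submod) : U := projT1 (cid (lrange_preimage y)).

Lemma lrange_invK y : S (lrange_inv y) = val y.
Proof. by rewrite /lrange_inv; case: cid. Qed.

Lemma below_inj : injective S.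
Proof.
move=> x y xy; apply/eqP; rewrite -subr_eq0 -normr_eq0.
have := Sa (x - y); rewrite linearB/= xy subrr normr0 => h.
by rewrite eq_le normr_ge0 andbT -(ler_pM2l a0) mulr0.
Qed.

Lemma lrange_inv_linear : linear lrange_inv.
Proof.
move=> c y z; apply: below_inj; rewrite linearP !lrange_invK.
by [].
Qed.

HB.instance Definition _ := GRing.isLinear.Build R (subspace_of lrange_submod) U _
  lrange_inv lrange_inv_linear.

Lemma lrange_mem x : S x \in lrange_submod.
Proof. by apply/asboolP; exists x. Qed.

Definition lrange_map x : subspace_of lrange_submod := exist _ (S x) (lrange_mem x).

Lemma lrange_map_linear : linear lrange_map.
Proof. by move=> c x y; apply: val_inj; rewrite /= linearP. Qed.

HB.instance Definition _ := GRing.isLinear.Build R U (subspace_of lrange_submod) _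
  lrange_map lrange_map_linear.

Lemma banach_mazur_lrange b : 0 <= b -> (forall x, `|S x| <= b * `|x|) ->
  (banach_mazur (subspace_of lrange_submod) U <= (a^-1 * b)%:E)%E.
Proof.
move=> b0 Sb.
have H1 y : `|lrange_inv y| <= a^-1 * `|y|.
  by rewrite ler_pdivlMl// (le_trans (Sa _))// lrange_invK.
have H2 x : `|lrange_map x| <= b * `|x| by exact: Sb.
apply: (@le_trans _ _ (opnorm lrange_inv * opnorm lrange_map)%E).
  apply: ereal_inf_lbound; exists lrange_inv, lrange_map; split=> //.
  - exact: bounded_linear_cont H1.
  - exact: bounded_linear_cont H2.
  - by move=> y; apply: val_inj; rewrite /= lrange_invK.
  - by move=> x; apply: below_inj; rewrite lrange_invK.
rewrite EFinM lee_pmul ?opnorm_ge0//; apply: opnorm_le => //.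
by rewrite invr_ge0 ltW.
Qed.

End LinearRange.

(** * Elements of $\ell_p$ from doubly indexed coordinates *)

Section SequenceSpace.
Context (R : realType) (p : R) (p1 : 1 < p).
Local Notation lp := (ell (lt1_le1E p1)).

Let p0 : 0 < p. Proof. exact: lt_trans ltr01 p1. Qed.

Lemma ell_Int (a : nat -> R) (K : R) : (forall M, \sum_(n < M) `|a n| `^ p <= K) ->
  (@counting nat R).-integrable setT (EFin \o (fun n => `|a n| `^ p)).
Proof.
move=> aK; apply/integrableP; split; first exact: measurable_funTS.
under eq_integral do rewrite /= ger0_norm ?powR_ge0//.
rewrite ge0_integral_count; last by move=> n; rewrite lee_fin powR_ge0.
apply: (@le_lt_trans _ _ K%:E); last exact: ltry.
apply: lime_le; first by apply: is_cvg_nneseries => n _ _; rewrite lee_fin powR_ge0.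
by apply: nearW => M; rewrite sumEFin lee_fin big_mkord.
Qed.

Lemma ell_measurable (a : nat -> R) : measurable_fun setT a.
Proof. by move=> _ B _. Qed.

Definition mkell (a : nat -> R) (K : R) (aK : forall M, \sum_(n < M) `|a n| `^ p <= K) : lp :=
  Lclass (mkLf p1 (@ell_measurable a) (ell_Int aK)).

Lemma norm_mkell (a : nat -> R) K (aK : forall M, \sum_(n < M) `|a n| `^ p <= K) :
  (`|mkell aK| `^ p)%:E = (\sum_(n <oo) (`|a n| `^ p)%:E)%E.
Proof.
rewrite norm_Lclass /Rintegral fineK; last exact: integrable_fin_num (ell_Int aK).
by rewrite ge0_integral_count// => n; rewrite lee_fin powR_ge0.
Qed.

(** A bijection lays the finite blocks out on a single index; the terms are nonnegative, so the sum
    may be rearranged. *)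
Lemma sum_pairs (e : nat -> nat * nat) (w : nat -> nat -> R) (k : nat -> nat) :
  set_bij [set: nat] [set: nat * nat] e -> (forall m l, 0 <= w m l) ->
  (forall m l, (k m <= l)%N -> w m l = 0) ->
  (\sum_(n <oo) (w (e n).1 (e n).2)%:E = \sum_(m <oo) (\sum_(l < k m) w m l)%:E)%E.
Proof.
move=> be w0 wk.
have w0' m l : (0 <= (w m l)%:E)%E by rewrite lee_fin.
rewrite nneseries_esumT//.
rewrite -(@reindex_esum _ _ _ _ _ e (fun ml => (w ml.1 ml.2)%:E) be).
rewrite nneseries_esumT; last by move=> m; rewrite lee_fin sumr_ge0.
transitivity (\esum_(m in [set: nat]) \esum_(l in [set: nat]) (w m l)%:E)%E.
  rewrite esum_esum//; congr esum; apply/seteqP; split=> // x _ /=; by [].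
apply: eq_esum => m _; rewrite -nneseries_esumT//.
rewrite (nneseries_split 0 (k m))//= eseries0 ?adde0; last first.
  by move=> l kl _; rewrite wk// -[k m]add0n.
by rewrite add0n big_mkord sumEFin.
Qed.

End SequenceSpace.

Section CompactEmbedding.
Context d (T : measurableType d) (R : realType).
Variables (mu : probability T R) (p : R) (p1 : 1 < p).
Local Notation L := (LspaceType mu (lt1_le1E p1)).
Local Notation J := (@Lspace_L1 _ _ _ mu _ (lt1_le1E p1)).
Local Notation lp := (ell (lt1_le1E p1)).
Variable (X : submodClosed L).

Let p0 : 0 < p. Proof. exact: lt_trans ltr01 p1. Qed.

Lemma compact_ball_embedding e : compact (J @` [set f | f \in X /\ `|f| <= 1]) ->
  0 < e -> e < 1 -> exists S : subspace_of X -> lp, linear S /\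
    forall x, (1 - e) * `|x| `^ p <= `|S x| `^ p <= (1 + e) * `|x| `^ p.
Proof.
move=> cX ep e1; have [W [k [WL Wk Wsum]]] := almost_isometric_coords cX ep.
have /card_set_bijP[g bg] : ([set: nat] #= [set: nat * nat])%card.
  by rewrite card_eq_sym; exact: card_nat2.
have W0 m l : W 0 m l = 0.
  by have := WL 1 0 0 m l; rewrite scale1r addr0 mul1r => /eqP; rewrite -subr_eq subrr => /eqP <-.
have WZ c f m l : W (c *: f) m l = c * W f m l.
  by have := WL c f 0 m l; rewrite addr0 W0 addr0.
have Wnorm f : f \in X ->
  (forall M, \sum_(m < M) \sum_(l < k m) `|W f m l| `^ p <= (1 + e) * `|f| `^ p) /\
  exists M, (1 - e) * `|f| `^ p <= \sum_(m < M) \sum_(l < k m) `|W f m l| `^ p.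
  move=> fX; have [f0|f0] := eqVneq f 0.
    have z M : \sum_(m < M) \sum_(l < k m) `|W f m l| `^ p = 0.
      by apply: big1 => m _; apply: big1 => l _; rewrite f0 W0 normr0 powR0// gt_eqF.
    rewrite f0 normr0 powR0 ?gt_eqF// !mulr0 -f0.
    by split=> [M|]; [rewrite z|exists 0%N; rewrite z].
  have fn : 0 < `|f| by rewrite normr_gt0.
  have fp : 0 < `|f| `^ p by rewrite powR_gt0.
  have gX : `|f|^-1 *: f \in X by exact: rpredZ.
  have g1 : `| `|f|^-1 *: f| = 1 by rewrite normrZ normfV normr_id mulVf ?gt_eqF.
  have z M : \sum_(m < M) \sum_(l < k m) `|W f m l| `^ p =
      `|f| `^ p * \sum_(m < M) \sum_(l < k m) `|W (`|f|^-1 *: f) m l| `^ p.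
    rewrite mulr_sumr; apply: eq_bigr => m _; rewrite mulr_sumr; apply: eq_bigr => l _.
    by rewrite WZ -powRM// -{1}[`|f|]normr_id -normrM mulrA divff ?gt_eqF// mul1r.
  have [up [M lo]] := Wsum _ gX g1.
  split=> [M'|]; first by rewrite z mulrC ler_pM2r.
  by exists M; rewrite z mulrC ler_pM2l.
pose a f n := W f (g n).1 (g n).2.
pose w f m l := `|W f m l| `^ p.
have w0 f m l : 0 <= w f m l by exact: powR_ge0.
have wk f m l : (k m <= l)%N -> w f m l = 0.
  by move=> kl; rewrite /w Wk// normr0 powR0// gt_eqF.
have ser f := sum_pairs bg (w0 f) (wk f).
have ser_ub f : f \in X -> (\sum_(n <oo) (`|a f n| `^ p)%:E <= ((1 + e) * `|f| `^ p)%:E)%E.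
  move=> fX; rewrite (ser f); apply: lime_le.
    by apply: is_cvg_nneseries => n _ _; rewrite lee_fin sumr_ge0.
  by apply: nearW => M; rewrite sumEFin lee_fin big_mkord; have [h _] := Wnorm f fX.
have ser_lb f : f \in X -> (((1 - e) * `|f| `^ p)%:E <= \sum_(n <oo) (`|a f n| `^ p)%:E)%E.
  move=> fX; rewrite (ser f); have [_ [M HM]] := Wnorm f fX.
  apply: (@le_trans _ _ (\sum_(0 <= m < M) (\sum_(l < k m) w f m l)%:E)%E).
    by rewrite sumEFin lee_fin big_mkord.
  by apply: nneseries_lim_ge => m _ _; rewrite lee_fin sumr_ge0.
have aK (x : subspace_of X) M : \sum_(n < M) `|a (val x) n| `^ p <= (1 + e) * `|val x| `^ p.
  rewrite -lee_fin; apply: le_trans (ser_ub _ (valP x)).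
  rewrite -(big_mkord xpredT (fun n => `|a (val x) n| `^ p)) -sumEFin.
  by apply: nneseries_lim_ge => n _ _; rewrite lee_fin powR_ge0.
exists (fun x => mkell p1 (aK x)); split.
  move=> c x y; rewrite /mkell LclassZ LclassD; congr Lclass; apply/LfuneqP => n.
  by rewrite addE scaleE /= /a -WL.
move=> x; rewrite -!lee_fin norm_mkell; apply/andP; split.
  exact: ser_lb (valP x).
exact: ser_ub (valP x).
Qed.

Lemma compact_banach_mazur e : compact (J @` [set f | f \in X /\ `|f| <= 1]) ->
  0 < e -> exists X0 : submodClosed lp,
    (banach_mazur (subspace_of X0) (subspace_of X) < (1 + e)%:E)%E.
Proof.
(* [(1 + t) / (1 - t) < 1 + e] amounts to [t (2 + e) < e]; here the left side is [e / 2]. *)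
move=> cX e0; pose t := e / (2 * (2 + e)).
have e2 : 0 < 2 * (2 + e) by lra.
have t0 : 0 < t by rewrite divr_gt0.
have te : t * (2 * (2 + e)) = e by rewrite /t divfK ?gt_eqF.
have t1 : t < 1 by nra.
have [S [Slin SN]] := compact_ball_embedding cX t0 t1.
have a0 : 0 < (1 - t) `^ p^-1 by rewrite powR_gt0//; lra.
have b0 : 0 <= (1 + t) `^ p^-1 by exact: powR_ge0.
have root (x y c : R) : 0 <= c -> 0 <= x -> 0 <= y -> c * x `^ p <= y `^ p -> c `^ p^-1 * x <= y.
  move=> c0 x0 y0; rewrite leNgt => h; rewrite leNgt; apply: contra h => h.
  have := lt_powR p0 y0 h.
  by rewrite powRM ?powR_ge0// -powRrM mulVf ?gt_eqF// powRr1.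
have root' (x y c : R) : 0 <= c -> 0 <= x -> 0 <= y -> y `^ p <= c * x `^ p -> y <= c `^ p^-1 * x.
  move=> c0 x0 y0; rewrite leNgt => h; rewrite leNgt; apply: contra h => h.
  have := lt_powR p0 (mulr_ge0 (powR_ge0 c p^-1) x0) h.
  by rewrite powRM ?powR_ge0// -powRrM mulVf ?gt_eqF// powRr1.
have Sa (x : subspace_of X) : (1 - t) `^ p^-1 * `|x| <= `|mklinear Slin x|.
  by apply: root; rewrite ?normr_ge0//; [lra|have /andP[] := SN x].
have Sb (x : subspace_of X) : `|mklinear Slin x| <= (1 + t) `^ p^-1 * `|x|.
  by apply: root'; rewrite ?normr_ge0//; [lra|have /andP[] := SN x].
exists (lrange_submod (mklinear Slin)).
apply: (le_lt_trans (banach_mazur_lrange a0 Sa b0 Sb)); rewrite lte_fin.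
have tt : (1 + t) / (1 - t) < 1 + e.
  by rewrite ltr_pdivrMr; [nra|lra].
apply: le_lt_trans tt; rewrite mulrC.
(* Taking roots of order [p] moves [1 - t] and [1 + t] towards 1. *)
have ip : p^-1 <= 1 by rewrite invf_le1// ltW.
have ta : 1 - t <= (1 - t) `^ p^-1 by apply: ger1_powR => //; apply/andP; split; lra.
have tb : (1 + t) `^ p^-1 <= 1 + t by apply: ler1_powR => //; lra.
apply: ler_pM => //; first by rewrite invr_ge0 ltW.
by rewrite lef_pV2 ?posrE//; lra.
Qed.

End CompactEmbedding.

(** * Subspaces of $\ell_p$ have property $(m_p)$ *)

Section LimSup.
Context (R : realType).
Implicit Types (a b : nat -> R) (M : R).

Lemma limn_esup_near_le b M : (\forall n \near \oo, b n <= M) ->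
  (limn_esup (fun n => (b n)%:E) <= M%:E)%E.
Proof.
move=> bM; apply: (@le_trans _ _ (ereal_sup ((fun n => (b n)%:E) @` [set n | b n <= M]))).
  by apply: ereal_inf_lbound; exists [set n | b n <= M].
by apply: ub_ereal_sup => _ [n nM <-]; rewrite lee_fin.
Qed.

Lemma limn_esup_lt_near b M : (limn_esup (fun n => (b n)%:E) < M%:E)%E ->
  \forall n \near \oo, b n < M.
Proof.
move=> /ereal_inf_lt[_ [V Voo <-]] VM; apply: filterS Voo => n Vn.
by rewrite -lte_fin; apply: le_lt_trans VM; apply: ereal_sup_ubound; exists n.
Qed.

Lemma limn_esup_near_ge b M : (\forall n \near \oo, M <= b n) ->
  (M%:E <= limn_esup (fun n => (b n)%:E))%E.
Proof.
move=> Mb; rewrite leNgt; apply/negP => /limn_esup_lt_near bM.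
have [n []] := filter_ex (filterI Mb bM); lra.
Qed.

(** Boundedness of [b] makes its upper limit a real number [L]. For the lower estimate, an upper
    limit of [a] below [S] would keep the [p]-th powers of [b] below that of [L] by a fixed
    amount. *)
Lemma limn_esup_powR p a b c : 1 < p -> 0 <= c -> (forall n, 0 <= a n) -> (forall n, 0 <= b n) ->
  (exists C, forall n, b n <= C) -> (fun n => a n `^ p - b n `^ p) @ \oo --> c `^ p ->
  limn_esup (fun n => (a n)%:E) =
  ((c%:E `^ p + limn_esup (fun n => (b n)%:E) `^ p) `^ p^-1)%E.
Proof.
move=> p1 c0 a0 b0 [C bC] ab; have p0 : 0 < p by lra.
have : (limn_esup (fun n => (b n)%:E) <= C%:E)%E by apply: limn_esup_near_le; exact: nearW.
have : (0%:E <= limn_esup (fun n => (b n)%:E))%E by apply: limn_esup_near_ge; exact: nearW.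
case bL : (limn_esup (fun n => (b n)%:E)) => [L| |]//; rewrite lee_fin => L0 _.
pose S := (c `^ p + L `^ p) `^ p^-1.
have -> : ((c%:E `^ p + L%:E `^ p) `^ p^-1)%E = S%:E by [].
have S0 : 0 <= S by exact: powR_ge0.
have Sp : S `^ p = c `^ p + L `^ p.
  by rewrite /S -powRrM mulVf ?gt_eqF// powRr1// addr_ge0 ?powR_ge0.
have ub : (limn_esup (fun n => (a n)%:E) <= S%:E)%E.
  apply/lee_addgt0Pr => e e0; rewrite -EFinD; apply: limn_esup_near_le.
  pose eta := (S + e) `^ p - S `^ p.
  have eta0 : 0 < eta by rewrite subr_gt0 lt_powR//; lra.
  have eta2 : 0 < eta / 2 by lra.
  have := @norm_powR_continuous R p p1 L.
  move=> /cvgrPdist_le /(_ _ eta2) /nbhs_ballP[d /= d0 Hd].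
  have Ld : (limn_esup (fun n => (b n)%:E) < (L + d / 2)%:E)%E by rewrite bL lte_fin; lra.
  have nb := limn_esup_lt_near Ld.
  have /cvgrPdist_le /(_ _ eta2) na := ab.
  near=> n.
  have h1 : b n < L + d / 2 by near: n.
  have h2 : `|c `^ p - (a n `^ p - b n `^ p)| <= eta / 2 by near: n.
  have h3 : `| `|L| `^ p - `|L + d / 2| `^ p| <= eta / 2.
    by apply: Hd; rewrite /ball/= opprD addNKr normrN ger0_norm; lra.
  rewrite leNgt; apply/negP => /(lt_powR p0 (addr_ge0 S0 (ltW e0))).
  have Ld0 : 0 <= L + d / 2 by lra.
  have h4 := le_powR (ltW p0) (b0 n) (ltW h1).
  move: h2 h3; rewrite (ger0_norm L0) (ger0_norm Ld0) !ler_norml => /andP[? ?] /andP[? ?].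
  have etaE : eta = (S + e) `^ p - S `^ p by [].
  by clearbody eta; move: Sp; lra.
apply/eqP; rewrite eq_le ub /= leNgt; apply/negP.
have : (0%:E <= limn_esup (fun n => (a n)%:E))%E by apply: limn_esup_near_ge; exact: nearW.
move: ub; case aA : (limn_esup (fun n => (a n)%:E)) => [A| |]//.
rewrite !lee_fin lte_fin => _ A0 AS.
pose s := (A + S) / 2.
have sS : s < S by rewrite /s; lra.
have s0 : 0 <= s by rewrite /s; lra.
have As : (limn_esup (fun n => (a n)%:E) < s%:E)%E by rewrite aA lte_fin /s; lra.
have na := limn_esup_lt_near As.
have := lt_powR p0 s0 sS; rewrite Sp => sp.
pose t := (c `^ p + L `^ p - s `^ p) / 2.
have t0 : 0 < t by rewrite /t; lra.
have /cvgrPdist_le /(_ _ t0) nab := ab.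
have nb : \forall n \near \oo, b n `^ p <= L `^ p - t.
  near=> n.
  have h1 : a n < s by near: n.
  have h2 : `|c `^ p - (a n `^ p - b n `^ p)| <= t by near: n.
  have h3 := le_powR (ltW p0) (a0 n) (ltW h1).
  move: h2; rewrite ler_norml => /andP[? ?].
  have tE : t * 2 = c `^ p + L `^ p - s `^ p by rewrite /t divfK.
  by clearbody t s; lra.
have [n0 hn0] := filter_ex nb.
have Lt : 0 <= L `^ p - t by rewrite (le_trans (powR_ge0 (b n0) p)).
have lL : (L `^ p - t) `^ p^-1 < L.
  rewrite -[ltRHS](_ : (L `^ p) `^ p^-1 = L).
    by apply: lt_powR; rewrite ?invr_gt0//; lra.
  by rewrite -powRrM mulfV ?gt_eqF// powRr1.
have : (limn_esup (fun n => (b n)%:E) <= ((L `^ p - t) `^ p^-1)%:E)%E.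
  apply: limn_esup_near_le; apply: filterS nb => n hn.
  rewrite leNgt; apply/negP => /(lt_powR p0 (powR_ge0 _ _)).
  by rewrite -powRrM mulVf ?gt_eqF// powRr1//; lra.
by rewrite bL lee_fin; lra.
Unshelve. all: by end_near.
Qed.

End LimSup.

(** * Asymptotic additivity and its stability under almost isometries *)

Section AsymptoticallyAdditive.
Context (R : realType).
Implicit Types X Y : normedModType R.

(* The form of property $(m_p)$ for bounded sequences that passes through
   almost isometric isomorphisms. *)
Definition asymptotically_additive (p : R) X := forall (x : X) (u : X^nat) C,
  weakly_null u -> (forall n, `|u n| <= C) ->
  (fun n => `|x + u n| `^ p - `|u n| `^ p) @ \oo --> `|x| `^ p.

Lemma asymptotically_additive_property_m p X : 1 < p -> asymptotically_additive p X ->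
  property_m p X.
Proof.
move=> p1 AX x u wu; have p0 : 0 < p by lra.
have [fin|] := ltP (limn_esup (fun n => `|u n|%:E)) +oo%E.
  have u0 : (0%:E <= limn_esup (fun n => `|u n|%:E))%E by apply: limn_esup_near_ge; exact: nearW.
  case uL : (limn_esup (fun n => `|u n|%:E)) fin u0 => [L| |]// _ _.
  have : (limn_esup (fun n => `|u n|%:E) < (L + 1)%:E)%E by rewrite uL lte_fin; lra.
  move=> /limn_esup_lt_near[N _ HN].
  have [C HC] : exists C, forall n, `|u n| <= C.
    exists (L + 1 + \sum_(i < N) `|u i|) => n.
    have s0 : 0 <= \sum_(i < N) `|u i| by exact: sumr_ge0.
    have [Nn|nN] := leqP N n.
      by have := HN n Nn => /= h; have := normr_ge0 (u n); lra.
    have L1 : 0 <= L + 1 by have := HN N (leqnn N) => /= h; have := normr_ge0 (u N); lra.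
    rewrite (bigD1 (Ordinal nN))//= addrCA ler_wpDr// addr_ge0// sumr_ge0//.
  by rewrite -uL; apply: limn_esup_powR => //; [exists C|exact: AX wu HC].
rewrite leye_eq => /eqP uoo; rewrite uoo.
rewrite poweRyr ?gt_eqF// addey// poweRyr ?invr_eq0 ?gt_eqF//.
(* When the upper limit of [|u n|] is infinite, both sides are infinite: a finite upper limit of
   [|x + u n|] would bound that of [|u n|]. *)
have h : (limn_esup (fun n => `|x + u n|%:E) < +oo)%E -> False.
  move=> fin.
  have a0 : (0%:E <= limn_esup (fun n => `|x + u n|%:E))%E by apply: limn_esup_near_ge; exact: nearW.
  case aL : (limn_esup (fun n => `|x + u n|%:E)) fin a0 => [L| |]// _ _.
  have : (limn_esup (fun n => `|x + u n|%:E) < (L + 1)%:E)%E by rewrite aL lte_fin; lra.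
  move=> /limn_esup_lt_near nx.
  have : (limn_esup (fun n => `|u n|%:E) <= (`|x| + (L + 1))%:E)%E.
    apply: limn_esup_near_le; apply: filterS nx => n hn.
    by have := ler_normB (x + u n) x; rewrite addrC addKr; lra.
  by rewrite uoo leye_eq.
by apply/eqP; rewrite -leye_eq leNgt; apply/negP.
Qed.

Lemma weakly_null_linear X Y (g : {linear X -> Y}) (u : X^nat) : continuous g ->
  weakly_null u -> weakly_null (g \o u).
Proof.
move=> cg wu phi cphi; apply: (wu (phi \o g)).
by move=> x; apply: continuous_comp; [exact: cg|exact: cphi].
Qed.

(** Only the product of the norms of [f] and [g] enters, through [A^p B^p <= (1 + e)^p], so neither
    map has to be normalised. The bound [C] turns this relative error into an absolute one. *)
Lemma asymptotically_additive_banach_mazur p X : 1 < p ->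
  (forall e, 0 < e -> exists Y, asymptotically_additive p Y /\ (banach_mazur Y X < (1 + e)%:E)%E) ->
  asymptotically_additive p X.
Proof.
move=> p1 HY x u C wu uC; have p0 : 0 < p by lra.
have C0 : 0 <= C by exact: le_trans (normr_ge0 _) (uC 0%N).
(* [D] bounds every quantity that gets multiplied by [(1 + e)^p - 1], so that this error costs at
   most [eta / 2]. *)
pose D := `|x| `^ p + C `^ p + (`|x| + C) `^ p + 1.
have D0 : 0 < D by rewrite ltr_wpDl// !addr_ge0 ?powR_ge0.
apply/cvgrPdist_le => /= eta eta0.
have etaD : 0 < eta / (2 * D) by rewrite divr_gt0// mulr_gt0.
have /cvgrPdist_le /(_ _ etaD) /nbhs_ballP[d /= d0 Hd] := @powR_continuous_at1 R p.
pose e := d / 2; have e0 : 0 < e by rewrite /e; lra.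
have Ke : (1 + e) `^ p - 1 <= eta / (2 * D).
  have := Hd (1 + e); rewrite /ball/= opprD addNKr normrN ger0_norm ?(ltW e0)//.
  by rewrite ler_norml => /(_ _)/andP[|h _]; [rewrite /e; lra|lra].
have [Y [AY]] := HY e e0.
move=> /ereal_inf_lt[_ [f [g [cf cg fK gK ->]]]].
have [A fA] : exists A, opnorm f = A%:E by exists (fine (opnorm f)); rewrite fineK// opnorm_fin.
have [B gB] : exists B, opnorm g = B%:E by exists (fine (opnorm g)); rewrite fineK// opnorm_fin.
have A0 : 0 <= A by rewrite -lee_fin -fA opnorm_ge0.
have B0 : 0 <= B by rewrite -lee_fin -gB opnorm_ge0.
rewrite fA gB -EFinM lte_fin => AB.
have fb y : `|f y| <= A * `|y| by apply: opnorm_bound; rewrite fA.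
have gb y : `|g y| <= B * `|y| by apply: opnorm_bound; rewrite gB.
have guC n : `|(g \o u) n| <= B * C by rewrite (le_trans (gb _))// ler_wpM2l.
have Ap : 0 < A `^ p + 1 by rewrite ltr_wpDl// powR_ge0.
have etaA : 0 < eta / (2 * (A `^ p + 1)) by rewrite divr_gt0// mulr_gt0.
have /cvgrPdist_le /(_ _ etaA) near_g := AY (g x) _ _ (weakly_null_linear cg wu) guC.
apply: filterS near_g => n /=; set r := eta / _; rewrite ler_norml => /andP[r1 r2].
set K := (1 + e) `^ p in Ke.
have ABK : A `^ p * B `^ p <= K.
  by rewrite -powRM// /K; apply: le_powR; [exact: ltW|exact: mulr_ge0|exact: ltW].
have powl (h k M : R) : 0 <= h -> 0 <= k -> 0 <= M -> h <= M * k -> h `^ p <= M `^ p * k `^ p.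
  by move=> h0 k0 M0 hk; rewrite -powRM// le_powR// ltW.
have f1 : `|x + u n| `^ p <= A `^ p * `|g x + g (u n)| `^ p.
  by apply: powl => //; rewrite -linearD -{1}[x + u n]gK.
have g1 : `|g x + g (u n)| `^ p <= B `^ p * `|x + u n| `^ p.
  by apply: powl => //; rewrite -linearD.
have f2 : `|x| `^ p <= A `^ p * `|g x| `^ p by apply: powl => //; rewrite -{1}[x]gK.
have f3 : `|u n| `^ p <= A `^ p * `|g (u n)| `^ p by apply: powl => //; rewrite -{1}[u n]gK.
have g2 : `|g x| `^ p <= B `^ p * `|x| `^ p by apply: powl.
have g3 : `|g (u n)| `^ p <= B `^ p * `|u n| `^ p by apply: powl.
have uCp : `|u n| `^ p <= C `^ p by rewrite le_powR// ltW.
have xuC : `|x + u n| `^ p <= (`|x| + C) `^ p.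
  by rewrite le_powR ?(ltW p0)// (le_trans (ler_normD _ _))// lerD2l.
have rA : r * (A `^ p + 1) = eta / 2 by rewrite /r; field; rewrite gt_eqF.
set t := eta / (2 * D) in Ke etaD; have tD : t * D = eta / 2 by rewrite /t; field; rewrite gt_eqF.
have r0 : 0 <= r := ltW etaA.
have aD : `|x| `^ p + `|u n| `^ p <= D by rewrite /D; have := powR_ge0 (`|x| + C) p; lra.
have wD : `|x + u n| `^ p <= D.
  by rewrite /D; have := powR_ge0 `|x| p; have := powR_ge0 C p; lra.
have := powR_ge0 A p; have := powR_ge0 `|x| p; have := powR_ge0 `|u n| p.
have := powR_ge0 `|x + u n| p.
clearbody r t K D; clear - r1 r2 f1 g1 f2 f3 g2 g3 Ke rA tD r0 aD wD ABK etaD.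
move: (`|x + u n| `^ p) (`|g x + g (u n)| `^ p) (`|x| `^ p) (`|u n| `^ p) (`|g x| `^ p)
  (`|g (u n)| `^ p) (A `^ p) (B `^ p) r1 r2 f1 g1 f2 f3 g2 g3 rA aD wD ABK.
move=> w w' a v ga gv al be r1 r2 f1 g1 f2 f3 g2 g3 rA aD wD ABK w0 v0 a0 al0.
have K1 : K <= 1 + t by lra.
have tw := ler_wpM2l (ltW etaD) wD; have ta := ler_wpM2l (ltW etaD) aD.
have av0 : 0 <= a + v by lra.
(* [h1] to [h3] bound [|x + u n|^p] from above and [h4] to [h6] from below: going to [Y] and back
   costs a factor [al * be <= K], and the limit taken in [Y] costs [al * r]. *)
have h1 : al * w' <= al * (be * (a + v) + r) by apply: ler_wpM2l => //; lra.
have h2 := ler_wpM2r av0 ABK; have h3 := ler_wpM2r av0 K1.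
have h4 : al * (ga + gv) <= al * (be * w + r) by apply: ler_wpM2l => //; lra.
have h5 := ler_wpM2r w0 ABK; have h6 := ler_wpM2r w0 K1.
rewrite ler_norml; apply/andP; split.
  by clear h4 h5 h6 tw; lra.
by clear h1 h2 h3 ta; lra.
Qed.

End AsymptoticallyAdditive.

Section SequenceSpaceAdditive.
Context (R : realType) (p : R) (p1 : 1 < p).
Local Notation lp := (ell (lt1_le1E p1)).
Local Notation Int f := ((@counting nat R).-integrable setT (EFin \o f)).

Let p0 : 0 < p. Proof. exact: lt_trans ltr01 p1. Qed.

Lemma counting_ae (a b : nat -> R) : a = b %[ae (@counting nat R)] -> a =1 b.
Proof.
move=> [N [mN N0 abN]] n; apply: contrapT => abn.
have Nn : N n by apply: abN => /= h; apply: abn; exact: h.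
have : ((@counting nat R) [set n] <= 0)%E.
  by rewrite -N0; apply: le_measure => //; rewrite ?inE// => _ ->.
by rewrite /counting/= asboolT// ?fset_set1 ?finmap.cardfs1 // lee_fin ler10.
Qed.

Lemma Rint_counting_trunc (h : nat -> R) M : (forall n, 0 <= h n) ->
  \int[@counting nat R]_n (if (n < M)%N then h n else 0) = \sum_(n < M) h n.
Proof.
move=> h0; rewrite /Rintegral ge0_integral_count; last by move=> n; case: ifP; rewrite lee_fin.
rewrite (nneseries_split 0 M)/=; last by move=> n _; case: ifP; rewrite lee_fin.
rewrite eseries0 ?adde0; last by move=> n Mn _; rewrite add0n in Mn; rewrite ltnNge Mn.
rewrite add0n big_mkord sumEFin /=; apply: eq_bigr => n _.
by rewrite ltn_ord.
Qed.

Lemma Rint_counting_tail (h : nat -> R) e : (forall n, 0 <= h n) -> Int h -> 0 < e ->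
  exists M, \int[@counting nat R]_n h n <= \sum_(n < M) h n + e.
Proof.
move=> h0 ih e0; have h0' n : (0 <= (h n)%:E)%E by rewrite lee_fin.
have fin := integrable_fin_num measurableT ih.
apply: contrapT => /forallNP H.
have : (\int[@counting nat R]_n (h n)%:E <= (\int[@counting nat R]_n h n - e)%:E)%E.
  rewrite ge0_integral_count//; apply: lime_le; first exact: is_cvg_nneseries.
  apply: nearW => M; rewrite sumEFin lee_fin big_mkord.
  by have /negP := H M; rewrite -ltNge; lra.
have -> : (\int[@counting nat R]_n (h n)%:E = (\int[@counting nat R]_n h n)%:E)%E.
  by rewrite /Rintegral fineK.
by rewrite lee_fin; lra.
Qed.

Lemma ell_coordZ (c : R) (f : lp) n : Lrepr (c *: f) n = c * Lrepr f n.
Proof.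
rewrite -{1}(LreprK f) LclassZ; exact: (counting_ae (Lrepr_class _)).
Qed.

Lemma ell_coordD (f g : lp) n : Lrepr (f + g) n = Lrepr f n + Lrepr g n.
Proof.
rewrite -{1}(LreprK f) -{1}(LreprK g) LclassD; exact: (counting_ae (Lrepr_class _)).
Qed.

Lemma ell_coord_le (f : lp) n : `|Lrepr f n| <= `|f|.
Proof.
rewrite leNgt; apply/negP => /(lt_powR p0 (normr_ge0 _)); rewrite ltNge => /negP; apply.
rewrite norm_Lrepr.
have h0 m : 0 <= `|Lrepr f m| `^ p by exact: powR_ge0.
apply: (@le_trans _ _ (\sum_(m < n.+1) `|Lrepr f m| `^ p)).
  by rewrite big_ord_recr/= lerDr sumr_ge0.
rewrite -(@Rint_counting_trunc (fun m => `|Lrepr f m| `^ p))//; apply: le_Rint.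
- apply: (Int_le _ (Lf_Int (Lrepr f))); first exact: ell_measurable.
  by move=> m; case: ifP; rewrite ?normr0// ger0_norm.
- exact: Lf_Int.
- by move=> m; case: ifP.
Qed.

Lemma ell_subspace_additive (X0 : submodClosed lp) :
  asymptotically_additive p (subspace_of X0).
Proof.
move=> x u C wu uC.
have C0 : 0 <= C by exact: le_trans (normr_ge0 _) (uC 0%N).
have coord n : (fun k => Lrepr (val (u k)) n) @ \oo --> (0 : R).
  pose phi (y : subspace_of X0) : R^o := Lrepr (val y) n.
  have phil : linear phi.
    move=> c y z; rewrite /phi; transitivity (Lrepr (c *: val y + val z) n); first by [].
    by rewrite ell_coordD ell_coordZ.
  have phic : continuous (mklinear phil).
    by apply: (@bounded_linear_cont _ _ _ _ 1) => y; rewrite mul1r; exact: ell_coord_le.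
  exact: (wu (mklinear phil) phic).
(* The minimum is at most [|u k|] on the first [M] coordinates, where [u k] tends to 0, and at most
   [|x|] on the others, where little of [x] is left. *)
have pm e : 0 < e -> \forall k \near \oo, pmin (val x) (val (u k)) <= e.
  move=> e0; have e2 : 0 < e / 2 by lra.
  have h0 m : 0 <= `|Lrepr (val x) m| `^ p by exact: powR_ge0.
  have [M HM] := Rint_counting_tail h0 (Lf_Int (Lrepr (val x))) e2.
  have S0 : (fun k => \sum_(n < M) `|Lrepr (val (u k)) n| `^ p) @ \oo --> (0 : R).
    elim: (M) => [|M' IH].
      by rewrite (_ : (fun _ => _) = fun=> 0); [exact: cvg_cst|apply/funext => k; rewrite big_ord0].
    rewrite (_ : (fun _ => _) = (fun k => \sum_(n < M') `|Lrepr (val (u k)) n| `^ p +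
      `|Lrepr (val (u k)) M'| `^ p)); last by apply/funext => k; rewrite big_ord_recr.
    rewrite -[X in _ --> X]addr0; apply: cvgD => //.
    rewrite -[X in _ --> X](_ : `|0 : R| `^ p = 0); last by rewrite normr0 powR0// gt_eqF.
    exact: (cvg_comp _ _ (coord M') (@norm_powR_continuous R p p1 0)).
  have /cvgrPdist_le /(_ _ e2) := S0; apply: filterS => k /=.
  rewrite sub0r normrN ger0_norm => [hk|]; last by apply: sumr_ge0 => n _; exact: powR_ge0.
  have v0 m : 0 <= `|Lrepr (val (u k)) m| `^ p by exact: powR_ge0.
  have it (v : lp) : Int (fun n => if (n < M)%N then `|Lrepr v n| `^ p else 0).
    apply: (Int_le _ (Lf_Int (Lrepr v))); first exact: ell_measurable.
    by move=> m; case: ifP => _; rewrite ?normr0 ?powR_ge0// ger0_norm ?powR_ge0.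
  have := @le_Rint_comb4 _ _ _ _ _ _ _ _ _ 1 1 (-1) 0
    (Int_min_powR (Lrepr (val x)) (Lf_measurable (Lrepr (val (u k)))))
    (it (val (u k))) (Lf_Int (Lrepr (val x))) (it (val x)) (it (val x)).
  rewrite !Rint_counting_trunc// => h; apply: le_trans (h _) _ => [n|].
    rewrite !mul1r mul0r addr0 mulN1r; case: ifP => _.
      rewrite addrK; apply: le_powR; rewrite ?(ltW p0)// ?le_min ?normr_ge0//.
      by rewrite ge_min lexx orbT.
    rewrite add0r subr0; apply: le_powR; rewrite ?(ltW p0)// ?le_min ?normr_ge0//.
    by rewrite ge_min lexx.
  rewrite !mul1r mul0r addr0 mulN1r; move: hk HM; rewrite /=.
  move: (Rintegral _ _ _) (\sum_(n < M) _) (\sum_(n < M) _) => *; lra.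
apply/cvgrPdist_le => /= e e0.
pose D := `|x| `^ p + C `^ p + 1.
have D0 : 0 < D by rewrite ltr_wpDl// !addr_ge0 ?powR_ge0.
have e1 : 0 < e / (2 * D) by rewrite divr_gt0// mulr_gt0.
have [K K0 HK] := @brezis_lieb_Lp _ _ _ (@counting nat R) p p1 _ e1.
have K1 : 0 < K + 1 by rewrite ltr_wpDl.
have e2 : 0 < e / (2 * (K + 1)) by rewrite divr_gt0// mulr_gt0.
apply: filterS (pm _ e2) => k hk.
have := HK (val x) (val (u k)).
rewrite -[`|val x|]/`|x| -[`|val (u k)|]/`|u k| -[`|val x + val (u k)|]/`|x + u k| => h.
have uCp : `|u k| `^ p <= C `^ p by apply: le_powR => //; exact: ltW.
have h1 := ler_wpM2l K0 hk.
have eD : e / (2 * D) * D = e / 2 by field; rewrite gt_eqF.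
have eK : e / (2 * (K + 1)) * (K + 1) = e / 2 by field; rewrite gt_eqF.
have h2 : e / (2 * D) * (`|x| `^ p + `|u k| `^ p) <= e / (2 * D) * D.
  apply: ler_wpM2l; first exact: ltW.
  by rewrite /D -addrA lerD2l ler_wpDr.
rewrite distrC; have -> : `|x + u k| `^ p - `|u k| `^ p - `|x| `^ p =
  `|x + u k| `^ p - `|x| `^ p - `|u k| `^ p by rewrite addrAC.
apply: (le_trans h); apply: (le_trans (lerD h2 h1)); rewrite eD.
have : K * (e / (2 * (K + 1))) <= e / 2 by rewrite -eK mulrC ler_pM2l// lerDl.
by move: (K * _) => *; lra.
Qed.

Lemma ell_banach_mazur_property_m (X : normedModType R) :
  (forall e : R, 0 < e -> exists X0 : submodClosed lp,
      (banach_mazur (subspace_of X0) X < (1 + e)%:E)%E) ->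
  property_m p X.
Proof.
move=> H; apply: asymptotically_additive_property_m => //.
apply: asymptotically_additive_banach_mazur => // e /H[X0 HX0].
by exists (subspace_of X0); split=> //; exact: ell_subspace_additive.
Qed.

End SequenceSpaceAdditive.

(** * Property $(m_p)$ implies compactness *)

Section Subsequences.
Context (R : realType).

Lemma ultra_bounded_cvg (U : set_system nat) (a : nat -> R) (C : R) : UltraFilter U ->
  (forall n, `|a n| <= C) -> exists l, forall e, 0 < e -> U [set n | `|a n - l| <= e].
Proof.
move=> UU aC; have cC : compact `[- C, C] by exact: segment_compact.
have aU : (a @ U) [set` `[- C, C]].
  by apply: (@filterS _ U _ setT) => [n _ /=|]; last exact: filterT; rewrite in_itv/= -ler_norml.
have [l [_ cl]] := cC _ (fmap_proper_filter a (@ultra_proper _ _ UU)) aU.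
exists l => e e0; have [//|Uc] := in_ultra_setVsetC [set n | `|a n - l| <= e] UU.
exfalso; have : (a @ U) [set r | ~ `|r - l| <= e] by exact: Uc.
move=> /cl /(_ (nbhsx_ballx l e e0))[r [/= h]]; rewrite /ball/= distrC => h'.
by apply: h; exact: ltW.
Qed.

Lemma increasing_ge (phi : nat -> nat) : (forall k, phi k < phi k.+1)%N -> forall k, (k <= phi k)%N.
Proof. by move=> inc; elim=> // k IH; exact: leq_ltn_trans IH (inc k). Qed.

Lemma increasing_cvgoo (phi : nat -> nat) : (forall k, phi k < phi k.+1)%N -> phi @ \oo --> \oo.
Proof.
move=> inc V [N _ NV]; exists N => // k /= Nk; apply: NV => /=.
exact: leq_trans Nk (increasing_ge inc k).
Qed.

(* Limits along a nonprincipal ultrafilter replace the diagonal argument. *)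
Lemma common_subsequence (I : countType) (a : I -> nat -> R) :
  (forall i, exists C, forall n, `|a i n| <= C) ->
  exists phi : nat -> nat, (forall k, phi k < phi k.+1)%N /\
    forall i, exists l, (a i \o phi) @ \oo --> (l : R).
Proof.
move=> aC; have [U [UU ooU]] := ultraFilterLemma (@eventually_filter : ProperFilter \oo).
have /choice[l Hl] i : exists l, forall e, 0 < e -> U [set n | `|a i n - l| <= e].
  by have [C HC] := aC i; exact: ultra_bounded_cvg HC.
(* At step [k] closeness is asked only for the indices with [pickle i < k], so finitely many members
   of [U] are intersected. *)
have U_le k e : 0 < e -> U [set n | forall i, (pickle i < k)%N -> `|a i n - l i| <= e].
  move=> e0; elim: k => [|k IH]; first by apply: (@filterS _ U _ setT) => [n _ i //|]; exact: filterT.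
  case ik : (@unpickle I k) => [j|].
    apply: filterS2 IH (Hl j e e0) => n h hj i; rewrite ltnS leq_eqVlt => /predU1P[ki|/h//].
    by have := pickleK i; rewrite ki ik => -[<-].
  apply: filterS IH => n h i; rewrite ltnS leq_eqVlt => /predU1P[ki|/h//].
  by have := pickleK i; rewrite ki ik.
have /choice[F HF] (kN : nat * nat) : exists n, (kN.2 <= n)%N /\
    forall i, (pickle i < kN.1)%N -> `|a i n - l i| <= kN.1.+1%:R^-1.
  have e0 : 0 < (kN.1.+1%:R^-1 : R) by rewrite invr_gt0.
  have NU : U [set n | (kN.2 <= n)%N] by apply: ooU; exists kN.2.
  by have [n [h1 h2]] := filter_ex (filterI NU (U_le kN.1 _ e0)); exists n.
pose phi := fix phi (k : nat) : nat := if k is k'.+1 then F (k, (phi k').+1) else F (0, 0)%N.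
exists phi; split.
  by move=> k; have [] := HF (k.+1, (phi k).+1).
have phiP k i : (pickle i < k)%N -> `|a i (phi k) - l i| <= k.+1%:R^-1.
  by case: k => // k; have [_ h] := HF (k.+1, (phi k).+1); exact: h.
move=> i; exists (l i); apply/cvgrPdist_le => e e0.
near=> k.
have ik : (pickle i < k)%N by near: k; exact: nbhs_infty_gt.
have ke : k.+1%:R^-1 <= e.
  by near: k; have := @near_infty_natSinv_lt R (PosNum e0); apply: filterS => n /ltW.
by rewrite distrC; apply: le_trans ke; exact: phiP.
Unshelve. all: by end_near.
Qed.

Lemma weakly_null_subseq (X : normedModType R) (u : X^nat) (phi : nat -> nat) :
  (forall k, phi k < phi k.+1)%N -> weakly_null u -> weakly_null (u \o phi).
Proof.
move=> inc wu psi cpsi; exact: (cvg_comp _ _ (increasing_cvgoo inc) (wu psi cpsi)).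
Qed.

End Subsequences.

(** * Weakly Cauchy subsequences from uniform smoothness *)

Section WeaklyCauchy.
Context (R : realType) (p : R) (p1 : 1 < p) (X : normedModType R).
Implicit Types (x : X).

Let p0 : 0 < p. Proof. exact: lt_trans ltr01 p1. Qed.

Hypothesis US : forall e : R, 0 < e -> exists2 t0 : R, 0 < t0 & forall (t : R) (f g : X),
  0 < t -> t <= t0 ->
  `|f + t *: g| `^ p + `|f - t *: g| `^ p - 2 * `|f| `^ p <= t * e * (`|f| `^ p + `|g| `^ p).

(** A countable family, coded by lists, that contains 0 and is closed under adding or subtracting
    [x n / (N + 1)]; the minimisation below needs no more. *)
Definition signed_comb (x : nat -> X) (s : seq (nat * nat * bool)) : X :=
  foldr (fun (c : nat * nat * bool) y => y + ((-1) ^+ (c.2 : bool) * c.1.2.+1%:R^-1) *: x c.1.1) 0 s.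

(** The difference is nonnegative once [r^(p - 1) >= L]; below this threshold [L r] is at most [L]
    times the threshold. Hence the minimised quantity is bounded below. *)
Lemma functional_lower_bound (L r : R) : 0 < L -> 0 <= r ->
  - (L * L `^ (p - 1)^-1) <= r `^ p - L * r.
Proof.
move=> L0 r0; rewrite -(mulr_powRB1 r0 p0); have := powR_ge0 L (p - 1)^-1 => B0.
have q0 : 0 < p - 1 by rewrite subr_gt0.
have Bq : (L `^ (p - 1)^-1) `^ (p - 1) = L.
  by rewrite -powRrM mulVf ?gt_eqF// powRr1// ltW.
have [h|h] := leP r (L `^ (p - 1)^-1).
  have := ler_wpM2l (ltW L0) h; have := mulr_ge0 r0 (powR_ge0 r (p - 1)); lra.
have h1 : L <= r `^ (p - 1) by rewrite -[leLHS]Bq le_powR// ltW.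
have := ler_wpM2l r0 h1; have := mulr_ge0 (ltW L0) B0; lra.
Qed.

Lemma sublevel_bound (L r : R) : 0 < L -> 0 <= r -> r `^ p <= L * r + 1 ->
  r <= (L + 1) `^ (p - 1)^-1.
Proof.
move=> L0 r0; rewrite -(mulr_powRB1 r0 p0) => H.
have q0 : 0 < p - 1 by rewrite subr_gt0.
have L1 : 0 <= L + 1 by lra.
have Bq : ((L + 1) `^ (p - 1)^-1) `^ (p - 1) = L + 1.
  by rewrite -powRrM mulVf ?gt_eqF// powRr1.
rewrite leNgt; apply/negP => h.
have h1 : L + 1 < r `^ (p - 1) by rewrite -[ltLHS]Bq lt_powR// powR_ge0.
have r1 : 1 <= r.
  apply: le_trans (ltW h); rewrite -[leLHS](powRr0 (L + 1)) ler_powR//; first lra.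
  by rewrite invr_ge0 ltW.
have rp : 0 < r by lra.
have : r * (L + 1) < r * r `^ (p - 1) by rewrite ltr_pM2l.
lra.
Qed.

(* A near-minimizer [y] of [|y|^p - psi y] over a countable set of combinations of the [x n]
   satisfies [t psi (x n) = |y + t x n|^p - |y|^p] up to a small error, uniformly in [n];
   so the convergence of countably many sequences of norms controls every functional. *)
Lemma weakly_cauchy_subsequence (x : nat -> X) : (forall n, `|x n| <= 1) ->
  exists phi : nat -> nat, (forall k, phi k < phi k.+1)%N /\
    weakly_null (fun k => x (phi k.+1) - x (phi k)).
Proof.
move=> x1; pose y := signed_comb x.
pose a (i : seq (nat * nat * bool) * nat) n := `|y i.1 + i.2.+1%:R^-1 *: x n| `^ p.
have [i|phi [inc cva]] := @common_subsequence R _ a.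
  exists ((`|y i.1| + 1) `^ p) => n; rewrite ger0_norm ?powR_ge0// le_powR ?(ltW p0)//.
  rewrite (le_trans (ler_normD _ _))// lerD2l normrZ ger0_norm ?invr_ge0//.
  by rewrite mulr_ile1// ?invr_ge0// invf_le1// ler1n.
exists phi; split=> // psi cpsi.
have [M psiM] : exists M, opnorm psi = M%:E.
  by exists (fine (opnorm psi)); rewrite fineK// opnorm_fin.
have M0 : 0 <= M by rewrite -lee_fin -psiM opnorm_ge0.
pose L := M + 1; have L0 : 0 < L by rewrite /L; lra.
have psiL z : `|psi z| <= L * `|z|.
  apply: (@le_trans _ _ (M * `|z|)); first by apply: opnorm_bound; rewrite psiM.
  by rewrite ler_wpM2r// /L; lra.
pose F s := `|y s| `^ p - psi (y s).
have F_lb s : - (L * L `^ (p - 1)^-1) <= F s.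
  apply: (le_trans (functional_lower_bound L0 (normr_ge0 (y s)))).
  by rewrite lerD2l lerN2 (le_trans (ler_norm _)).
have F_nil : F [::] = 0 by rewrite /F /y /= linear0 normr0 powR0 ?subr0// gt_eqF.
pose B := (L + 1) `^ (p - 1)^-1.
have near_min d : 0 < d -> d <= 1 -> exists s, (forall s', F s <= F s' + d) /\ `|y s| <= B.
  move=> d0 d1; have hF : has_inf (range F).
    split; first by exists (F [::]); exists [::].
    by exists (- (L * L `^ (p - 1)^-1)) => _ [s _ <-].
  have [_ [s _ <-] Fs] := inf_adherent d0 hF.
  have Fs' s' : F s <= F s' + d.
    have : inf (range F) <= F s' by apply: ge_inf; [case: hF|exists s'].
    by move=> h; lra.
  exists s; split=> //; apply: sublevel_bound => //.
  have := Fs' [::]; rewrite F_nil add0r /F => h.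
  by have := psiL (y s); have := ler_norm (psi (y s)); lra.
apply/cvgrPdist_le => e e0.
pose K := B `^ p + 1; have K0 : 0 < K by rewrite ltr_wpDl// powR_ge0.
have e8 : 0 < e / (8 * K) by rewrite divr_gt0// mulr_gt0.
have [t0 t00 Ht0] := US e8.
have [N HN] : exists N : nat, N.+1%:R^-1 <= t0.
  by have [N _ /(_ N (leqnn N)) /ltW] := @near_infty_natSinv_lt R (PosNum t00); exists N.
pose t : R := N.+1%:R^-1; have t_gt0 : 0 < t by rewrite invr_gt0.
(* [d <= 1] keeps [y s] in a fixed ball, by [sublevel_bound]; [t * e / 8] leaves as much again to
   uniform smoothness. *)
pose d := Num.min 1 (t * e / 8).
have te : 0 < t * e / 8 by rewrite divr_gt0// mulr_gt0.
have dpos : 0 < d by rewrite lt_min ltr01.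
have d1 : d <= 1 by rewrite ge_min lexx.
have dt : d <= t * e / 8 by rewrite ge_min lexx orbT.
have [s [smin sB]] := near_min d dpos d1.
(* Near-minimality against [y s + t x n] bounds [t psi (x n)] above by the forward increment of the
   powered norm, and against [y s - t x n] it bounds it below by the backward one; smoothness makes
   the two increments nearly equal. *)
have est n : `|t * psi (x n) - (a (s, N) n - `|y s| `^ p)| <= t * e / 4.
  have h1 : F s <= F ((n, N, false) :: s) + d by exact: smin.
  have h2 : F s <= F ((n, N, true) :: s) + d by exact: smin.
  move: h1 h2; rewrite /F /y /= -/y expr0 expr1 mul1r mulN1r -/t scaleNr !linearD/= linearN/= linearZ/=.
  rewrite /a /= -/t => h1 h2.
  have h3 := Ht0 t (y s) (x n) t_gt0 HN.
  have h4 : `|y s| `^ p <= B `^ p by rewrite le_powR// ltW.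
  have h5 : `|x n| `^ p <= 1 by have := @le_powR _ p _ _ (ltW p0) (normr_ge0 _) (x1 n); rewrite powR1.
  have h6 : t * (e / (8 * K)) * (`|y s| `^ p + `|x n| `^ p) <= t * (e / (8 * K)) * K.
    by apply: ler_wpM2l; [rewrite mulr_ge0// ltW|rewrite /K; exact: lerD].
  have h7 : t * (e / (8 * K)) * K = t * e / 8 by field; rewrite gt_eqF.
  move: h1 h2 h3 h6; rewrite h7 ler_norml.
  move: (psi (y s)) (t *: psi (x n)) (erefl : t *: psi (x n) = t * psi (x n)) => z z' <-.
  by move: (`|y s + _| `^ p) (`|y s - _| `^ p) (_ * (_ + _)) => *; apply/andP; split; lra.
have [l cl] := cva (s, N).
(* Four errors of this size add up to [t * e]: two from [est], two from the convergence of the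
   norms. *)
have te4 : 0 < t * e / 4 by rewrite divr_gt0// mulr_gt0.
have /cvgrPdist_le /(_ _ te4) nl := cl.
have nl' : \forall k \near \oo, `|l - a (s, N) (phi k.+1)| <= t * e / 4.
  by have [N' _ HN'] := nl; exists N' => // k /= Nk; apply: HN' => /=; exact: leqW.
apply: filterS2 nl nl' => k /= hk hk'.
rewrite sub0r normrN linearB/= -(ler_pM2l t_gt0) -{1}(gtr0_norm t_gt0) -normrM mulrBr.
move: hk hk' (est (phi k)) (est (phi k.+1)); rewrite !ler_norml.
move: (t * psi _) (t * psi _) (a _ _) (a _ _) => w1 w2 a1 a2.
by move=> /andP[? ?] /andP[? ?] /andP[? ?] /andP[? ?]; apply/andP; split; lra.
Qed.

End WeaklyCauchy.

Section PropertyM.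
Context (R : realType).

Lemma not_near_subsequence (P : nat -> Prop) : ~ (\forall n \near \oo, P n) ->
  exists phi : nat -> nat, (forall k, phi k < phi k.+1)%N /\ forall k, ~ P (phi k).
Proof.
move=> nP; have /choice[F HF] N : exists n, (N <= n)%N /\ ~ P n.
  apply: contrapT => /forallNP h; apply: nP; exists N => // n /= Nn.
  by apply: contrapT => Pn; apply: (h n).
pose phi := fix phi (k : nat) : nat := if k is k'.+1 then F (phi k').+1 else F 0%N.
exists phi; split=> [k|[|k]]; first by have [] := HF (phi k).+1.
  by have [] := HF 0%N.
by have [] := HF (phi k).+1.
Qed.

Lemma cvg_limn_esupE (b : nat -> R) l : b @ \oo --> l ->
  limn_esup (fun n => (b n)%:E) = l%:E.
Proof.
move=> /cvgrPdist_le bl; apply/eqP; rewrite eq_le; apply/andP; split.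
  apply/lee_addgt0Pr => e e0; rewrite -EFinD; apply: limn_esup_near_le.
  by apply: filterS (bl e e0) => n; rewrite ler_norml => /andP[? ?]; lra.
apply/lee_subgt0Pr => e e0; rewrite -EFinB; apply: limn_esup_near_ge.
by apply: filterS (bl e e0) => n; rewrite ler_norml => /andP[? ?]; lra.
Qed.

Variables (p : R) (p1 : 1 < p) (X : normedModType R).
Implicit Types (x : X) (u : X^nat).
Hypothesis mX : property_m p X.

Let p0 : 0 < p. Proof. exact: lt_trans ltr01 p1. Qed.

Lemma property_m_cvg x u a l : weakly_null u ->
  (fun n => `|u n|) @ \oo --> l -> (fun n => `|x + u n|) @ \oo --> a ->
  `|a| `^ p = `|x| `^ p + `|l| `^ p.
Proof.
move=> wu ul xa.
have l0 : 0 <= l by apply: (cvgr_to_ge ul); exact: nearW.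
have a0 : 0 <= a by apply: (cvgr_to_ge xa); exact: nearW.
have := mX x wu; rewrite (cvg_limn_esupE ul) (cvg_limn_esupE xa).
have -> : ((`|x|%:E `^ p + l%:E `^ p) `^ p^-1)%E = ((`|x| `^ p + l `^ p) `^ p^-1)%:E by [].
move=> [->].
rewrite !ger0_norm ?powR_ge0// -powRrM mulVf ?gt_eqF// powRr1//.
by rewrite addr_ge0 ?powR_ge0.
Qed.

Lemma weakly_null_opp u : weakly_null u -> weakly_null (fun n => - u n).
Proof.
move=> wu psi cpsi; rewrite (_ : (fun n => _) = (fun n => - psi (u n))).
  by rewrite -[in X in _ --> X]oppr0; apply: cvgN; exact: wu.
by apply/funext => n; rewrite linearN.
Qed.

(** $(m_p)$ is applied to [u] and to [- u]. As it speaks of upper limits, it is used along a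
    subsequence on which all three norms converge; a sequence of failures would contain one. *)
Lemma property_m_midpoint x u C : weakly_null u -> (forall n, `|u n| <= C) ->
  (fun n => `|x + u n| `^ p + `|x - u n| `^ p - 2 * `|x| `^ p - 2 * `|u n| `^ p) @ \oo --> 0.
Proof.
move=> wu uC; apply/cvgrPdist_le => e e0; apply: contrapT.
move=> /not_near_subsequence[phi [incphi Hphi]].
pose v := u \o phi; have wv : weakly_null v by exact: weakly_null_subseq.
have vC n : `|v n| <= C by exact: uC.
(* Three sequences of norms, indexed by 0, 1 and everything else to suit [common_subsequence]. *)
pose b (i : nat) n := if i == 0%N then `|v n| else if i == 1%N then `|x + v n| else `|x - v n|.
have [i|psi [incpsi cb]] := @common_subsequence R _ b.
  exists (`|x| + C) => n; rewrite /b; have := normr_ge0 x.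
  have := ler_normB x (v n); have := ler_normD x (v n); have := vC n.
  by case: ifP => _; [|case: ifP => _]; rewrite normr_id; lra.
have [l0 h0] := cb 0%N; have [l1 h1] := cb 1%N; have [l2 h2] := cb 2%N.
have ww := weakly_null_subseq incpsi wv.
have e1 := property_m_cvg ww h0 h1.
have h0' : (fun n => `|- v (psi n)|) @ \oo --> l0.
  by rewrite (_ : (fun n => _) = b 0%N \o psi)//; apply/funext => n /=; rewrite normrN.
have e2 := property_m_cvg (weakly_null_opp ww) h0' h2.
have cont (s : nat -> R) l : s @ \oo --> l -> (fun n => `|s n| `^ p) @ \oo --> `|l| `^ p.
  by move=> sl; apply: (continuous_cvg _ (@norm_powR_continuous R p p1 l)).
have /cvgrPdist_lt /(_ e e0) : (fun n => `|x + v (psi n)| `^ p + `|x - v (psi n)| `^ p -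
    2 * `|x| `^ p - 2 * `|v (psi n)| `^ p) @ \oo -->
    `|l1| `^ p + `|l2| `^ p - 2 * `|x| `^ p - 2 * `|l0| `^ p.
  have c0 := cont _ _ h0; have c1 := cont _ _ h1; have c2 := cont _ _ h2.
  apply: cvgB; last first.
    apply: cvgMr; move: c0; rewrite /b/=.
    by under eq_fun do rewrite normr_id.
  apply: cvgB; last exact: cvg_cst.
  apply: cvgD.
    by move: c1; rewrite /b/=; under eq_fun do rewrite normr_id.
  by move: c2; rewrite /b/=; under eq_fun do rewrite normr_id.
rewrite e1 e2 => -[N _ /(_ N (leqnn N))] /= h; apply: (Hphi (psi N)).
apply: ltW; rewrite sub0r normrN; move: h; rewrite /v /= distrC => h.
set s := (X in `|X|); move: h; set s' := (X in `|X|).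
by have -> : s' = s by rewrite /s' /s; lra.
Qed.

End PropertyM.

(** * Total boundedness in $L_1$ *)

Section Compactness.
Context d (T : measurableType d) (R : realType).
Variables (mu : probability T R) (p : R) (p1 : 1 < p).
Local Notation L := (LspaceType mu (lt1_le1E p1)).
Local Notation Lf := (LfunType mu (lt1_le1E p1)).
Local Notation Int f := (mu.-integrable setT (EFin \o f)).
Implicit Types (f g : L) (M v w : Lf).

Let p0 : 0 < p. Proof. exact: lt_trans ltr01 p1. Qed.

Lemma le_add_powR (s r : R) : 0 < s -> 0 <= r -> r <= s + s `^ (1 - p) * r `^ p.
Proof.
move=> s0 r0; have [h|h] := leP r s; first by rewrite (le_trans h)// lerDl mulr_ge0 ?powR_ge0.
have rp : 0 < r := lt_trans s0 h.
have -> : r `^ p = r `^ (p - 1) * r by rewrite -[in RHS](powRr1 r0) mulrC mulr_powRB1// powRr1.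
rewrite mulrA -[leLHS]mul1r (@le_trans _ _ (s `^ (1 - p) * r `^ (p - 1) * r))//; last first.
  by rewrite lerDr ltW.
rewrite ler_pM2r// -(opprB p 1) powRN ler_pdivlMl ?powR_gt0// mulr1 le_powR// ?ltW//.
by rewrite subr_gt0.
Qed.

Lemma Int_norm_powR_max v w : Int (fun x => `|Num.max `|v x| `|w x| | `^ p).
Proof.
apply: (@Int_le _ _ _ _ _ (fun x => `|v x| `^ p + `|w x| `^ p)).
- apply: measurable_norm_powR; apply: measurable_maxr; apply: measurableT_comp => //; exact: Lf_measurable.
- by apply: IntD; exact: Lf_Int.
- move=> x; rewrite ger0_norm ?powR_ge0// ger0_norm; last by rewrite le_max normr_ge0.
  by rewrite /Num.max; case: ifP => _; rewrite ?lerDl ?lerDr powR_ge0.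
Qed.

Lemma measurable_norm_max v w : measurable_fun setT (fun x => Num.max `|v x| `|w x|).
Proof. by apply: measurable_maxr; apply: measurableT_comp => //; exact: Lf_measurable. Qed.

Definition Lmax v w : Lf := mkLf p1 (measurable_norm_max v w) (Int_norm_powR_max v w).

Definition imin v w := \int[mu]_x Num.min `|v x| `|w x|.

Lemma Int_imin v w : Int (fun x => Num.min `|v x| `|w x|).
Proof.
apply: (@Int_le _ _ _ _ _ (fun x => `|v x|)).
- by apply: min_measurable; exact: Lf_measurable.
- by apply: integrable_norm; exact: Lf_Int1.
- by move=> x; rewrite ger0_norm ?ge_min ?lexx// le_min !normr_ge0.
Qed.

Lemma imin_Lmax M v w : imin (Lmax M v) w <= imin M w + imin v w.
Proof.
rewrite /imin -RintegralD//; [|exact: Int_imin|exact: Int_imin].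
apply: le_Rint => [||x]; [exact: Int_imin|by apply: IntD; exact: Int_imin|].
rewrite [Lmax M v x]/=; move: (M x) (v x) (w x) => a b c.
rewrite (@ger0_norm _ (Num.max _ _)) ?le_max ?normr_ge0//.
move: `|a| `|b| `|c| (normr_ge0 a) (normr_ge0 b) (normr_ge0 c) => x1 x2 x3 *; rewrite /Num.max /Num.min.
by case: (ltP x1 x2) => ?; case: (ltP x1 x3) => ?; case: (ltP x2 x3) => ?; lra.
Qed.

Lemma Rint_Lmax M v : \int[mu]_x `|Lmax M v x| =
  \int[mu]_x `|M x| + \int[mu]_x `|v x| - imin M v.
Proof.
have i1 : Int (fun x => `|M x|) by apply: integrable_norm; exact: Lf_Int1.
have i2 : Int (fun x => `|v x|) by apply: integrable_norm; exact: Lf_Int1.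
rewrite -RintegralD// -RintegralB//; [|exact: IntD|exact: Int_imin].
congr Rintegral; apply/funext => x; rewrite [Lmax M v x]/=.
rewrite (@ger0_norm _ (Num.max _ _)) ?le_max ?normr_ge0//.
by rewrite -(addr_max_min `|M x| `|v x|) addrK.
Qed.

Lemma Rint_powR_Lmax M v : \int[mu]_x (`|Lmax M v x| `^ p) <=
  \int[mu]_x (`|M x| `^ p) + \int[mu]_x (`|v x| `^ p).
Proof.
rewrite -RintegralD//; [|exact: Lf_Int|exact: Lf_Int].
apply: le_Rint => [||x]; [exact: Lf_Int|by apply: IntD; exact: Lf_Int|].
rewrite [Lmax M v x]/= ger0_norm; last by rewrite le_max normr_ge0.
by rewrite /Num.max; case: ifP => _; rewrite ?lerDl ?lerDr powR_ge0.
Qed.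

Lemma imin_le_pmin e f g : 0 < e ->
  imin (Lrepr f) (Lrepr g) <= e + e `^ (1 - p) * pmin f g.
Proof.
move=> e0; rewrite /pmin -(RintegralZl _ measurableT); last first.
  by apply: Int_min_powR; exact: Lf_measurable.
have ic : Int (fun x => e `^ (1 - p) * Num.min `|Lrepr f x| `|Lrepr g x| `^ p).
  by apply: IntZ; apply: Int_min_powR; exact: Lf_measurable.
rewrite -[X in X + _](Rint_cst mu e) -RintegralD//; last exact: Int_cst.
apply: le_Rint => [||x]; [exact: Int_imin|apply: IntD => //; exact: Int_cst|].
by apply: le_add_powR; rewrite // le_min !normr_ge0.
Qed.

(* The maximum of [k] nearly disjoint [v n] has [L^1]-norm of order [k] but [p]-th moment at most
   [k C], which is impossible on a probability space for large [k]. *)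
Lemma not_almost_disjoint (v : nat -> Lf) (C dl : R) : 0 < dl ->
  (forall n, \int[mu]_x (`|v n x| `^ p) <= C) -> (forall n, dl <= \int[mu]_x `|v n x|) ->
  ~ (forall m, (fun n => imin (v m) (v n)) @ \oo --> 0).
Proof.
move=> dl0 vC vdl vv.
have C0 : 0 <= C by apply: le_trans (vC 0%N); apply: Rintegral_ge0 => // x _; exact: powR_ge0.
have imin_ge0 M w : 0 <= imin M w.
  by apply: Rintegral_ge0 => // x _; rewrite le_min !normr_ge0.
have build k : exists M : Lf, [/\ (fun n => imin M (v n)) @ \oo --> 0,
    k%:R * (dl / 2) <= \int[mu]_x `|M x| & \int[mu]_x (`|M x| `^ p) <= k%:R * C].
  elim: k => [|k [M [Mv M1 Mp]]].
    exists (Lrepr (0 : L)); rewrite !mul0r -norm_Lrepr normr0 powR0 ?gt_eqF//; split => //.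
    - rewrite (_ : (fun n => _) = fun=> 0); first exact: cvg_cst.
      apply/funext => n; apply/eqP; rewrite eq_le imin_ge0 andbT.
      have i0 : Int (fun x => `|Lrepr (0 : L) x|) by apply: integrable_norm; exact: Lf_Int1.
      apply: (@le_trans _ _ (\int[mu]_x `|Lrepr (0 : L) x|)).
        apply: (le_Rint (Int_imin _ _) i0) => x; by rewrite ge_min lexx.
      rewrite -(n1E (0 : L)) (le_trans (n1_le _))// normr0 mulr0//.
    - by apply: Rintegral_ge0.
  (* The next [v n] overlaps [M] by at most [dl / 2], so passing to the maximum gains at least
     [dl / 2] of $L_1$-norm. *)
  have dl2 : 0 < dl / 2 by rewrite divr_gt0.
  have /cvgrPdist_le /(_ _ dl2) [n _ /(_ n (leqnn n))] := Mv; rewrite sub0r normrN ger0_norm//= => Mn.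
  exists (Lmax M (v n)); split.
  - have Sv : (fun m => imin M (v m) + imin (v n) (v m)) @ \oo --> 0.
      by rewrite -[in X in _ --> X](addr0 0); apply: cvgD.
    apply/cvgrPdist_le => e e0; move/cvgrPdist_le: Sv => /(_ e e0).
    apply: filterS => m; rewrite !sub0r !normrN !ger0_norm ?addr_ge0//.
    exact: le_trans (imin_Lmax _ _ _).
  - by rewrite Rint_Lmax -natr1 mulrDl mul1r; have := vdl n; lra.
  - by rewrite (le_trans (Rint_powR_Lmax _ _))// -natr1 mulrDl mul1r lerD.
(* With the threshold [k q], the integral of [|M|], at least [2 k q], is at most
   [k q + (k q)^(1 - p) k C]; the last term is below [k q] once [k^(p - 1) > C / q^p]. *)
pose q := dl / 4; have q0 : 0 < q by rewrite divr_gt0.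
pose C1 := C / (q `^ p).
have [k [k0 hk]] : exists k : nat, 0 < (k%:R : R) /\ C1 < k%:R `^ (p - 1).
  exists (Num.truncn ((C1 + 1) `^ (p - 1)^-1)).+1.
  have p10 : 0 < p - 1 by rewrite subr_gt0.
  have C10 : 0 <= C1 by rewrite divr_ge0 ?powR_ge0.
  split=> //; have C10' : 0 <= C1 + 1 by lra.
  apply: (@le_lt_trans _ _ (((C1 + 1) `^ (p - 1)^-1) `^ (p - 1))).
    by rewrite -powRrM mulVf ?gt_eqF// powRr1// lerDl.
  by apply: lt_powR; rewrite ?powR_ge0// truncnS_gt.
have [M [_ M1 Mp]] := build k.
have kq : 0 < k%:R * q by rewrite mulr_gt0.
have : \int[mu]_x `|M x| <= k%:R * q + (k%:R * q) `^ (1 - p) * \int[mu]_x (`|M x| `^ p).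
  rewrite -(RintegralZl _ measurableT) ?Lf_Int//.
  have ic : Int (fun x => (k%:R * q) `^ (1 - p) * `|M x| `^ p) by apply: IntZ; exact: Lf_Int.
  rewrite -[X in X + _](Rint_cst mu) -RintegralD//; last exact: Int_cst.
  apply: le_Rint => [||x]; [by apply: integrable_norm; exact: Lf_Int1|apply: IntD => //; exact: Int_cst|].
  exact: le_add_powR.
have : (k%:R * q) `^ (1 - p) * \int[mu]_x (`|M x| `^ p) <= (k%:R * q) `^ (1 - p) * (k%:R * C).
  by rewrite ler_wpM2l ?powR_ge0.
have : (k%:R * q) `^ (1 - p) * (k%:R * C) < k%:R * q.
  rewrite -(opprB p 1) powRN ltr_pdivrMl ?powR_gt0// [ltRHS]mulrC (mulr_powRB1 (ltW kq) p0).
  have qp : 0 < q `^ p by rewrite powR_gt0.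
  rewrite powRM ?(ltW q0)// ?(ltW k0)//; move: hk; rewrite ltr_pdivrMr// => hk.
  rewrite -(mulr_powRB1 (ltW k0) p0) -mulrA ltr_pM2l//.
have kE : k%:R * (dl / 2) = k%:R * q + k%:R * q by rewrite /q; field.
by move: M1; rewrite kE; set z := k%:R * q; lra.
Qed.

Variable X : submodClosed L.
Hypothesis p2 : p != 2.
Hypothesis mX : property_m p (subspace_of X).

(** By [property_m_midpoint] the Clarkson defect of [x] and [u n] tends to 0, and [pmin_clarkson]
    turns this into vanishing overlap. *)
Lemma property_m_pmin (x : subspace_of X) (u : (subspace_of X)^nat) C :
  weakly_null u -> (forall n, `|u n| <= C) -> (fun n => pmin (val x) (val (u n))) @ \oo --> 0.
Proof.
move=> wu uC; apply/cvgrPdist_le => e e0.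
have C0 : 0 <= C by exact: le_trans (normr_ge0 _) (uC 0%N).
pose D := `|x| `^ p + C `^ p + 1; have D0 : 0 < D by rewrite ltr_wpDl// addr_ge0 ?powR_ge0.
have eD : 0 < e / (2 * D) by rewrite divr_gt0// mulr_gt0.
have [K K0 HK] := pmin_clarkson mu p1 p2 eD.
have eK : 0 < e / (2 * (K + 1)) by rewrite divr_gt0// mulr_gt0// ltr_wpDl.
have /cvgrPdist_le /(_ _ eK) := property_m_midpoint p1 mX x wu uC.
apply: filterS => n; rewrite !sub0r !normrN => h.
rewrite ger0_norm; last by apply: Rintegral_ge0 => // y _; exact: powR_ge0.
apply: (le_trans (HK _ _)).
have h1 : e / (2 * D) * (`|val x| `^ p + `|val (u n)| `^ p) <= e / (2 * D) * D.
  have hC : `|val (u n)| `^ p <= C `^ p by apply: le_powR; [exact: ltW| |exact: uC].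
  by rewrite ler_wpM2l ?(ltW eD)// /D -addrA lerD2l (le_trans hC)// lerDl.
have h2 : e / (2 * D) * D = e / 2 by field; rewrite gt_eqF.
set S := (X in K * X).
have h3 : `|S| <= e / (2 * (K + 1)).
  by apply: le_trans h; rewrite /S normrM; case: ifP => _; rewrite ?normrN normr1 mul1r.
have h4 : K * S <= (K + 1) * (e / (2 * (K + 1))).
  apply: (@le_trans _ _ (K * `|S|)); first by rewrite ler_wpM2l// ler_norm.
  by apply: ler_pM; rewrite ?normr_ge0// lerDl.
have h5 : (K + 1) * (e / (2 * (K + 1))) = e / 2 by field; rewrite gt_eqF// ltr_wpDl.
by move: h1 h4; rewrite h2 h5; move: (K * S) (_ * (_ + _)) => *; lra.
Qed.

Lemma property_m_imin (u : (subspace_of X)^nat) C : weakly_null u -> (forall n, `|u n| <= C) ->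
  forall m, (fun n => imin (Lrepr (val (u m))) (Lrepr (val (u n)))) @ \oo --> 0.
Proof.
move=> wu uC m; apply/cvgrPdist_le => e e0.
have e2 : 0 < e / 2 by rewrite divr_gt0.
pose K := (e / 2) `^ (1 - p); have K0 : 0 < K by rewrite powR_gt0.
have eK : 0 < e / 2 / K by rewrite divr_gt0.
have /cvgrPdist_le /(_ _ eK) := property_m_pmin (u m) wu uC.
apply: filterS => n; rewrite !sub0r !normrN => h.
rewrite ger0_norm; last by apply: Rintegral_ge0 => // y _; rewrite le_min !normr_ge0.
apply: (le_trans (imin_le_pmin _ _ e2)); rewrite -/K.
have := le_trans (ler_norm _) h; rewrite ler_pdivlMr// mulrC.
by move: (K * _) => *; lra.
Qed.

(** Greedy choice: [st n] lists the points chosen so far, and as no finite list in the ball is an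
    [e]-net, some point of the ball is far from all of them. *)
Lemma separated_sequence e : ~ (exists s : seq (subspace_of X), all (fun g : subspace_of X => `|g| <= 1) s /\
    forall f : subspace_of X, `|f| <= 1 -> exists2 g : subspace_of X, g \in s & n1 (val f - val g) < e) ->
  exists x : nat -> subspace_of X, (forall n, `|x n| <= 1) /\
    forall m n, (m < n)%N -> e <= n1 (val (x n) - val (x m)).
Proof.
move=> /forallNP H.
have /choice[F HF] (s : seq (subspace_of X)) : exists f : subspace_of X,
    all (fun g : subspace_of X => `|g| <= 1) s -> `|f| <= 1 /\ forall g : subspace_of X, g \in s -> e <= n1 (val f - val g).
  have [s1|s1] := boolP (all (fun g : subspace_of X => `|g| <= 1) s); last by exists 0.
  have := H s; rewrite s1 => /not_andP[//|/existsNP[f /not_implyP[f1 Hf]]].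
  exists f => _; split=> // g gs; rewrite leNgt; apply/negP => h; apply: Hf.
  by exists g.
pose st := fix st n := if n is n'.+1 then F (st n') :: st n' else [::].
have st1 n : all (fun g : subspace_of X => `|g| <= 1) (st n).
  by elim: n => //= n IH; rewrite IH andbT; have [] := HF _ IH.
exists (fun n => F (st n)); split=> [n|m n mn]; first by have [] := HF _ (st1 n).
have [_ h] := HF _ (st1 n); apply: h.
elim: n mn => // n IH; rewrite ltnS leq_eqVlt /= inE => /predU1P[->|/IH ->]; first by rewrite eqxx.
by rewrite orbT.
Qed.

Lemma property_m_totally_bounded e : 0 < e ->
  exists s : seq (subspace_of X), all (fun g : subspace_of X => `|g| <= 1) s /\
    forall f : subspace_of X, `|f| <= 1 -> exists2 g : subspace_of X, g \in s & n1 (val f - val g) < e.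
Proof.
move=> e0; apply: contrapT => /separated_sequence[x [x1 xe]].
have [|phi [inc wu]] := @weakly_cauchy_subsequence R p p1 (subspace_of X) _ x x1.
  move=> eta eta0; have [t0 t00 Ht] := uniform_smooth_Lp mu p1 eta0.
  by exists t0 => // t f g t1 t2; exact: Ht.
pose u k := x (phi k.+1) - x (phi k).
have u2 k : `|u k| <= 2.
  by rewrite (le_trans (ler_normB _ _))// (_ : 2 = 1 + 1)// lerD.
apply: (@not_almost_disjoint (fun n => Lrepr (val (u n))) (2 `^ p) e e0).
- move=> n; rewrite -norm_Lrepr le_powR// ?(ltW p0)//; exact: u2.
- by move=> n; rewrite -n1E; exact: xe.
- exact: (property_m_imin wu u2).
Qed.

End Compactness.

(** * Limits of fast Cauchy sequences in $L_p$ *)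

Section Complete.
Context d (T : measurableType d) (R : realType).
Variables (mu : probability T R) (p : R) (p1 : 1 < p).
Local Notation L := (LspaceType mu (lt1_le1E p1)).
Local Notation Lf := (LfunType mu (lt1_le1E p1)).
Local Notation Int f := (mu.-integrable setT (EFin \o f)).
Implicit Types (f g : L).

Let p0 : 0 < p. Proof. exact: lt_trans ltr01 p1. Qed.

Variable z : nat -> L.
Hypothesis zc : forall n k, (n <= k)%N -> `|z n - z k| <= 2^-1 ^+ n.
Let v n : Lf := Lrepr (z n).

Let zB n k : z n - z k = Lclass (v n - v k).
Proof. by rewrite -{1}(LreprK (z n)) -{1}(LreprK (z k)) LclassB. Qed.

(** The increments have $L_1$-norms at most [2 * 2^-n], so the sum of their absolute values has
    integral at most 4 and is finite almost everywhere. *)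
Lemma fast_cauchy_ae_cvg : {ae mu, forall x, cvgn (fun n => v n x)}.
Proof.
pose D n x := (`|v n x - v n.+1 x|%:E : \bar R).
have iD n : Int (fun x => `|(v n - v n.+1) x|) by apply: integrable_norm; exact: Lf_Int1.
have D0 n x : (0 <= D n x)%E by rewrite lee_fin.
have mD n : measurable_fun setT (D n) by exact: measurable_int (iD n).
have geo n : \sum_(i < n) 2 * 2^-1 ^+ i = 4 - 4 * 2^-1 ^+ n :> R.
  elim: n => [|n IH]; first by rewrite big_ord0 expr0; lra.
  by rewrite big_ord_recr/= IH exprS; lra.
have : mu.-integrable setT (fun x => (\sum_(0 <= n <oo) D n x)%E).
  apply/integrableP; split.
    by apply: (@ge0_emeasurable_sum _ _ _ _ _ xpredT) => [k x _ _|k _]; [exact: D0|exact: mD].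
  under eq_integral => x _ do rewrite gee0_abs ?nneseries_ge0//.
  rewrite integral_nneseries//; apply: (@le_lt_trans _ _ 4%:E); last exact: ltry.
  apply: lime_le; first by apply: is_cvg_nneseries => n _ _; exact: integral_ge0.
  apply: nearW => n; rewrite big_mkord.
  apply: (@le_trans _ _ (\sum_(i < n) (2 * 2^-1 ^+ i)%:E)%E).
    apply: lee_sum => i _; have := n1_le (z i - z i.+1); rewrite zB n1_Lclass => h.
    have -> : (\int[mu]_x D i x = (\int[mu]_x `|(v i - v i.+1) x|)%:E)%E.
      by rewrite /Rintegral fineK//; exact: integrable_fin_num (iD i).
    by rewrite lee_fin (le_trans h)// -zB ler_wpM2l// zc.
  rewrite sumEFin lee_fin geo.
  by have h : 0 <= 2^-1 ^+ n :> R; [rewrite exprn_ge0|lra].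
move=> /(integrable_ae measurableT); apply: filterS => x /(_ I) fin.
pose w n : R^o := v n.+1 x - v n x.
have cw : cvgn (series w).
  apply: normed_cvg; apply: nondecreasing_is_cvgn.
    apply/nondecreasing_seqP => n.
    change (\sum_(0 <= k < n) `|w k| <= \sum_(0 <= k < n.+1) `|w k|).
    by rewrite big_nat_recr//= lerDl.
  exists (fine (\sum_(0 <= n <oo) D n x)%E) => _ [n _ <-].
  rewrite -lee_fin fineK// /series/= -sumEFin.
  rewrite (eq_bigr (fun i => D i x)); last by move=> i _; rewrite /D distrC.
  exact: nneseries_lim_ge.
have -> : (fun n => v n x) = (fun n => series w n + v 0%N x).
  apply/funext => n; rewrite /series/=; elim: n => [|n IH]; first by rewrite big_nil add0r.
  by rewrite big_nat_recr//= addrAC -IH addrC subrK.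
by apply: is_cvgD; [exact: cw|exact: is_cvg_cst].
Qed.

Lemma fast_cauchy_cvg : exists f, forall n, `|z n - f| <= 2^-1 ^+ n.
Proof.
(* An upper limit is measurable and defined everywhere; almost everywhere it is the limit. *)
pose h x := fine (limn_esup (fun n => (v n x)%:E)).
have mh : measurable_fun setT h.
  apply: (@measurableT_comp _ _ _ _ _ _ fine); first exact: fine_measurable.
  by apply: measurable_fun_limn_esup => n; apply/measurable_EFinP; exact: Lf_measurable.
have mvh n : measurable_fun setT (fun x => v n x - h x).
  by apply: measurable_funB => //; exact: Lf_measurable.
have bound n : (\int[mu]_x (`|v n x - h x| `^ p)%:E <= ((2^-1 ^+ n) `^ p)%:E)%E.
  pose F m x := ((`|(v n - v m) x| `^ p)%:E : \bar R).
  have mF m : measurable_fun setT (F m).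
    by apply/measurable_EFinP; apply: measurable_norm_powR; exact: Lf_measurable.
  have -> : (\int[mu]_x (`|v n x - h x| `^ p)%:E = \int[mu]_x limn_einf (F^~ x))%E.
    apply: ae_eq_integral => //.
    - by apply/measurable_EFinP; apply: measurable_norm_powR; exact: mvh.
    - rewrite (_ : (fun x => _) = -%E \o (fun x => limn_esup (fun m => - F m x)%E)).
        apply: measurableT_comp => //; apply: measurable_fun_limn_esup => m.
        exact: measurableT_comp.
      by apply/funext => x /=; rewrite /limn_einf.
    - apply: filterS fast_cauchy_ae_cvg => x /cvg_ex[l vl] _.
      have hl : h x = l by rewrite /h (cvg_limn_esupE vl).
      have : F^~ x @ \oo --> (`|v n x - l| `^ p)%:E.
        apply: cvg_EFin; first exact: nearW.
        apply: (continuous_cvg _ (@norm_powR_continuous R p p1 (v n x - l))).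
        by apply: cvgB => //; exact: cvg_cst.
      by move=> /cvg_limn_einf_sup[-> _]; rewrite hl.
  apply: (le_trans (fatou mu measurableT mF _)); first by move=> m x _; rewrite lee_fin powR_ge0.
  apply: (le_trans (limn_einf_sup _)).
  have E m : (\int[mu]_x F m x = (`|z n - z m| `^ p)%:E)%E.
    rewrite zB norm_Lclass /Rintegral fineK//; exact: integrable_fin_num (Lf_Int _).
  under eq_fun do rewrite E.
  apply: limn_esup_near_le; exists n => // m /= nm.
  by rewrite le_powR ?(ltW p0)// zc.
have ivh n : Int (fun x => `|v n x - h x| `^ p).
  apply/integrableP; split.
    by apply/measurable_EFinP; apply: measurable_norm_powR; exact: mvh.
  under eq_integral do rewrite /= ger0_norm ?powR_ge0//.
  by apply: le_lt_trans (bound n) _; exact: ltry.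
(* What has been shown [p]-integrable is [v n - h], not [h]; hence the limit is entered as
   [v 0 - (v 0 - h)]. *)
pose W := mkLf p1 (mvh 0%N) (ivh 0%N).
exists (Lclass (v 0%N - W)) => n.
rewrite -{1}(LreprK (z n)) LclassB.
have e0 : 0 <= 2^-1 ^+ n :> R by rewrite exprn_ge0.
rewrite leNgt; apply/negP => /(lt_powR p0 e0); rewrite ltNge => /negP; apply.
rewrite norm_Lclass -lee_fin; apply: le_trans (bound n).
rewrite le_eqVlt; apply/orP; left; apply/eqP.
have E x : (v n - (v 0%N - W)) x = v n x - h x.
  transitivity (v n x - (v 0%N x - (v 0%N x - h x))); first by [].
  by rewrite subKr.
rewrite /Rintegral; under eq_integral => x _ do rewrite E.
by rewrite fineK//; exact: integrable_fin_num (ivh n).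
Qed.

End Complete.

(** * From total boundedness to compactness of the ball in $L_1$ *)

Section CompactBall.
Context d (T : measurableType d) (R : realType).
Variables (mu : probability T R) (p : R) (p1 : 1 < p).
Local Notation L := (LspaceType mu (lt1_le1E p1)).
Local Notation J := (@Lspace_L1 _ _ _ mu _ (lt1_le1E p1)).
Implicit Types (f g : L).

Let p0 : 0 < p. Proof. exact: lt_trans ltr01 p1. Qed.

Let powR1p : 1 `^ p = 1 :> R. Proof. by rewrite powR1. Qed.

Lemma n1Z (c : R) f : n1 (c *: f) = `|c| * n1 f.
Proof.
rewrite -(LreprK f) LclassZ !n1_Lclass -RintegralZl//; last by apply: integrable_norm; exact: Lf_Int1.
by congr Rintegral; apply/funext => x; rewrite -normrM.
Qed.

Lemma n1_norm f g : `|J f - J g| = n1 (f - g).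
Proof. by rewrite -L1B. Qed.

Lemma ultra_finite_cover (S : Type) (I : eqType) (U : set_system S) (A : set S) (s : seq I) (P : I -> set S) :
  UltraFilter U -> U A -> (forall y, A y -> exists2 i, i \in s & P i y) -> exists2 i, i \in s & U (P i).
Proof.
move=> UU; elim: s A => [|i s IH] A UA AP.
  by have [y /AP[]] := @filter_ex _ U _ _ UA.
have [Ui|Ui] := in_ultra_setVsetC (P i) UU; first by exists i => //; exact: mem_head.
have [|j js Uj] := IH _ (filterI UA Ui); last by exists j => //; rewrite inE js orbT.
by move=> y; case=> /AP[j]; rewrite inE => /predU1P[->|js] Pj nPi //; exists j.
Qed.

Variable X : submodClosed L.
Hypothesis cX : closed [set f | f \in X].
Let B := [set f : L | f \in X /\ `|f| <= 1].
Hypothesis tB : forall e, 0 < e -> exists s : seq L, (forall g, g \in s -> B g) /\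
  forall f, B f -> exists2 g, g \in s & n1 (f - g) < e.

Section Ultra.
Variable U : set_system (LspaceType1 mu).
Hypothesis UU : UltraFilter U.
Hypothesis UB : U (J @` B).

(** Points of the ball that stand in for the limit of [U] before it is known to exist: [U] is
    concentrated within [1 / (n + 1)] of them in $L_1$. *)
Definition near_center (n : nat) : set L := [set f | B f /\
  U [set y | exists2 k, y = J k & n1 (k - f) <= n.+1%:R^-1]].

Lemma near_center_nonempty n : near_center n !=set0.
Proof.
have n0 : 0 < n.+1%:R^-1 :> R by rewrite invr_gt0.
have [s [sB Hs]] := tB n0.
have [|g gs Ug] := @ultra_finite_cover _ _ U _ s
    (fun g => [set y | exists2 k, y = J k & n1 (k - g) <= n.+1%:R^-1]) UU UB.
  by move=> _ [f Bf <-]; have [g gs fg] := Hs f Bf; exists g => //; exists f => //; exact: ltW.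
by exists g; split=> //; exact: sB.
Qed.

Lemma near_center_antitone m n : (m <= n)%N -> near_center n `<=` near_center m.
Proof.
move=> mn f [Bf Uf]; split=> //; apply: filterS Uf => _ [k -> kf]; exists k => //.
by apply: (le_trans kf); rewrite lef_pV2 ?posrE// ler_nat.
Qed.

Lemma near_center_midpoint n f g : near_center n f -> near_center n g ->
  near_center n (2^-1 *: (f + g)).
Proof.
move=> [[fX f1] Uf] [[gX g1] Ug]; split.
  split; first by apply: rpredZ; exact: rpredD.
  rewrite normrZ ger0_norm// ler_pdivrMl// mulr1 (le_trans (ler_normD _ _))//.
  by have -> : 2 = 1 + 1 :> R by []; exact: lerD.
apply: filterS2 Uf Ug => _ [k -> kf] [k' kk' k'g]; exists k => //.
have kE : n1 (k - g) = n1 (k' - g) by rewrite -!n1_norm kk'.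
have -> : k - 2^-1 *: (f + g) = 2^-1 *: ((k - f) + (k - g)).
  have h : 2^-1 + 2^-1 = 1 :> R by field.
  by rewrite !scalerDr !scalerN addrACA -scalerDl h scale1r -opprD.
rewrite n1Z ger0_norm// ler_pdivrMl//; apply: (le_trans (n1D _ _)).
by rewrite kE mulrDl mul1r lerD.
Qed.

Let m n := inf [set `|f| `^ p | f in near_center n].

Let m_lb n : has_lbound [set `|f| `^ p | f in near_center n].
Proof. by exists 0 => _ [f _ <-]; exact: powR_ge0. Qed.

Let m_le n f : near_center n f -> m n <= `|f| `^ p.
Proof. by move=> nf; apply: ge_inf; [exact: m_lb|exists f]. Qed.

Let m_ne n : [set `|f| `^ p | f in near_center n] !=set0.
Proof. by have [f nf] := near_center_nonempty n; exists (`|f| `^ p); exists f. Qed.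

Let m_le1 n : m n <= 1.
Proof.
have [f nf] := near_center_nonempty n; apply: (le_trans (m_le nf)).
by rewrite -[leRHS]powR1p le_powR ?(ltW p0)//; case: nf => -[[]].
Qed.

Let M := sup (range m).

Let m_sup : has_sup (range m).
Proof. by split; [exists (m 0%N); exists 0%N|exists 1 => _ [n _ <-]]. Qed.

Let m_M n : m n <= M.
Proof. by apply: ub_le_sup; [case: m_sup|exists n]. Qed.

(** The norms are compared with the supremum [M] of the infima [m n], not with [m n] itself, so that
    these sets shrink as [n] grows. *)
Definition near_minimal (n : nat) : set L :=
  [set f | near_center n f /\ `|f| `^ p <= M + n.+1%:R^-1].

Lemma near_minimal_nonempty n : near_minimal n !=set0.
Proof.
have n0 : 0 < n.+1%:R^-1 :> R by rewrite invr_gt0.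
have [_ [f nf <-] fm] := inf_adherent n0 (conj (m_ne n) (m_lb n)).
exists f; split=> //; rewrite (le_trans (ltW fm))// lerD2r; exact: m_M.
Qed.

Lemma near_minimal_antitone i n : (i <= n)%N -> near_minimal n `<=` near_minimal i.
Proof.
move=> le_in f [nf fM]; split; first exact: near_center_antitone nf.
by apply: (le_trans fM); rewrite lerD2l lef_pV2 ?posrE// ler_nat.
Qed.

(** The midpoint of [f] and [g] is still a near center, so its powered norm is almost at least [M],
    while those of [f] and [g] are almost at most [M]; uniform convexity then bounds the half
    difference. *)
Lemma near_minimal_cauchy e : 0 < e -> exists n, forall f g,
  near_minimal n f -> near_minimal n g -> `|f - g| <= e.
Proof.
move=> e0; have e2 : 0 < e / 2 by rewrite divr_gt0.
have E0 : 0 < (e / 2) `^ p by rewrite powR_gt0.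
have E4 : 0 < (e / 2) `^ p / 4 by rewrite divr_gt0.
have [C C0 HC] := uniform_convex_Lp mu p1 E4.
(* The convexity defect is at most [4 eta], so its term is at most half of [(e / 2)^p]. The term
   with coefficient [(e / 2)^p / 4] is at most the other half, as both norms in it are at most 1. *)
pose eta := (e / 2) `^ p / (8 * (C + 1)).
have C1 : 0 < C + 1 by rewrite ltr_wpDl.
have eta0 : 0 < eta by rewrite divr_gt0// mulr_gt0.
have [_ [n1 _ <-] hn1] := sup_adherent eta0 m_sup.
have [n2 hn2] : exists n : nat, n.+1%:R^-1 <= eta.
  by have [N _ /(_ N (leqnn N)) /ltW] := @near_infty_natSinv_lt R (PosNum eta0); exists N.
exists (maxn n1 n2) => f g nf ng.
have [[f1 fM] [f2 _]] := (near_minimal_antitone (leq_maxr n1 n2) nf, near_minimal_antitone (leq_maxl n1 n2) nf).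
have [[g1 gM] [g2 _]] := (near_minimal_antitone (leq_maxr n1 n2) ng, near_minimal_antitone (leq_maxl n1 n2) ng).
have hm := m_le (near_center_midpoint f2 g2).
have := HC (2^-1 *: (f + g)) (2^-1 *: (f - g)).
have half (h : L) : 2^-1 *: h + 2^-1 *: h = h.
  have h2 : 2^-1 + 2^-1 = 1 :> R by field.
  by rewrite -scalerDl h2 scale1r.
have -> : 2^-1 *: (f + g) + 2^-1 *: (f - g) = f.
  by rewrite -scalerDr addrACA subrr addr0 scalerDr half.
have -> : 2^-1 *: (f + g) - 2^-1 *: (f - g) = g.
  by rewrite -scalerBr opprB [f + g]addrC addrACA subrr addr0 scalerDr half.
have b1 : `|2^-1 *: (f + g)| `^ p <= 1.
  have [[_ h] _] := near_center_midpoint f1 g1.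
  by rewrite -[leRHS]powR1p le_powR ?(ltW p0).
have fg2 : `|2^-1 *: (f - g)| = `|f - g| / 2 by rewrite normrZ ger0_norm// mulrC.
have b2 : `|2^-1 *: (f - g)| `^ p <= 1.
  rewrite -[leRHS]powR1p le_powR ?(ltW p0)// fg2 ler_pdivrMr// mul1r.
  have [[_ h] _] := f1; have [[_ h'] _] := g1.
  by rewrite (le_trans (ler_normB _ _))// (_ : 2 = 1 + 1)// lerD.
move=> h; rewrite -(ler_pM2r (_ : 0 < 2^-1)) ?invr_gt0// -fg2.
rewrite leNgt; apply/negP => /(lt_powR p0 (ltW e2)).
have h3 : C * (`|f| `^ p + `|g| `^ p - 2 * `|2^-1 *: (f + g)| `^ p) <= (C + 1) * (4 * eta).
  apply: (@le_trans _ _ (C * (4 * eta))); last first.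
    by apply: ler_wpM2r; [rewrite mulr_ge0// ltW|rewrite lerDl].
  apply: ler_wpM2l => //.
  have lin (a b c x y t : R) : x <= c -> y - t < x -> a <= y + t -> b <= y + t -> a + b - 2 * c <= 4 * t by lra.
  apply: (lin _ _ _ _ _ _ hm hn1); [apply: (le_trans fM)|apply: (le_trans gM)]; by rewrite lerD2l.
have h4 : (C + 1) * (4 * eta) = (e / 2) `^ p / 2 by rewrite /eta; field; rewrite gt_eqF.
have h5 : (e / 2) `^ p / 4 * (`|2^-1 *: (f + g)| `^ p + `|2^-1 *: (f - g)| `^ p) <= (e / 2) `^ p / 4 * 2.
  by rewrite ler_wpM2l ?(ltW E4)// (_ : 2 = 1 + 1)// lerD.
by have := le_trans h (lerD h5 h3); rewrite h4; move: (_ `^ p) ((e / 2) `^ p) => *; lra.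
Qed.

Lemma ultra_limit : exists2 f, B f & U --> J f.
Proof.
have /choice[N HN] j : exists n, forall f g,
    near_minimal n f -> near_minimal n g -> `|f - g| <= 2^-1 ^+ j.
  by apply: near_minimal_cauchy; rewrite exprn_gt0.
(* [r j] is at least [N i] for every [i <= j], which makes [z] fast Cauchy, and at least [j], which
   makes the $L_1$-radius around [z j] tend to 0. *)
pose r j := (j + \sum_(i < j.+1) N i)%N.
have /choice[z Hz] j := near_minimal_nonempty (r j).
have zN i j : (i <= j)%N -> near_minimal (N i) (z j).
  move=> ij; apply: near_minimal_antitone (Hz j).
  rewrite (leq_trans _ (leq_addl _ _))//.
  by rewrite (bigD1 (Ordinal (ij : (i < j.+1)%N)))//= leq_addr.
have [|f fz] := @fast_cauchy_cvg _ _ _ mu _ p1 z.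
  by move=> n k nk; apply: HN; exact: zN.
have half_cvg e : 0 < e -> \forall j \near \oo, 2^-1 ^+ j <= (e : R).
  move=> e0; have /cvgrPdist_le /(_ e e0) : (GRing.exp (2^-1 : R)) @ \oo --> 0.
    by apply: cvg_expr; rewrite ger0_norm// invf_lt1// ltr1n.
  by apply: filterS => j; rewrite sub0r normrN ger0_norm// exprn_ge0.
have zf : z @ \oo --> f.
  apply/cvgrPdist_le => e /half_cvg; apply: filterS => j; apply: le_trans.
  by rewrite distrC.
have zB j : B (z j) by have [[]] := Hz j.
exists f.
  split.
    apply: (@closed_cvg nat L \oo _ z [set f | f \in X] cX _ f zf).
    by apply: nearW => j; have [] := zB j.
  by apply: (cvgr_to_le (cvg_norm zf)); apply: nearW => j; have [] := zB j.
move=> V /nbhs_ballP[e /= e0 HV].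
have e4 : 0 < e / 4 by rewrite divr_gt0.
have e2 : 0 < e / 2 by rewrite divr_gt0.
have [j [h1 h2]] : exists j, 2^-1 ^+ j <= e / 4 /\ j.+1%:R^-1 < e / 2.
  exact: filter_ex (filterI (half_cvg _ e4) (@near_infty_natSinv_lt R (PosNum e2))).
have [[_ Uz] _] := Hz j; apply: filterS Uz => _ [k -> kz]; apply: HV.
rewrite -ball_normE/= distrC n1_norm.
have -> : k - f = (k - z j) + (z j - f) by rewrite addrA subrK.
have rj : (r j).+1%:R^-1 <= j.+1%:R^-1 :> R by rewrite lef_pV2 ?posrE// ler_nat ltnS leq_addr.
have := n1D (k - z j) (z j - f); have := n1_le (z j - f); have := fz j.
have := le_lt_trans (le_trans kz rj) h2; lra.
Qed.

End Ultra.

Lemma totally_bounded_compact : compact (J @` B).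
Proof.
rewrite compact_ultra => U UU UB; have [f Bf Uf] := ultra_limit UU UB.
by exists (J f); split=> //; exists f.
Qed.

End CompactBall.

Lemma property_m_compact d (T : measurableType d) (R : realType)
    (mu : probability T R) (p : R) (p1 : 1 < p)
    (X : submodClosed (LspaceType mu (lt1_le1E p1))) :
  p != 2 -> closed [set f | f \in X] -> property_m p (subspace_of X) ->
  compact (@Lspace_L1 _ _ _ mu _ _ @` [set f | f \in X /\ `|f| <= 1]).
Proof.
move=> p2 cX mX; apply: totally_bounded_compact => // e e0.
have [s [s1 Hs]] := property_m_totally_bounded p2 mX e0.
exists (map val s); split.
  by move=> _ /mapP[g gs ->]; split; [exact: valP|exact: (allP s1 _ gs)].
move=> f [fX f1]; have [g gs fg] := Hs (exist _ f fX) f1.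
by exists (val g) => //; exact: map_f.
Qed.

Theorem theorem5p4 (R : realType) (T : pmetricType R)
  (mu : probability (borel T) R) (p : R) (p1 : 1 < p)
  (X : submodClosed (LspaceType mu (lt1_le1E p1))) :
  compact [set: T] -> nonatomic mu -> p != 2 ->
  closed [set f | f \in X] ->
  ~ finite_dimensional (subspace_of X) ->
  [<->
    compact (@Lspace_L1 _ _ _ mu _ _ @` [set f | f \in X /\ `|f| <= 1]);
    property_m p (subspace_of X);
    forall e : R, 0 < e -> exists X0 : submodClosed (ell (lt1_le1E p1)),
      (banach_mazur (subspace_of X0) (subspace_of X) < (1 + e)%:E)%E ].
Proof.
move=> _ _ p2 cX _.
have to_ell := @compact_banach_mazur _ _ _ mu p p1 X.
have to_m := @ell_banach_mazur_property_m _ p p1 (subspace_of X).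
have to_compact := property_m_compact p2 cX.
(* The cycle runs from (i) to (ii) to (iii) to (i), against the direction of the three implications
   proved, so each arrow is a composite of two of them. *)
tfae.
- by move=> cB; apply: to_m => e e0; exact: to_ell.
- by move=> mX e e0; apply: to_ell => //; exact: to_compact.
- by move=> emb; apply: to_compact; exact: to_m.
Qed.
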